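(* Let $d\in\mathbb{N}$, fix an integer $0\le q<d$ and $t\in[0,1]$, and let $P$ be a stationary and ergodic probability measure on $\Omega=[0,1]^{\mathcal{K}^d}$ which is a product measure. Then there exists a constant $\sigma^2\ge0$ (depending on $d,q,t$) such that, as $n\to\infty$, $$\frac{1}{|\Lambda_n|}E\Big[\big(\beta_q^n(t)-E[\beta_q^n(t)]\big)^2\Big]\to\sigma^2$$ and $$\frac{1}{|\Lambda_n|^{1/2}}\big(\beta_q^n(t)-E[\beta_q^n(t)]\big)\Rightarrow\mathcal{N}(0,\sigma^2),$$ where $\Rightarrow$ denotes convergence in law and $\mathcal{N}(0,\sigma^2)$ is the centered Gaussian law with variance $\sigma^2$.
   Context: An elementary interval is $[l,l+1]$ or $[l]=[l,l]$ with $l\in\mathbb{Z}$; an elementary cube in $\mathbb{R}^d$ is a product of $d$ elementary intervals, of dimension equal to the number of nondegenerate factors; $\mathcal{K}^d$ is the set of all elementary cubes. A cubical set is a union of elementary cubes. For a cubical set $X$, $C_k(X)$ is the free $\mathbb{Z}$-module on the $k$-dimensional elementary cubes contained in $X$ with the standard cubical boundary operator; $H_k(X)$ is the resulting homology and, for bounded $X$, $\beta_k(X)$ is the rank of the free part of $H_k(X)$. $\Omega=[0,1]^{\mathcal{K}^d}$ with product topology and Borel $\sigma$-field, $\omega=(\omega_Q)_{Q\in\mathcal{K}^d}$; $\tau_x\omega=(\omega_{-x+Q})_Q$ for $x\in\mathbb{Z}^d$; stationarity: $P\circ\tau_x^{-1}=P$ for all $x$; ergodicity: translation-invariant events have probability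 $0$ or $1$; $E$ is expectation under $P$. $X(t)=\bigcup\{Q:\omega_Q\le t\}$, $\Lambda_n=[-n,n]^d$, $X^n(t)=X(t)\cap\Lambda_n$, $\beta_q^n(t)=\beta_q(X^n(t))$, $|\Lambda_n|=(2n)^d$. *)

(* Defs.v *)
From HB Require Import structures.
From mathcomp Require Import all_boot all_order all_algebra.
From mathcomp Require Import all_classical all_reals all_analysis.
Unset Printing Implicit Defensive.
Import Order.TTheory GRing.Theory Num.Theory.
Import numFieldNormedType.Exports.
Local Open Scope classical_set_scope.
Local Open Scope ring_scope.

(* Elementary cubes in R^d.  A cube is encoded by (l, e) with
   l : 'I_d -> int and e : 'I_d -> bool; the i-th factor is
   [l i, l i + 1] if e i, and the degenerate [l i] otherwise.          *)
Definition Cube (d : nat) := ({ffun 'I_d -> int} * {ffun 'I_d -> bool})%type.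

Definition cdim {d} (Q : Cube d) : nat := (\sum_(i < d) (Q.2 i : nat))%N.

Definition cube_pts {R : realType} {d} (Q : Cube d) : set ('I_d -> R) :=
  [set x | forall i, ((Q.1 i)%:~R <= x i) /\ (x i <= (Q.1 i + (Q.2 i : nat)%:Z)%:~R)].

Definition face_lo {d} (Q : Cube d) (i : 'I_d) : Cube d :=
  (Q.1, [ffun j => if j == i then false else Q.2 j]).
Definition face_hi {d} (Q : Cube d) (i : 'I_d) : Cube d :=
  ([ffun j => if j == i then Q.1 j + 1 else Q.1 j],
   [ffun j => if j == i then false else Q.2 j]).

(* coefficient of P in the standard cubical boundary of Q:
   d Q = sum over nondegenerate factors i of
         (-1)^(#nondegenerate factors before i) (face_hi Q i - face_lo Q i) *)
Definition incidence {d} (Q P : Cube d) : int :=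
  \sum_(i < d | Q.2 i)
     (-1) ^+ (\sum_(j < d | (j < i)%N) (Q.2 j : nat))%N *
     (((P == face_hi Q i) : nat)%:Z - ((P == face_lo Q i) : nat)%:Z).

Definition BoxT (d n : nat) : finType :=
  ({ffun 'I_d -> 'I_(2 * n + 1)} * {ffun 'I_d -> bool})%type.

Definition emb {d n} (b : BoxT d n) : Cube d :=
  ([ffun i => (b.1 i : nat)%:Z - n%:Z], b.2).

Definition is_chain {d n} (S : pred (BoxT d n)) (q : nat) (c : BoxT d n -> int) :=
  forall b, c b != 0 -> S b /\ cdim (emb b) = q.

Definition bdry {d n} (c : BoxT d n -> int) : BoxT d n -> int :=
  fun p => \sum_(b : BoxT d n) c b * incidence (emb b) (emb p).

(* "k cycles of C_q(S) that are Z-linearly independent modulo the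
   boundaries B_q(S)", i.e. k independent elements of H_q(S). *)
Definition indep_homology_family {d n} (S : pred (BoxT d n)) (q k : nat) : Prop :=
  exists z : 'I_k -> BoxT d n -> int,
    (forall j, is_chain S q (z j) /\ forall p, bdry (z j) p = 0) /\
    (forall c : 'I_k -> int,
       (exists b, is_chain S q.+1 b /\
          forall p, \sum_(j < k) c j * z j p = bdry b p) ->
       forall j, c j = 0).

(* rank of the free part of H_q(S) (S a finite set of cubes, closed
   under faces): maximal size of a Z-independent family in H_q(S). *)
Definition betti {d n} (S : pred (BoxT d n)) (q : nat) : nat :=
  (\max_(k < #|BoxT d n|.+1 | `[< indep_homology_family S q k >]) (k : nat))%N.

(* The configuration space.  Points omega : Cube d -> R carry the
   product topology; the sigma-field is the Borel one.  The space
   Omega = [0,1]^{K^d} is the subset where all coordinates lie in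
   [0,1]; probabilities are required to be carried by it.             *)
Definition Omega (d : nat) (R : realType) :=
  g_sigma_algebraType (@open {ptws Cube d -> R}).

Definition Lambda {R : realType} d (n : nat) : set ('I_d -> R) :=
  [set x | forall i, (- (n%:R) <= x i) /\ (x i <= n%:R)].

Definition Xt {R : realType} {d} (omega : Cube d -> R) (t : R) : set ('I_d -> R) :=
  [set x | exists Q : Cube d, omega Q <= t /\ cube_pts Q x].

Definition Xnt {R : realType} {d} (omega : Cube d -> R) (t : R) (n : nat) :=
  Xt omega t `&` @Lambda R d n.

(* the elementary cubes contained in X^n(t) (all lie in the box) *)
Definition cubes_in_Xnt {R : realType} {d} (omega : Cube d -> R) (t : R) (n : nat)
  : pred (BoxT d n) :=
  fun b => `[< cube_pts (emb b) `<=` Xnt omega t n >].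

Definition beta_qnt {R : realType} {d} (q n : nat) (t : R) (omega : Omega d R) : nat :=
  betti (cubes_in_Xnt omega t n) q.

Definition shift_cube {d} (x : {ffun 'I_d -> int}) (Q : Cube d) : Cube d :=
  ([ffun i => Q.1 i - x i], Q.2).
Definition tau {R : realType} {d} (x : {ffun 'I_d -> int}) (omega : Omega d R)
  : Omega d R := fun Q => omega (shift_cube x Q).

Definition supported_01 {R : realType} {d} (P : probability (Omega d R) R) :=
  P [set omega : Omega d R | forall Q, 0 <= omega Q <= 1] = 1%E.

Definition stationary {R : realType} {d} (P : probability (Omega d R) R) :=
  forall (x : {ffun 'I_d -> int}) (A : set (Omega d R)),
    measurable A -> P (tau x @^-1` A) = P A.

Definition ergodic {R : realType} {d} (P : probability (Omega d R) R) :=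
  forall A : set (Omega d R), measurable A ->
    (forall x : {ffun 'I_d -> int}, tau x @^-1` A = A) ->
    P A = 0%E \/ P A = 1%E.

Definition product_measure {R : realType} {d} (P : probability (Omega d R) R) :=
  forall (F : seq (Cube d)) (B : Cube d -> set R),
    uniq F -> (forall Q, measurable (B Q)) ->
    P [set omega : Omega d R | forall Q, Q \in F -> B Q (omega Q)] =
    (\prod_(Q <- F) P [set omega : Omega d R | B Q (omega Q)])%E.

Definition Ex {R : realType} {d} (P : probability (Omega d R) R)
  (f : Omega d R -> R) : R :=
  fine (\int[P]_omega (f omega)%:E)%E.

(* expectation of f under N(0, s2); N(0,0) is the Dirac mass at 0 *)
Definition gauss_expect {R : realType} (s2 : R) (f : R -> R) : \bar R :=
  if s2 == 0 then (f 0)%:E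
  else (\int[lebesgue_measure]_x (f x * normal_pdf 0 (Num.sqrt s2) x)%:E)%E.

Definition conv_in_law_gauss {R : realType} {d} (P : probability (Omega d R) R)
  (Y : nat -> Omega d R -> R) (s2 : R) : Prop :=
  forall f : R -> R, continuous f -> (exists M : R, forall x, `|f x| <= M) ->
    ((fun n => \int[P]_omega (f (Y n omega))%:E)%E @ \oo --> gauss_expect s2 f).

Definition vol {R : realType} (d n : nat) : R := ((2 * n)%:R) ^+ d.

(* Main.v *)
Require Import Defs.
From HB Require Import structures.
From mathcomp Require Import all_boot all_order all_algebra finmap.
From mathcomp Require Import all_classical all_reals all_analysis.
From mathcomp Require Import measurable_realfun ring lra zify.
Set Implicit Arguments.
Unset Strict Implicit.
Unset Printing Implicit Defensive.
Import Order.TTheory GRing.Theory Num.Theory.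
Import numFieldNormedType.Exports.
Local Open Scope classical_set_scope.
Local Open Scope fset_scope.
Local Open Scope ring_scope.

(* Put eta_Q = 1 when omega_Q <= t; these are independent bits whose law is
   invariant under translations.  Over rat, beta_q = n_q - r_q - r_{q+1}, where
   n_q counts the q-cubes and r_k is the rank of the k-dimensional boundary
   operator, so beta_q = u - v with u = n_q and v = r_q + r_{q+1}, two monotone
   submodular functions of the set of cubes with bounded increments.  By
   submodularity the increment of u or v caused by adding one cube decreases
   when the window grows, so that its expectation converges, and increments
   computed in two windows containing a large ball around the cube are close in
   L^1.  The Efron-Stein inequality then shows that beta_q of the box differs
   from the sum of the values in disjoint blocks of side L by a variable of
   variance at most delta_L |Lambda_n|, with delta_L -> 0.  The block sums are sums of
   i.i.d. bounded variables.  Hence the normalized variances are Cauchy, and the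
   central limit theorem follows by letting n, then L, go to infinity.

   For the block sums, averaging the Gaussian kernel K_s over a centered step Y
   of variance v turns it into K_{s+v} up to an error of third order; iterating,
   the law of the sum mollified by K_s has a density converging pointwise, hence
   in L^1 (Scheffe), to K_{s+tau}, where tau is the limiting variance. *)

(** * Finite Bernoulli expectations *)

(** The increments of beta_q itself have no sign and no monotonicity in the configuration, so no
    monotone limit argument applies to them; this is why u and v are treated separately and
    recombined only in the final variance bound. Cubes closer to the boundary of their block than
    the stabilization radius are controlled only by the uniform bound on increments. They must be a
    small fraction of all cubes, which forces the order of choices: radius, then block side, then
    box. For fixed n only finitely many bits matter, so integrals under P reduce to finite weighted
    sums, and independence becomes the possibility of summing over one group of bits after another.
    A function of finitely many bits has a discrete law, so Scheffe's argument cannot be applied to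
    it directly. Mollifying by a Gaussian supplies a density, and the heat equation makes the
    second-order terms of the two expansions agree. The mollifier has variance h > 0, so the total
    variance h + tau stays positive and the degenerate case of limit variance 0 needs separate care
    only when h tends to 0. *)

Section FiniteExpectation.
Context {R : realType} {K : choiceType}.
Implicit Types (p : K -> R) (s : seq K) (F G : {fset K} -> R) (A W : {fset K}).

(** For duplicate-free [s] this is the expectation of [F] at a random subset of [s] that contains
    each [Q] independently with probability [p Q]. The recursion on the list turns conditioning on
    one bit into a computation step. *)
Fixpoint Ebern p s F : R :=
  if s is Q :: s' then
    p Q * Ebern p s' (fun A => F (Q |` A)) + (1 - p Q) * Ebern p s' F
  else F fset0.

Lemma Ebern_ext_in p s F G : (forall A, {subset A <= s} -> F A = G A) ->
  Ebern p s F = Ebern p s G.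
Proof.
elim: s F G => [|Q s IH] F G FG /=; first by apply: FG => x; rewrite in_fset0.
congr (_ * _ + _ * _); apply: IH => A sA; apply: FG => x.
  by rewrite !inE => /orP[->//|/sA ->]; rewrite orbT.
by move=> /sA xs; rewrite inE xs orbT.
Qed.

Lemma Ebern_ext p s F G : F =1 G -> Ebern p s F = Ebern p s G.
Proof. by move=> FG; apply: Ebern_ext_in. Qed.

Lemma EbernD p s F G : Ebern p s (fun A => F A + G A) = Ebern p s F + Ebern p s G.
Proof. by elim: s F G => [//|Q s IH] F G /=; rewrite !IH; ring. Qed.

Lemma EbernZ p s (c : R) F : Ebern p s (fun A => c * F A) = c * Ebern p s F.
Proof. by elim: s F => [//|Q s IH] F /=; rewrite !IH; ring. Qed.

Lemma EbernB p s F G : Ebern p s (fun A => F A - G A) = Ebern p s F - Ebern p s G.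
Proof. by elim: s F G => [//|Q s IH] F G /=; rewrite !IH; ring. Qed.

Lemma Ebern_cst p s (c : R) : Ebern p s (fun=> c) = c.
Proof. by elim: s => [//|Q s IH] /=; rewrite !IH; ring. Qed.

Lemma Ebern_sum (I : Type) (r : seq I) p s (F : I -> {fset K} -> R) :
  Ebern p s (fun A => \sum_(i <- r) F i A) = \sum_(i <- r) Ebern p s (F i).
Proof.
elim: r => [|i r IH].
  rewrite big_nil -[RHS](Ebern_cst p s); apply: Ebern_ext => A.
  by rewrite big_nil.
by rewrite big_cons -IH -EbernD; apply: Ebern_ext => A; rewrite big_cons.
Qed.

Lemma Ebern_perm p s s' F : perm_eq s s' -> Ebern p s F = Ebern p s' F.
Proof.
have swap Q Q' t G : Ebern p [:: Q, Q' & t] G = Ebern p [:: Q', Q & t] G.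
  rewrite /= [in LHS](@Ebern_ext _ _ (fun A => G (Q |` (Q' |` A)))
    (fun A => G (Q' |` (Q |` A)))); last by move=> A; rewrite fsetUCA.
  by ring.
have mid t1 t2 Q G : Ebern p (t1 ++ Q :: t2) G = Ebern p (Q :: t1 ++ t2) G.
  elim: t1 G => [//|Q' t1 IH] G; rewrite [RHS]swap.
  by rewrite cat_cons /= -!/(Ebern p (Q :: _) _) !IH.
elim: s s' F => [|Q s IH] s' F ss'; first by move: ss'; rewrite perm_sym => /perm_nilP ->.
have Qs' : Q \in s' by rewrite -(perm_mem ss') mem_head.
case/splitPr: Qs' ss' => t1 t2; rewrite perm_sym perm_catC cat_cons perm_cons perm_catC perm_sym.
by move=> H; rewrite mid /= !(IH _ _ H).
Qed.

Lemma Ebern_filter p s F W :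
  Ebern p s (fun A => F (A `&` W)) = Ebern p [seq Q <- s | Q \in W] F.
Proof.
elim: s F => [|Q s IH] F /=; first by rewrite fset0I.
case: ifP => QW /=.
  rewrite -!IH; congr (_ * _ + _); apply: Ebern_ext => A.
  by rewrite fsetIUl (fsetIidPl _) // fsub1set.
rewrite -IH [X in _ * X + _](@Ebern_ext _ _ _ (fun A => F (A `&` W))); first by ring.
move=> A; rewrite fsetIUl [X in X `|` _](_ : _ = fset0) ?fset0U//.
by apply/fsetP => x; rewrite !inE; case: eqP => // ->; rewrite QW.
Qed.

Lemma Ebern_cat p s s' F :
  Ebern p (s ++ s') F = Ebern p s (fun A => Ebern p s' (fun B => F (A `|` B))).
Proof.
elim: s F => [|Q s IH] F /=; first by apply: Ebern_ext => A; rewrite fset0U.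
rewrite !IH; congr (_ * _ + _); apply: Ebern_ext => A.
by apply: Ebern_ext => B; rewrite fsetUA.
Qed.

Lemma Ebern_map p (f : K -> K) s F : (forall Q, p (f Q) = p Q) ->
  Ebern p (map f s) F = Ebern p s (fun A => F [fset f x | x in A]).
Proof.
move=> pf; elim: s F => [|Q s IH] F /=; first by rewrite imfset0.
rewrite !IH pf; congr (_ * _ + _); apply: Ebern_ext => A.
by rewrite imfsetU imfset_fset1.
Qed.

Lemma Ebern_restrict p s F W : uniq s -> {subset W <= s} ->
  Ebern p s (fun A => F (A `&` W)) = Ebern p W F.
Proof.
move=> us Ws; rewrite Ebern_filter; apply: Ebern_perm; apply: uniq_perm.
- exact: filter_uniq.
- exact: fset_uniq.
- by move=> x; rewrite mem_filter; case: (boolP (x \in W)) => // /Ws ->.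
Qed.

Section Bernoulli.
Variable p : K -> R.
Hypothesis p01 : forall Q, 0 <= p Q <= 1.

Lemma Ebern_le_in s F G : (forall A, {subset A <= s} -> F A <= G A) ->
  Ebern p s F <= Ebern p s G.
Proof.
elim: s F G => [|Q s IH] F G FG /=; first by apply: FG => x; rewrite in_fset0.
have /andP[p0 p1] := p01 Q.
apply: lerD; apply: ler_wpM2l => //; rewrite ?subr_ge0//; apply: IH => A sA;
    apply: FG => x.
  by rewrite !inE => /orP[->//|/sA ->]; rewrite orbT.
by move=> /sA xs; rewrite inE xs orbT.
Qed.

Lemma Ebern_le s F G : (forall A, F A <= G A) -> Ebern p s F <= Ebern p s G.
Proof. by move=> FG; apply: Ebern_le_in. Qed.

Lemma Ebern_ge0 s F : (forall A, 0 <= F A) -> 0 <= Ebern p s F.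
Proof. by move=> F0; rewrite -(Ebern_cst p s 0); exact: Ebern_le. Qed.

Lemma Ebern_norm s F : `|Ebern p s F| <= Ebern p s (fun A => `|F A|).
Proof.
rewrite ler_norml -{1}[X in - X]mul1r -mulNr -EbernZ.
by apply/andP; split; apply: Ebern_le => A; rewrite ?mulN1r ?ler_norm// lerNl -normrN ler_norm.
Qed.

Lemma Ebern_sqr_le s F : Ebern p s F ^+ 2 <= Ebern p s (fun A => F A ^+ 2).
Proof.
set m := Ebern p s F.
suff : 0 <= Ebern p s (fun A => F A ^+ 2) - m ^+ 2 by rewrite subr_ge0.
have -> : Ebern p s (fun A => F A ^+ 2) - m ^+ 2 = Ebern p s (fun A => (F A - m) ^+ 2).
  rewrite (@Ebern_ext _ _ (fun A => (F A - m) ^+ 2)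
    (fun A => F A ^+ 2 - (2 * m) * F A + m ^+ 2)); last by move=> A; ring.
  by rewrite EbernD EbernB EbernZ Ebern_cst -/m; ring.
by apply: Ebern_ge0 => A; exact: sqr_ge0.
Qed.

Definition Vbern s F := Ebern p s (fun A => (F A - Ebern p s F) ^+ 2).

Lemma VbernE s F : Vbern s F = Ebern p s (fun A => F A ^+ 2) - Ebern p s F ^+ 2.
Proof.
rewrite /Vbern; set m := Ebern p s F.
rewrite (@Ebern_ext _ _ (fun A => (F A - m) ^+ 2)
    (fun A => F A ^+ 2 - (2 * m) * F A + m ^+ 2)); last by move=> A; ring.
by rewrite EbernD EbernB EbernZ Ebern_cst -/m; ring.
Qed.

(** Conditioning on the first bit splits the variance into the mean of the two conditional
    variances, handled by induction, and p(1-p) times the squared difference of the conditional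
    means. Jensen bounds that square by the mean squared effect of the bit, and the factor p(1-p) is
    bounded by 1. *)
Lemma Efron_Stein s F : uniq s ->
  Vbern s F <= \sum_(Q <- s) Ebern p s (fun A => (F (Q |` A) - F (A `\ Q)) ^+ 2).
Proof.
elim: s F => [|Q s IH] F; first by rewrite big_nil VbernE /= subrr.
move=> /= /andP[Qs us]; rewrite VbernE /= big_cons.
have /andP[p0 p1] := p01 Q.
have := IH (fun A => F (Q |` A)) us; have := IH F us.
rewrite !VbernE; set a1 := Ebern p s F; set b1 := Ebern p s (fun A => F (Q |` A)).
set a2 := Ebern p s (fun A => F A ^+ 2); set b2 := Ebern p s (fun A => F (Q |` A) ^+ 2).
set U := \sum_(_ <- s) _ => hU; set V := \sum_(_ <- s) _ => hV.
rewrite [X in _ <= _ + X](_ : _ = p Q * V + (1 - p Q) * U); last first.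
  rewrite !mulr_sumr -big_split; apply: eq_big_seq => Q' Q's /=.
  have QQ' : Q != Q' by apply: contraNneq Qs => ->.
  congr (_ * _ + _); apply: Ebern_ext => A; congr ((_ - _) ^+ 2).
    by rewrite fsetUCA.
  congr F; apply/fsetP => x; rewrite !inE; case: (eqVneq x Q) => [->|_].
    by rewrite QQ'.
  by [].
have D A : {subset A <= s} -> (Q |` A) `\ Q = A /\ A `\ Q = A.
  move=> sA; have QA : Q \notin A by apply: contra Qs; exact: sA.
  split; apply/fsetP => x; rewrite !inE; case: eqP => //= ->;
  by rewrite (negbTE QA).
rewrite [X in _ <= X + _](_ : _ =
    Ebern p s (fun A => (F (Q |` A) - F A) ^+ 2)); last first.
  set e := RHS.
  rewrite (@Ebern_ext_in _ _ _ (fun A => (F (Q |` A) - F A) ^+ 2)); last first.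
    by move=> A /D[-> _]; rewrite fsetUA fsetUid.
  rewrite (@Ebern_ext_in _ _ (fun A => (F (Q |` A) - F (A `\ Q)) ^+ 2)
     (fun A => (F (Q |` A) - F A) ^+ 2)) -/e; first by ring.
  by move=> A /D[_ ->].
have : (b1 - a1) ^+ 2 <= Ebern p s (fun A => (F (Q |` A) - F A) ^+ 2).
  by rewrite -EbernB; exact: Ebern_sqr_le.
set e := Ebern _ _ _; move=> he.
have h1 : p Q * (b2 - b1 ^+ 2) <= p Q * V by rewrite ler_wpM2l.
have h2 : (1 - p Q) * (a2 - a1 ^+ 2) <= (1 - p Q) * U.
  by rewrite ler_wpM2l// subr_ge0.
have h3 : p Q * (1 - p Q) * (b1 - a1) ^+ 2 <= e.
  have e0 := sqr_ge0 (b1 - a1).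
  apply: le_trans he; rewrite ler_piMl//; nra.
nra.
Qed.

End Bernoulli.
End FiniteExpectation.

(** * The Gaussian kernel *)

Section GaussianKernel.
Context {R : realType}.
Implicit Types s x a y t : R.

Definition gauss_const : R := (Num.sqrt (pi *+ 2))^-1.
(** The density of N(0, s), parametrized by the variance. The factor s^(-1/2) is put into the
    exponent so that differentiation in s only meets [expR], [ln] and the inverse. The indices 1, 2,
    3 below count derivatives in x, and [gaussK22] is the second derivative in s. *)
Definition gaussK s x : R := gauss_const * expR (- (ln s / 2) - x ^+ 2 / (2 * s)).
Definition gaussK1 s x : R := - (x / s) * gaussK s x.
Definition gaussK2 s x : R := ((x / s) ^+ 2 - s^-1) * gaussK s x.
Definition gaussK3 s x : R := (- (x / s) ^+ 3 + 3 * (x / s) / s) * gaussK s x.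
Definition gaussK22 s x : R :=
  (2^-1 * (- (2 * (x / s) ^+ 2 / s) + (s ^+ 2)^-1) +
   4^-1 * ((x / s) ^+ 2 - s^-1) ^+ 2) * gaussK s x.

Lemma is_derive_gaussK s x : 0 < s -> is_derive x 1 (gaussK s) (gaussK1 s x).
Proof.
move=> s0; rewrite /gaussK1 /gaussK.
have E : is_derive x 1 (fun x => - (ln s / 2) - x ^+ 2 / (2 * s)) (- (x / s)).
  apply: is_derive_eq; rewrite /GRing.scale /=; field; lra.
have E2 := is_derive1_comp (is_derive_expR _) E.
by apply: is_derive_eq; rewrite /GRing.scale /=; ring.
Qed.

Lemma is_derive_gaussK1 s x : 0 < s -> is_derive x 1 (gaussK1 s) (gaussK2 s x).
Proof.
move=> s0; rewrite /gaussK1; have K' := is_derive_gaussK x s0.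
by apply: is_derive_eq; rewrite /GRing.scale /= /gaussK2 /gaussK1; field; lra.
Qed.

Lemma is_derive_gaussK2 s x : 0 < s -> is_derive x 1 (gaussK2 s) (gaussK3 s x).
Proof.
move=> s0; rewrite /gaussK2; have K' := is_derive_gaussK x s0.
by apply: is_derive_eq; rewrite /GRing.scale /= /gaussK3 /gaussK1; field; lra.
Qed.

Lemma is_derive_inv s : 0 < s -> is_derive s 1 (fun s => s^-1 : R) (- (s ^+ 2)^-1).
Proof.
move=> s0; have := @is_deriveV R id s 1 1 (lt0r_neq0 s0) (is_derive_id _ _).
by move=> H; apply: is_derive_eq; rewrite /GRing.scale /=; field; lra.
Qed.

(** The heat equation: increasing the variance acts as half the second derivative in space. *)
Lemma is_derive_gaussK_var s x : 0 < s ->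
  is_derive s 1 (gaussK^~ x) (2^-1 * gaussK2 s x).
Proof.
move=> s0; rewrite /gaussK2 /gaussK.
have V := is_derive_inv s0.
have L := is_derive1_ln s0.
have E : is_derive s 1 (fun s => - (ln s / 2) - x ^+ 2 / (2 * s))
   (2^-1 * ((x / s) ^+ 2 - s^-1)).
  rewrite (_ : (fun s => _) = (fun s => - (ln s / 2) - x ^+ 2 * 2^-1 * s^-1)).
    by apply: is_derive_eq; rewrite /GRing.scale /=; field; lra.
  by apply/funext => s'; rewrite invfM; ring.
have E2 := is_derive1_comp (is_derive_expR _) E.
by apply: is_derive_eq; rewrite /GRing.scale /=; ring.
Qed.

Lemma is_derive_gaussK2_var s x : 0 < s ->
  is_derive s 1 (fun s => 2^-1 * gaussK2 s x) (gaussK22 s x).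
Proof.
move=> s0; rewrite /gaussK2.
have V := is_derive_inv s0; have K' := is_derive_gaussK_var x s0.
by apply: is_derive_eq; rewrite /GRing.scale /= /gaussK22 /gaussK2; field; lra.
Qed.

Lemma gauss_const_gt0 : 0 < gauss_const.
Proof. by rewrite invr_gt0 sqrtr_gt0 mulrn_wgt0// pi_gt0. Qed.

Lemma gauss_const_ge0 : 0 <= gauss_const. Proof. exact/ltW/gauss_const_gt0. Qed.

Lemma gaussK_ge0 s x : 0 <= gaussK s x.
Proof. by rewrite mulr_ge0 ?expR_ge0 ?gauss_const_ge0. Qed.

Lemma gaussK_even s x : gaussK s (- x) = gaussK s x.
Proof. by rewrite /gaussK sqrrN. Qed.

Lemma expR_quadratic (w : R) : 0 <= w -> (1 + w) ^+ 2 * expR (- w) <= 8.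
Proof.
move=> w0; rewrite expRN ler_pdivrMr ?expR_gt0//.
have := expR_ge1Dxn 1 w0; have := expR_ge1Dx w; rewrite (_ : 2`!%:R = 2 :> R)//.
move=> h1 h2; have : w ^+ 2 / 2 <= expR w - 1 by lra.
nra.
Qed.

(** With w = x^2 / (2s) one has (x/s)^2 = w (2/s), at most w (2/s0) for s >= s0, and the exponential
    absorbs (1 + w)^2 at the cost of the 8 of [expR_quadratic]. Degree four in x/s is what the
    second derivative in s requires, and uniformity in s >= s0 lets all steps of a sum share one
    error bound. *)
Definition gauss_bound s0 : R :=
  gauss_const * expR (- (ln s0 / 2)) * (8 * (1 + 2 / s0) ^+ 2).

Lemma gauss_bound_ge0 s0 : 0 <= gauss_bound s0.
Proof.
apply: mulr_ge0; first by rewrite mulr_ge0 ?expR_ge0 ?gauss_const_ge0.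
by apply: mulr_ge0 => //; exact: sqr_ge0.
Qed.

Lemma gaussK_quadratic s0 s x : 0 < s0 -> s0 <= s ->
  (1 + (x / s) ^+ 2) ^+ 2 * gaussK s x <= gauss_bound s0.
Proof.
move=> s00 ss; have s_gt0 : 0 < s by lra.
pose w := x ^+ 2 / (2 * s); have w0 : 0 <= w by rewrite divr_ge0 ?sqr_ge0//; lra.
have uw : (x / s) ^+ 2 = w * (2 / s) by rewrite /w; field; lra.
have hs : 2 / s <= 2 / s0 by rewrite ler_pM2l// lef_pV2 ?posrE.
have i0 : 0 < 2 / s by rewrite divr_gt0.
have h1 : (1 + (x / s) ^+ 2) ^+ 2 <= (1 + 2 / s0) ^+ 2 * (1 + w) ^+ 2.
  rewrite -exprMn lerXn2r ?nnegrE//; have := ler_wpM2l w0 hs; have := sqr_ge0 (x / s); nra.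
have lnss : expR (- (ln s / 2)) <= expR (- (ln s0 / 2)).
  by rewrite ler_expR lerN2 ler_pM2r// ler_ln ?posrE.
have h2 := expR_quadratic w0.
rewrite /gaussK -/w expRD /gauss_bound.
have c0 := gauss_const_gt0; have e0 := expR_ge0 (- (ln s0 / 2)).
have e1 := expR_ge0 (- (ln s / 2)); have e2 := expR_ge0 (- w).
apply: le_trans (ler_wpM2r _ h1) _; first by rewrite !mulr_ge0 ?gauss_const_ge0.
rewrite [leLHS](_ : _ = (gauss_const * expR (- (ln s / 2))) *
   (((1 + w) ^+ 2 * expR (- w)) * (1 + 2 / s0) ^+ 2)); last by ring.
apply: ler_pM.
- by rewrite mulr_ge0 ?gauss_const_ge0.
- by apply: mulr_ge0; [apply: mulr_ge0 => //|]; exact: sqr_ge0.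
- by rewrite ler_pM2l.
- by rewrite ler_wpM2r// sqr_ge0.
Qed.

Definition gauss_bound3 s0 : R := (1 + 3 / s0) * gauss_bound s0.
Definition gauss_bound22 s0 : R := (1 + s0^-1) ^+ 2 * gauss_bound s0.

Lemma gaussK3_le s0 s x : 0 < s0 -> s0 <= s -> `|gaussK3 s x| <= gauss_bound3 s0.
Proof.
move=> s00 ss; have s_gt0 : 0 < s by lra.
have hs : s^-1 <= s0^-1 by rewrite lef_pV2 ?posrE.
have i0 : 0 < s^-1 by rewrite invr_gt0.
have K0 := gaussK_ge0 s x.
rewrite /gaussK3 normrM (ger0_norm K0) /gauss_bound3; set u := x / s.
have hu : `|u| <= 1 + u ^+ 2.
  by rewrite -(real_normK (num_real u)); have := normr_ge0 u; nra.
have -> : - u ^+ 3 + 3 * u / s = u * (3 * s^-1 - u ^+ 2) by ring.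
have h1 : `|u * (3 * s^-1 - u ^+ 2)| <= (1 + 3 / s0) * (1 + u ^+ 2) ^+ 2.
  have A : `|3 * s^-1 - u ^+ 2| <= (1 + 3 / s0) * (1 + u ^+ 2).
    have u2 := sqr_ge0 u; have i1 : 0 < s0^-1 by rewrite invr_gt0.
    rewrite ler_norml; apply/andP; split; nra.
  rewrite normrM (_ : (1 + 3 / s0) * _ =
    (1 + u ^+ 2) * ((1 + 3 / s0) * (1 + u ^+ 2))); last by ring.
  by rewrite ler_pM.
apply: le_trans (ler_wpM2r K0 h1) _; rewrite -mulrA ler_wpM2l//.
  by rewrite addr_ge0// divr_ge0// ltW.
exact: gaussK_quadratic.
Qed.

Lemma gaussK22_le s0 s x : 0 < s0 -> s0 <= s -> `|gaussK22 s x| <= gauss_bound22 s0.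
Proof.
move=> s00 ss; have s_gt0 : 0 < s by lra.
have hs : s^-1 <= s0^-1 by rewrite lef_pV2 ?posrE.
have i0 : 0 < s^-1 by rewrite invr_gt0.
have K0 := gaussK_ge0 s x.
rewrite /gaussK22 normrM (ger0_norm K0) /gauss_bound22 -exprVn; set u := x / s.
have u2 := sqr_ge0 u; move: i0 hs; set i := s^-1; set i0 := s0^-1 => ip ii.
have h1 : `|2^-1 * (- (2 * u ^+ 2 * i) + i ^+ 2) + 4^-1 * (u ^+ 2 - i) ^+ 2| <=
   (1 + i0) ^+ 2 * (1 + u ^+ 2) ^+ 2.
  have A : (u ^+ 2 + i) ^+ 2 <= (1 + i0) ^+ 2 * (1 + u ^+ 2) ^+ 2.
    by rewrite -exprMn lerXn2r ?nnegrE; nra.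
  apply: le_trans A; rewrite ler_norml; apply/andP; split; nra.
apply: le_trans (ler_wpM2r K0 h1) _; rewrite -mulrA ler_wpM2l ?sqr_ge0//.
exact: gaussK_quadratic.
Qed.

End GaussianKernel.

(** * Taylor estimates on the unit interval *)

Section Taylor.
Context {R : realType}.
Implicit Types (f g : R -> R) (B : R).

Lemma unit_increment_le g g1 B :
  (forall t : R, 0 <= t <= 1 -> is_derive t 1 g (g1 t)) ->
  (forall t : R, 0 <= t <= 1 -> `|g1 t| <= B) ->
  forall t : R, 0 <= t <= 1 -> `|g t - g 0| <= B.
Proof.
move=> dg g1B t /andP[t0 t1].
have dgt x : x \in `]0, t[ -> is_derive x 1 g (g1 x).
  by rewrite in_itv /= => /andP[x0 xt]; apply: dg; lra.
have cgt : {within `[0, t], continuous g}.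
  apply: derivable_within_continuous => x; rewrite in_itv /= => /andP[x0 xt].
  have h : 0 <= x <= 1 by lra.
  by have := dg x h => -[].
have [x x0t ->] := MVT_segment t0 dgt cgt.
move: x0t; rewrite in_itv /= subr0 normrM (ger0_norm t0) => /andP[x0 xt].
have h : 0 <= x <= 1 by lra.
have := g1B x h; have := normr_ge0 (g1 x); nra.
Qed.

(** The mean value bound is applied to three successive remainders; the factorial of the sharp
    remainder is given up. *)
Lemma taylor2_unit f f1 f2 f3 B :
  (forall t : R, 0 <= t <= 1 -> is_derive t 1 f (f1 t)) ->
  (forall t : R, 0 <= t <= 1 -> is_derive t 1 f1 (f2 t)) ->
  (forall t : R, 0 <= t <= 1 -> is_derive t 1 f2 (f3 t)) ->
  (forall t : R, 0 <= t <= 1 -> `|f3 t| <= B) ->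
  `|f 1 - f 0 - f1 0 - f2 0 / 2| <= B.
Proof.
move=> d1 d2 d3 f3B.
have h2 := unit_increment_le d3 f3B.
have h1 (t : R) : 0 <= t <= 1 -> `|(f1 t - f2 0 * t) - (f1 0 - f2 0 * 0)| <= B.
  apply: (@unit_increment_le (fun t => f1 t - f2 0 * t) (fun t => f2 t - f2 0)) => // u hu.
  have D := d2 u hu.
  by apply: is_derive_eq; rewrite /GRing.scale /=; ring.
have := @unit_increment_le (fun t => f t - f1 0 * t - f2 0 * (t ^+ 2 / 2))
  (fun t => (f1 t - f2 0 * t) - (f1 0 - f2 0 * 0)) B _ h1 1.
rewrite (_ : _ - _ - _ - (_ - _ - _) = f 1 - f 0 - f1 0 - f2 0 / 2); last by field.
apply; last by lra.
move=> u hu; have D := d1 u hu.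
by apply: is_derive_eq; rewrite /GRing.scale /=; field.
Qed.

Lemma taylor1_unit f f1 f2 B :
  (forall t : R, 0 <= t <= 1 -> is_derive t 1 f (f1 t)) ->
  (forall t : R, 0 <= t <= 1 -> is_derive t 1 f1 (f2 t)) ->
  (forall t : R, 0 <= t <= 1 -> `|f2 t| <= B) ->
  `|f 1 - f 0 - f1 0| <= B.
Proof.
move=> d1 d2 f2B.
have h1 := unit_increment_le d2 f2B.
have := @unit_increment_le (fun t => f t - f1 0 * t) (fun t => f1 t - f1 0) B _ h1 1.
rewrite (_ : _ - _ - (_ - _) = f 1 - f 0 - f1 0); last by ring.
apply; last by lra.
move=> u hu; have D := d1 u hu.
by apply: is_derive_eq; rewrite /GRing.scale /=; ring.
Qed.

End Taylor.

Lemma is_derive_affine (R : realType) (F : R -> R) (a y t df : R) :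
  is_derive (a + y * t) 1 F df -> is_derive t 1 (fun t => F (a + y * t)) (y * df).
Proof.
move=> DF; have aff : is_derive t 1 (fun t : R => a + y * t) y.
  by apply: is_derive_eq; rewrite /GRing.scale /=; ring.
have D := @is_derive1_comp R F (fun t => a + y * t) t df y DF aff.
by apply: is_derive_eq D _; rewrite mulrC.
Qed.

(** * Lindeberg replacement: a centered step traded for extra variance *)

Section KernelStep.
Context {R : realType} {K : choiceType}.
Variables (p : K -> R) (S : seq K) (Y : {fset K} -> R) (M : R).
Hypotheses (p01 : forall Q, 0 <= p Q <= 1) (YM : forall A, `|Y A| <= M).
Hypothesis Y0 : Ebern p S Y = 0.
Let v := Ebern p S (fun A => Y A ^+ 2).

Lemma gaussK_space (s0 s a y : R) : 0 < s0 -> s0 <= s ->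
  `|gaussK s (a + y) - gaussK s a - y * gaussK1 s a - y ^+ 2 * gaussK2 s a / 2|
   <= gauss_bound3 s0 * `|y| ^+ 3.
Proof.
move=> s00 ss; have s_gt0 : 0 < s by lra.
have := @taylor2_unit R (fun t => gaussK s (a + y * t))
  (fun t => y * gaussK1 s (a + y * t)) (fun t => y ^+ 2 * gaussK2 s (a + y * t))
  (fun t => y ^+ 3 * gaussK3 s (a + y * t)) (gauss_bound3 s0 * `|y| ^+ 3).
rewrite !mulr1 !mulr0 !addr0; apply.
- by move=> t _; apply: is_derive_affine; exact: is_derive_gaussK.
- move=> t _; have D := is_derive_affine (is_derive_gaussK1 (a + y * t) s_gt0).
  by apply: is_derive_eq; rewrite /GRing.scale /=; ring.
- move=> t _; have D := is_derive_affine (is_derive_gaussK2 (a + y * t) s_gt0).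
  by apply: is_derive_eq; rewrite /GRing.scale /=; ring.
- move=> t _; rewrite normrM normrX mulrC ler_wpM2r ?exprn_ge0//.
  exact: gaussK3_le.
Qed.

Lemma gaussK_time (s0 s a e : R) : 0 < s0 -> s0 <= s -> 0 <= e ->
  `|gaussK (s + e) a - gaussK s a - e * (2^-1 * gaussK2 s a)|
   <= gauss_bound22 s0 * e ^+ 2.
Proof.
move=> s00 ss e0.
have st (t : R) : 0 <= t <= 1 -> 0 < s + e * t by move=> /andP[t0 _]; have := mulr_ge0 e0 t0; lra.
have := @taylor1_unit R (fun t => gaussK (s + e * t) a)
  (fun t => e * (2^-1 * gaussK2 (s + e * t) a))
  (fun t => e ^+ 2 * gaussK22 (s + e * t) a) (gauss_bound22 s0 * e ^+ 2).
rewrite !mulr1 !mulr0 !addr0; apply.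
- move=> t /st t0; exact: (is_derive_affine (is_derive_gaussK_var a t0)).
- move=> t /st t0; have D := is_derive_affine (is_derive_gaussK2_var a t0).
  by apply: is_derive_eq; rewrite /GRing.scale /=; ring.
- move=> t /andP[t0 _]; rewrite normrM normrX (ger0_norm e0) mulrC ler_wpM2r ?exprn_ge0//.
  by apply: gaussK22_le => //; have := mulr_ge0 e0 t0; lra.
Qed.

Definition step_bound (s0 x : R) : R := gauss_bound3 s0 * x ^+ 3 + gauss_bound22 s0 * x ^+ 4.

(** Expand in space to second order: the linear term vanishes as [Y] is centered, and the quadratic
    one is c^2 v K''/2. Expanding in the variance to first order gives the same term by the heat
    equation. What remains is of order c^3 from space and c^4 from the variance. *)
Lemma kernel_step (s0 s a c : R) : 0 < s0 -> s0 <= s -> 0 <= c ->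
  `|Ebern p S (fun A => gaussK s (a + c * Y A)) - gaussK (s + c ^+ 2 * v) a|
  <= step_bound s0 (c * M).
Proof.
move=> s00 ss c0.
have M0 : 0 <= M by apply: le_trans (normr_ge0 _) (YM fset0).
have v0 : 0 <= v by apply: Ebern_ge0 => // A; exact: sqr_ge0.
have vM : v <= M ^+ 2.
  rewrite -[leRHS](Ebern_cst p S); apply: Ebern_le => // A.
  by rewrite -(real_normK (num_real (Y A))) lerXn2r ?nnegrE.
have e0 : 0 <= c ^+ 2 * v by rewrite mulr_ge0 ?sqr_ge0.
have time := gaussK_time a s00 ss e0.
have space : `|Ebern p S (fun A => gaussK s (a + c * Y A)) - gaussK s a
     - c ^+ 2 * v * (2^-1 * gaussK2 s a)| <= gauss_bound3 s0 * (c * M) ^+ 3.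
  rewrite (_ : _ - _ - _ = Ebern p S (fun A => gaussK s (a + c * Y A) - gaussK s a
     - (c * Y A) * gaussK1 s a - (c * Y A) ^+ 2 * gaussK2 s a / 2)); last first.
    rewrite (@Ebern_ext _ _ p S (fun A => _ - _ - _ - _) (fun A => gaussK s (a + c * Y A)
      - gaussK s a - (c * gaussK1 s a) * Y A - (c ^+ 2 * gaussK2 s a / 2) * Y A ^+ 2)).
      rewrite !EbernB Ebern_cst; set E0 := Ebern p S (fun A => gaussK _ _).
      by rewrite !EbernZ Y0 -/v; field.
    by move=> A; ring.
  apply: le_trans (Ebern_norm p01 _ _) _; rewrite -[leRHS](Ebern_cst p S).
  apply: Ebern_le => // A; apply: le_trans (gaussK_space _ _ s00 ss) _.
  rewrite ler_wpM2l//.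
    by rewrite mulr_ge0 ?gauss_bound_ge0// addr_ge0// divr_ge0// ltW.
  by rewrite lerXn2r ?nnegrE ?mulr_ge0// normrM (ger0_norm c0) ler_wpM2l.
have h22 : gauss_bound22 s0 * (c ^+ 2 * v) ^+ 2 <= gauss_bound22 s0 * (c * M) ^+ 4.
  rewrite ler_wpM2l//; first by rewrite mulr_ge0 ?gauss_bound_ge0 ?sqr_ge0.
  rewrite [leRHS](_ : _ = (c ^+ 2 * M ^+ 2) ^+ 2); last by ring.
  by rewrite lerXn2r ?nnegrE ?mulr_ge0 ?sqr_ge0// ler_wpM2l ?sqr_ge0.
rewrite /step_bound; apply: le_trans (lerD space (le_trans time h22)).
rewrite [X in `|X| + _](_ : _ = (Ebern p S (fun A => gaussK s (a + c * Y A)) - 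
   gaussK (s + c ^+ 2 * v) a) + (gaussK (s + c ^+ 2 * v) a - gaussK s a -
   c ^+ 2 * v * (2^-1 * gaussK2 s a))); last by ring.
set x := Ebern _ _ _ - _; set y := _ - _ - _; rewrite -[x in `|x|](addrK y).
exact: ler_normB.
Qed.

Definition random_step (c : R) (Phi : R -> R) (a : R) : R :=
  Ebern p S (fun A => Phi (a + c * Y A)).

(** Averaging does not increase the sup norm, so the errors of the steps add up. The variance only
    grows along the way, so the bound taken at the initial s serves every step. *)
Lemma random_step_iter m (s c a : R) : 0 < s -> 0 <= c ->
  `|iter m (random_step c) (gaussK s) a - gaussK (s + m%:R * (c ^+ 2 * v)) a|
  <= m%:R * step_bound s (c * M).
Proof.
move=> s0 c0; have v0 : 0 <= v by apply: Ebern_ge0 => // A; exact: sqr_ge0.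
elim: m a => [|m IH] a; first by rewrite /= mul0r addr0 subrr normr0 mul0r.
set T := iter m (random_step c) (gaussK s) in IH *.
have h1 : `|random_step c T a - random_step c (gaussK (s + m%:R * (c ^+ 2 * v))) a|
    <= m%:R * step_bound s (c * M).
  rewrite -EbernB; apply: le_trans (Ebern_norm p01 _ _) _.
  by rewrite -[leRHS](Ebern_cst p S); apply: Ebern_le.
have ss : s <= s + m%:R * (c ^+ 2 * v) by rewrite lerDl !mulr_ge0 ?sqr_ge0.
have h2 := kernel_step a s0 ss c0.
have -> : s + m.+1%:R * (c ^+ 2 * v) = s + m%:R * (c ^+ 2 * v) + c ^+ 2 * v.
  by rewrite -natr1; ring.
rewrite -natr1 mulrDl mul1r; apply: le_trans (lerD h1 h2).
rewrite -/(random_step c (gaussK _) a) iterS -/T.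
set x := random_step _ T _; set y := random_step _ _ _; set z := gaussK _ _.
by rewrite (_ : x - z = (x - y) + (y - z)) ?ler_normD//; ring.
Qed.

(** Gives the second moment of a block sum from the same identity of laws that is used for the
    Gaussian kernel. *)
Lemma random_step_iter_sqr m (c a : R) :
  iter m (random_step c) (fun x => x ^+ 2) a = a ^+ 2 + m%:R * (c ^+ 2 * v).
Proof.
elim: m a => [|m IH] a; first by rewrite mul0r addr0.
rewrite iterS /random_step (@Ebern_ext _ _ p S _ (fun A =>
  (a ^+ 2 + m%:R * (c ^+ 2 * v)) + (2 * a * c) * Y A + c ^+ 2 * Y A ^+ 2)).
  by rewrite !EbernD !EbernZ !Ebern_cst Y0 -/v -natr1; ring.
by move=> A; rewrite IH; ring.
Qed.

End KernelStep.

(** * Convergence of densities in L^1 *)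

Section Scheffe.
Context {R : realType}.
Let mu := @lebesgue_measure R.
Implicit Types (f g : R -> R).

Definition density g := [/\ forall x, 0 <= g x,
  mu.-integrable setT (EFin \o g) & \int[mu]_x g x = 1].

Lemma integrableZ_EFin (k : R) g : mu.-integrable setT (EFin \o g) ->
  mu.-integrable setT (EFin \o (fun x => k * g x)).
Proof.
move=> ig; rewrite (_ : _ \o _ = (fun x => k%:E * (EFin \o g) x)%E)//.
exact: integrableZl.
Qed.

Lemma integrableD_EFin f g : mu.-integrable setT (EFin \o f) ->
  mu.-integrable setT (EFin \o g) -> mu.-integrable setT (EFin \o (fun x => f x + g x)).
Proof.
move=> fi gi; rewrite (_ : _ \o _ = (EFin \o f) \+ (EFin \o g))%E//.
exact: integrableD.
Qed.

Lemma integrableB_EFin f g : mu.-integrable setT (EFin \o f) ->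
  mu.-integrable setT (EFin \o g) -> mu.-integrable setT (EFin \o (fun x => f x - g x)).
Proof.
move=> fi gi; rewrite (_ : _ \o _ = (EFin \o f) \- (EFin \o g))%E//.
exact: integrableB.
Qed.

Lemma integrable_norm_EFin f : mu.-integrable setT (EFin \o f) ->
  mu.-integrable setT (EFin \o (fun x => `|f x|)).
Proof. exact: integrable_norm. Qed.

Lemma integrable_bounded_mul f g (B : R) : measurable_fun setT f ->
  (forall x, `|f x| <= B) -> mu.-integrable setT (EFin \o g) ->
  mu.-integrable setT (EFin \o (fun x => f x * g x)).
Proof.
move=> mf fB ig; have B0 : 0 <= B by apply: le_trans (normr_ge0 _) (fB 0).
have mg : measurable_fun setT g.
  by apply/measurable_EFinP; case/integrableP: ig.
apply: (@le_integrable _ _ _ mu setT measurableT _ (fun x => (B * g x)%:E)).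
- by apply/measurable_EFinP; exact: measurable_funM.
- move=> x _; rewrite /= lee_fin !normrM (ger0_norm B0).
  by rewrite ler_wpM2r.
- exact: integrableZ_EFin.
Qed.

(** The positive part of g - p_n is dominated by g, so its integral tends to 0. Both densities have
    mass 1, so the positive and negative parts of g - p_n have equal integrals and the L^1 distance
    is twice that quantity. *)
Lemma Scheffe (p : nat -> R -> R) g : (forall n, density (p n)) -> density g ->
  (forall x, p^~ x @ \oo --> g x) ->
  (fun n => \int[mu]_x `|p n x - g x|) @ \oo --> (0 : R).
Proof.
move=> dp [g0 ig g1] pg.
pose h n x : R := Num.max (g x - p n x) 0.
have mg : measurable_fun setT g by apply/measurable_EFinP; case/integrableP: ig.
have mp n : measurable_fun setT (p n).
  by apply/measurable_EFinP; have [_ /integrableP[]] := dp n.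
have mh n : measurable_fun setT (h n).
  by apply: measurable_maxr => //; exact: measurable_funB.
have hg n x : `|h n x| <= g x.
  have [p0 _ _] := dp n; rewrite ger0_norm /h; last by rewrite le_max lexx orbT.
  by rewrite ge_max g0 andbT; have := p0 x; lra.
have ih n : mu.-integrable setT (EFin \o h n).
  apply: (@le_integrable _ _ _ mu setT measurableT _ (EFin \o g)) => //.
    by apply/measurable_EFinP; exact: mh.
  by move=> x _; rewrite /= lee_fin (le_trans (hg n x))// ler_norm.
have hcvg : (fun n => \int[mu]_x (h n x)%:E)%E @ \oo --> (0 : \bar R)%E.
  have [] := @dominated_convergence _ _ _ mu setT measurableT
    (fun n => EFin \o h n) (cst 0%E) (EFin \o g) _ _ _ ig _ => //.
  - by move=> n; apply/measurable_EFinP; exact: mh.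
  - apply: aeW => x _; rewrite /= ; apply/fine_cvgP; split; first exact: nearW.
    rewrite [X in X @ \oo --> _](_ : _ = (fun n => Num.max (g x - p n x) 0))//.
    apply/cvgrPdist_le => e e0; move/cvgrPdist_le: (pg x) => /(_ _ e0).
    apply: filterS => n; rewrite sub0r normrN; apply: le_trans.
    rewrite /Num.max; case: ltP => _; rewrite ?normr0//.
  - by apply: aeW => x n _; rewrite /= lee_fin.
  - by move=> _ _; rewrite integral0.
have E n : \int[mu]_x `|p n x - g x| = 2 * \int[mu]_x h n x.
  have [p0 ip p1] := dp n.
  have D : \int[mu]_x (p n x - g x) = 0 by rewrite RintegralB// p1 g1 subrr.
  rewrite -RintegralZl// -[RHS]addr0 -D -RintegralD//; last first.
  - exact: integrableB_EFin.
  - exact: integrableZ_EFin.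
  apply: eq_Rintegral => x _; rewrite /h /Num.max; case: ltP => hx.
    by rewrite mulr0 add0r ger0_norm//; lra.
  by rewrite ler0_norm//; lra.
rewrite (_ : (fun n => _) = (fun n => 2 * \int[mu]_x h n x)); last exact/funext.
rewrite -[X in _ --> X](mulr0 2); apply: cvgMl_tmp.
by have := fine_cvg hcvg; apply.
Qed.

Lemma Scheffe_bounded (p : nat -> R -> R) f g (B : R) :
  (forall n, density (p n)) -> density g -> (forall x, p^~ x @ \oo --> g x) ->
  measurable_fun setT f -> (forall x, `|f x| <= B) ->
  (fun n => \int[mu]_x (f x * p n x)) @ \oo --> \int[mu]_x (f x * g x).
Proof.
move=> dp dg pg mf fB; have ig : mu.-integrable setT (EFin \o g) by case: dg.
have ip n : mu.-integrable setT (EFin \o p n) by case: (dp n).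
have H := Scheffe dp dg pg.
have B0 : 0 <= B by apply: le_trans (normr_ge0 _) (fB 0).
apply/cvgrPdist_le => e e0.
have e1 : 0 < e / (B + 1) by rewrite divr_gt0// ltr_wpDl.
move/cvgrPdist_le: H => /(_ _ e1); apply: filterS => n.
rewrite sub0r normrN => Hn.
have i1 := integrable_bounded_mul mf fB (ip n).
have i2 := integrable_bounded_mul mf fB ig.
have i3 : mu.-integrable setT (EFin \o (fun x => p n x - g x)) by exact: integrableB_EFin.
have i4 : mu.-integrable setT (EFin \o (fun x => `|p n x - g x|)) by exact: integrable_norm_EFin.
rewrite distrC -RintegralB//; apply: le_trans (le_normr_Rintegral _ _) _ => //.
  exact: integrableB_EFin.
apply: le_trans (_ : B * \int[mu]_x `|p n x - g x| <= _).
  rewrite -RintegralZl//; apply: le_Rintegral => //.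
  - exact: (integrable_norm_EFin (integrableB_EFin i1 i2)).
  - exact: integrableZ_EFin.
  - by move=> x _; rewrite -mulrBr normrM ler_wpM2r.
have I0 : 0 <= \int[mu]_x `|p n x - g x| by apply: Rintegral_ge0.
rewrite ger0_norm// ler_pdivlMr ?ltr_wpDl// in Hn.
by apply: le_trans Hn; rewrite mulrC ler_wpM2l// lerDl.
Qed.

End Scheffe.

(** * Gaussian mollification of bounded continuous functions *)

Section Smoothing.
Context {R : realType}.
Let mu := @lebesgue_measure R.
Implicit Types (f g : R -> R) (s x y z : R).

Lemma gaussK_pdf s z y : 0 < s -> normal_pdf z (Num.sqrt s) y = gaussK s (y - z).
Proof.
move=> s0; have r0 : Num.sqrt s != 0 by rewrite gt_eqF// sqrtr_gt0.
rewrite normal_pdfE// /normal_peak /normal_fun sqr_sqrtr ?ltW// /gaussK /gauss_const.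
have lnE : expR (- (ln s / 2)) = (Num.sqrt s)^-1.
  rewrite expRN; congr (_^-1); apply/eqP.
  rewrite -(@eqrXn2 _ 2)// ?expR_ge0 ?sqrtr_ge0// sqr_sqrtr ?ltW//.
  by rewrite -expRM_natl mulrC divfK// lnK// posrE.
rewrite expRD lnE -mulrnAr sqrtrM ?ltW// invfM [_^-1 * _^-1]mulrC -mulrA.
congr (_ * (_ * expR _)).
by rewrite -mulr_natr; field; lra.
Qed.

Lemma density_gaussK s z : 0 < s -> density (fun y => gaussK s (y - z)).
Proof.
move=> s0; have E : (fun y => gaussK s (y - z)) = normal_pdf z (Num.sqrt s).
  by apply/funext => y; rewrite gaussK_pdf.
split; first by move=> y; exact: gaussK_ge0.
  by rewrite E; exact: integrable_normal_pdf.
by rewrite E /Rintegral integral_normal_pdf.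
Qed.

(** Half of the exponent absorbs x^2 and the other half is the Gaussian of doubled variance. This
    yields integrability and a second moment of order s, which is all that mollification needs,
    without computing the exact value. *)
Lemma gaussK_second_moment s x : 0 < s -> x ^+ 2 * gaussK s x <= 8 * s * gaussK (2 * s) x.
Proof.
move=> s0; rewrite /gaussK.
have ln2 : ln (2 : R) <= 1.
  rewrite -[leRHS]expRK ler_ln ?posrE ?expR_gt0//.
  by have := expR_ge1Dx (1 : R); lra.
have lnE : ln (2 * s) = ln 2 + ln s by rewrite lnM ?posrE.
pose w := x ^+ 2 / (2 * (2 * s)); have w0 : 0 <= w by rewrite divr_ge0 ?sqr_ge0//; lra.
have xE : x ^+ 2 = 4 * s * w by rewrite /w; field; lra.
have -> : x ^+ 2 / (2 * s) = w + w by rewrite /w; field; lra.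
rewrite -/w xE lnE.
have -> : - (ln s / 2) - (w + w) = (- ((ln 2 + ln s) / 2) - w) + (ln 2 / 2 - w) by field.
rewrite expRD; set e := expR _; have e0 : 0 <= e by exact: expR_ge0.
have h : w * expR (ln 2 / 2 - w) <= 2.
  rewrite expRD expRN mulrA ler_pdivrMr ?expR_gt0//.
  have h1 : expR (ln 2 / 2) <= 2 :> R.
    rewrite -[leRHS]lnK ?posrE// ler_expR.
    have h0 : 0 <= ln (2 : R) by rewrite ln_ge0// ler1n.
    lra.
  have := expR_ge1Dx w; have := expR_ge0 (ln (2 : R) / 2); nra.
have c0 := @gauss_const_ge0 R.
have := ler_wpM2l (mulr_ge0 (mulr_ge0 (ltW s0) c0) e0) h; lra.
Qed.

Lemma integrable_second_moment s z : 0 < s ->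
  mu.-integrable setT (EFin \o (fun y => (y - z) ^+ 2 * gaussK s (y - z))) /\
  \int[mu]_y ((y - z) ^+ 2 * gaussK s (y - z)) <= 8 * s.
Proof.
move=> s0; have s20 : 0 < 2 * s by lra.
have [_ i2 d2] := density_gaussK z s20; have [_ i1 _] := density_gaussK z s0.
have i2' := integrableZ_EFin (8 * s) i2.
have ii : mu.-integrable setT (EFin \o (fun y => (y - z) ^+ 2 * gaussK s (y - z))).
  apply: (@le_integrable _ _ _ mu setT measurableT _ _ _ _ i2').
    apply/measurable_EFinP; apply: measurable_funM.
      by apply: measurable_funX; exact: measurable_funB.
    by apply/measurable_EFinP; case/integrableP: i1.
  move=> y _; rewrite /= lee_fin ger0_norm; last first.
    by rewrite mulr_ge0 ?sqr_ge0 ?gaussK_ge0.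
  by apply: le_trans (ler_norm _); exact: gaussK_second_moment.
split=> //; apply: le_trans (_ : \int[mu]_y (8 * s * gaussK (2 * s) (y - z)) <= _).
  by apply: le_Rintegral => // y _; exact: gaussK_second_moment.
by rewrite RintegralZl// d2 mulr1.
Qed.

(** Integrate the modulus against the kernel centered at z: the first term is constant there, and
    the second costs C times the second moment. The bound [B] serves integrability only and does not
    enter the error. *)
Lemma mollify_error f (B eps C s z : R) : 0 < s -> 0 <= C ->
  measurable_fun setT f -> (forall x, `|f x| <= B) ->
  (forall x y, `|f x - f y| <= eps * (1 + x ^+ 2) + C * (y - x) ^+ 2) ->
  `|f z - \int[mu]_y (f y * gaussK s (y - z))| <= eps * (1 + z ^+ 2) + 8 * C * s.
Proof.
move=> s0 C0 mf fB fC; have [K0 iK dK] := density_gaussK z s0.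
have [iQ hQ] := integrable_second_moment z s0.
have ifK := integrable_bounded_mul mf fB iK.
have iz := integrableZ_EFin (f z) iK.
have -> : f z = \int[mu]_y (f z * gaussK s (y - z)) by rewrite RintegralZl// dK mulr1.
rewrite -RintegralB//; apply: le_trans (le_normr_Rintegral _ _) _ => //.
  exact: integrableB_EFin.
have i1 := integrableZ_EFin (eps * (1 + z ^+ 2)) iK.
have i2 := integrableZ_EFin C iQ.
apply: le_trans (_ : \int[mu]_y (eps * (1 + z ^+ 2) * gaussK s (y - z) +
   C * ((y - z) ^+ 2 * gaussK s (y - z))) <= _).
  apply: le_Rintegral => //.
  - exact: (integrable_norm_EFin (integrableB_EFin iz ifK)).
  - exact: integrableD_EFin.
  - move=> y _; rewrite -mulrBl normrM (ger0_norm (gaussK_ge0 _ _)) mulrA -mulrDl.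
    by rewrite ler_wpM2r ?gaussK_ge0.
rewrite RintegralD// (RintegralZl _ measurableT iK) (RintegralZl _ measurableT iQ) dK mulr1 lerD2l.
by have := ler_wpM2l C0 hQ; lra.
Qed.

(** A bounded continuous function need not be uniformly continuous, so the error carries the weight
    1 + x^2, which turns into a second moment after averaging. Compactness handles |x| <= M; beyond
    M the weight alone exceeds the oscillation 2B. *)
Lemma bounded_continuous_modulus f (B : R) : continuous f -> (forall x, `|f x| <= B) ->
  forall eps, 0 < eps -> exists2 C, 0 <= C &
  forall x y, `|f x - f y| <= eps * (1 + x ^+ 2) + C * (y - x) ^+ 2.
Proof.
move=> cf fB eps e0; have B0 : 0 <= B by apply: le_trans (normr_ge0 _) (fB 0).
(* Chosen so that eps M >= 2B, while M >= 1 gives M <= x^2 as soon as |x| > M. *)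
pose M := 1 + 2 * B / eps; have M1 : 1 <= M by rewrite lerDl divr_ge0 ?mulr_ge0// ltW.
have [d d0 Hd] : exists2 d : R, 0 < d &
    forall x y, `|x| <= M -> `|y - x| < d -> `|f x - f y| <= eps.
  have := @segment_compact R (- M) M => /compact_near_coveringP.
  move=> /(_ R (0 : R)^'+ (fun d x => forall y, `|y - x| < d -> `|f x - f y| <= eps) _).
  case=> [|d /= d0 Hd].
    move=> x _; have e20 : 0 < eps / 2 by rewrite divr_gt0.
    have /cvgrPdist_lt/(_ _ e20)[d /= d0 Hd] := cf x.
    exists (ball x (d / 2), [set d' | d' < d / 2]) => /=.
      split; first by apply: nbhsx_ballx; rewrite divr_gt0.
      by apply: nbhs_right_lt; rewrite divr_gt0.
    move=> [x' d'] /= [xx' dd'] y yx'.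
    have h1 : `|f x - f x'| < eps / 2.
      by apply: Hd; move: xx'; rewrite /ball /=; lra.
    have h2 : `|f x - f y| < eps / 2.
      apply: Hd => /=; rewrite (_ : x - y = (x - x') - (y - x')); last by ring.
      by apply: le_lt_trans (ler_normB _ _) _; move: xx'; rewrite /ball /=; lra.
    rewrite (_ : f x' - f y = (f x - f y) - (f x - f x')); last by ring.
    by apply: le_trans (ler_normB _ _) _; lra.
  exists (d / 2); first by rewrite divr_gt0.
  move=> x y xM yx; apply: (Hd (d / 2)) yx => /=.
  - by rewrite /ball /= sub0r normrN gtr0_norm ?divr_gt0//; lra.
  - by rewrite divr_gt0.
  - by rewrite in_itv /= -ler_norml.
exists (2 * B / d ^+ 2); first by rewrite divr_ge0 ?mulr_ge0 ?exprn_ge0// ltW.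
move=> x y.
have fxy : `|f x - f y| <= 2 * B.
  by apply: le_trans (ler_normB _ _) _; have := fB x; have := fB y; lra.
have C0 : 0 <= 2 * B / d ^+ 2 * (y - x) ^+ 2.
  by apply: mulr_ge0 (sqr_ge0 _); apply: divr_ge0 (sqr_ge0 _); exact: mulr_ge0.
have x2 := sqr_ge0 x.
have [xM|Mx] := lerP `|x| M; last first.
  apply: le_trans fxy _; apply: le_trans (_ : eps * (1 + x ^+ 2) <= _); last by lra.
  have h : M <= x ^+ 2.
    rewrite -(real_normK (num_real x)); apply: le_trans (_ : M ^+ 2 <= _).
      by rewrite expr2 ler_peMl//; lra.
    by rewrite lerXn2r ?nnegrE//; lra.
  have ME : eps * M = eps + 2 * B by rewrite /M; field; rewrite gt_eqF.
  have : 2 * B <= eps * M by rewrite ME lerDr ltW.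
  have := ler_wpM2l (ltW e0) h; lra.
have [yx|dyx] := ltrP `|y - x| d.
  apply: le_trans (Hd x y xM yx) _.
  have := mulr_ge0 (ltW e0) x2; lra.
apply: le_trans fxy _; apply: le_trans (_ : 2 * B / d ^+ 2 * (y - x) ^+ 2 <= _); last first.
  rewrite lerDr; apply: mulr_ge0 (ltW e0) _; lra.
rewrite mulrAC ler_pdivlMr ?exprn_gt0// ler_wpM2l ?mulr_ge0//.
by rewrite -(real_normK (num_real (y - x))) lerXn2r ?nnegrE// ltW.
Qed.

End Smoothing.

(** * Weak convergence from block approximations *)

Lemma Ebern_Rintegral (R : realType) (K : choiceType) (p : K -> R) (S : seq K)
    (F : {fset K} -> R -> R) :
  let mu := @lebesgue_measure R in
  (forall A, mu.-integrable setT (EFin \o F A)) ->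
  mu.-integrable setT (EFin \o (fun y => Ebern p S (fun A => F A y))) /\
  \int[mu]_y Ebern p S (fun A => F A y) = Ebern p S (fun A => \int[mu]_y F A y).
Proof.
move=> mu; elim: S F => [|Q S IH] F iF /=; first by split=> //; exact: iF.
have [i1 e1] := IH (fun A => F (Q |` A)) (fun A => iF _).
have [i2 e2] := IH F iF.
have j1 := integrableZ_EFin (p Q) i1; have j2 := integrableZ_EFin (1 - p Q) i2.
split; first exact: integrableD_EFin.
rewrite (RintegralD measurableT j1 j2).
by rewrite (RintegralZl _ measurableT i1) (RintegralZl _ measurableT i2) e1 e2.
Qed.

Section GaussExpectation.
Context {R : realType}.
Let mu := @lebesgue_measure R.
Variables (f : R -> R) (B : R).
Hypotheses (cf : continuous f) (fB : forall x, `|f x| <= B).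

Definition gaussI (s : R) : R := \int[mu]_y (f y * gaussK s y).

Lemma measurable_test : measurable_fun setT f.
Proof. exact: continuous_measurable_fun. Qed.

Lemma density_gaussK0 (s : R) : 0 < s -> density (gaussK s).
Proof.
move=> s0; rewrite (_ : gaussK s = (fun y => gaussK s (y - 0))); first exact: density_gaussK.
by apply/funext => y; rewrite subr0.
Qed.

Lemma gaussK_continuous_var (s x : R) : 0 < s -> {for s, continuous (gaussK^~ x)}.
Proof.
move=> s0; apply: differentiable_continuous; apply/derivable1_diffP.
by have [] := is_derive_gaussK_var x s0.
Qed.

Lemma gaussI_continuous (s2 : R) : 0 < s2 -> forall eps, 0 < eps ->
  exists2 eta, 0 < eta & forall s, `|s - s2| < eta -> `|gaussI s - gaussI s2| <= eps.
Proof.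
move=> s20 eps e0.
(* [cut] keeps the variance positive along every sequence tending to [s2], so that all kernels are
   densities, and it is the identity near [s2]. *)
pose cut (s : R) := Num.max s (s2 / 2).
have cut0 s : 0 < cut s by rewrite lt_max divr_gt0// orbT.
have cutE : cut s2 = s2 by apply/max_idPl; lra.
have : (gaussI \o cut) @ s2 --> gaussI s2.
  apply: (iffRL (cvg_nbhsP (gaussI \o cut : R^o -> R^o) s2 (gaussI s2))) => u us2.
  have us2' : (cut \o u) @ \oo --> s2.
    apply/cvgrPdist_le => e e0'; move/cvgrPdist_le: us2 => /(_ _ e0').
    apply: filterS => n h; apply: le_trans h; rewrite /= /cut /Num.max.
    case: ltP => // h; rewrite [leRHS]ger0_norm; last lra.
    by rewrite ger0_norm; lra.
  apply: (@Scheffe_bounded _ (fun n => gaussK (cut (u n))) f (gaussK s2) B).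
  - by move=> n; exact: density_gaussK0.
  - exact: density_gaussK0.
  - move=> x; apply: (cvg_comp (cut \o u) (gaussK^~ x) us2').
    exact: gaussK_continuous_var.
  - exact: measurable_test.
  - exact: fB.
move/cvgrPdist_le => /(_ _ e0)[eta /= eta0 H].
exists (Num.min eta (s2 / 2)); first by rewrite lt_min eta0 divr_gt0.
move=> s; rewrite lt_min => /andP[s_eta s_s2].
have := H s; rewrite /= distrC => /(_ s_eta).
rewrite (_ : cut s = s) 1?distrC//; apply/max_idPl.
by move: s_s2; rewrite ltr_norml => /andP[]; lra.
Qed.

(** Treats positive and zero limit variance in one statement. For [s2] = 0 the limit is the Dirac
    mass, approached by mollification at the point 0. *)
Lemma gauss_expect_approx (s2 : R) : 0 <= s2 ->
  exists2 g0, gauss_expect s2 f = g0%:E & forall eps, 0 < eps ->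
  exists2 eta, 0 < eta &
    forall s, 0 < s -> `|s - s2| < eta -> `|gaussI s - g0| <= eps.
Proof.
rewrite le_eqVlt => /predU1P[<-|s20].
  exists (f 0); first by rewrite /gauss_expect eqxx.
  move=> eps e0; have e20 : 0 < eps / 2 by rewrite divr_gt0.
  have [C C0 fC] := bounded_continuous_modulus cf fB e20.
  (* Makes the term 8 C s of [mollify_error] at most eps/2; C + 1 avoids a zero denominator. *)
  exists (eps / (16 * (C + 1))); first by rewrite divr_gt0// mulr_gt0//; lra.
  move=> s s0; rewrite subr0 gtr0_norm// ltr_pdivlMr; last by rewrite mulr_gt0//; lra.
  move=> hs; have := mollify_error 0 s0 C0 measurable_test fB fC.
  rewrite expr0n addr0 mulr1 distrC (_ : \int[_]_y _ = gaussI s).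
    by move=> /le_trans; apply; have := mulr_gt0 s0 s0; nra.
  by apply: eq_Rintegral => y _; rewrite subr0.
exists (gaussI s2).
  rewrite /gauss_expect gt_eqF// /gaussI /Rintegral fineK.
    by apply: eq_integral => y _; rewrite gaussK_pdf// subr0.
  have [_ iK _] := density_gaussK0 s20.
  apply: integrable_fin_num => //.
  exact: (integrable_bounded_mul measurable_test fB iK).
move=> eps e0; have [eta eta0 H] := gaussI_continuous s20 e0.
by exists eta => // s _; exact: H.
Qed.

End GaussExpectation.

Section BlockApproximation.
Context {R : realType} {K : choiceType}.
Variables (p : K -> R) (S : nat -> seq K) (X : nat -> {fset K} -> R) (c : nat -> R).
Hypotheses (p01 : forall Q, 0 <= p Q <= 1) (c0 : forall n, 0 <= c n).
Hypothesis c_cvg : c @ \oo --> (0 : R).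

(* By the third condition [Z n] has the law of [c n] times a sum of [m n]
   independent copies of [Y]. *)
Definition iid_approximation (delta : R) := exists (T : seq K) (Y : {fset K} -> R)
  (M lam : R) (m : nat -> nat) (Z : nat -> {fset K} -> R),
  [/\ forall A, `|Y A| <= M, Ebern p T Y = 0,
      forall n Phi a, Ebern p (S n) (fun A => Phi (a + Z n A)) =
                      iter (m n) (random_step p T Y (c n)) Phi a,
      (fun n => (m n)%:R * c n ^+ 2) @ \oo --> lam &
      \forall n \near \oo, Ebern p (S n) (fun A => (X n A - Z n A) ^+ 2) <= delta].

Hypothesis approxX : forall delta, 0 < delta -> iid_approximation delta.

Let EX2 n := Ebern p (S n) (fun A => X n A ^+ 2).

(** Write x^2 - z^2 = 2x(x - z) - (x - z)^2 and split the product by the weighted inequality of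
    arithmetic and geometric means. *)
Lemma sqr_diff_le (k x z : R) : 0 < k ->
  `|x ^+ 2 - z ^+ 2| <= k * x ^+ 2 + (1 + k^-1) * (x - z) ^+ 2.
Proof.
move=> k0; have kV : k * k^-1 = 1 by rewrite divff// gt_eqF.
have k'0 : 0 < k^-1 by rewrite invr_gt0.
have h1 : 0 <= k^-1 * (k * x - (x - z)) ^+ 2 by rewrite mulr_ge0 ?sqr_ge0// ltW.
have h2 : 0 <= k^-1 * (k * x + (x - z)) ^+ 2 by rewrite mulr_ge0 ?sqr_ge0// ltW.
have E1 : k^-1 * (k * x - (x - z)) ^+ 2 =
    k * x ^+ 2 - 2 * x * (x - z) + k^-1 * (x - z) ^+ 2 by field; rewrite gt_eqF.
have E2 : k^-1 * (k * x + (x - z)) ^+ 2 =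
    k * x ^+ 2 + 2 * x * (x - z) + k^-1 * (x - z) ^+ 2 by field; rewrite gt_eqF.
have d2 := sqr_ge0 (x - z).
rewrite ler_norml; apply/andP; split; nra.
Qed.

Lemma second_moment_diff n (Z : {fset K} -> R) (k : R) : 0 < k ->
  `|EX2 n - Ebern p (S n) (fun A => Z A ^+ 2)| <=
  k * EX2 n + (1 + k^-1) * Ebern p (S n) (fun A => (X n A - Z A) ^+ 2).
Proof.
move=> k0; rewrite /EX2 -EbernB -!EbernZ -EbernD.
apply: le_trans (Ebern_norm p01 _ _) _; apply: Ebern_le => // A.
exact: sqr_diff_le.
Qed.

Lemma EX2_ge0 n : 0 <= EX2 n.
Proof. by apply: Ebern_ge0 => // A; exact: sqr_ge0. Qed.

(** Here tau is the limit variance of the block sums. The second moment occurs on both sides, with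
    the small factor k on the right: k = 1/2 first yields boundedness, then small k yields the
    Cauchy property. *)
Lemma approx_second_moment delta k : 0 < delta -> 0 < k ->
  exists2 tau : R, 0 <= tau & forall eps, 0 < eps -> \forall n \near \oo,
   `|EX2 n - tau| <= k * EX2 n + (1 + k^-1) * delta + eps.
Proof.
move=> d0 k0; have [T [Y [M [lam [m [Z [YM Y0 ZE mc dXZ]]]]]]] := approxX d0.
pose V := Ebern p T (fun A => Y A ^+ 2).
have V0 : 0 <= V by apply: Ebern_ge0 => // A; exact: sqr_ge0.
have Z2 n : Ebern p (S n) (fun A => Z n A ^+ 2) = (m n)%:R * c n ^+ 2 * V.
  have := ZE n (fun x => x ^+ 2) 0.
  rewrite random_step_iter_sqr// expr0n add0r -mulrA => <-.
  by apply: Ebern_ext => A; rewrite add0r.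
have lam0 : 0 <= lam.
  by apply: (cvgr_to_ge mc); apply: nearW => n; rewrite mulr_ge0 ?sqr_ge0.
exists (lam * V); first exact: mulr_ge0.
move=> eps e0.
have tauc : (fun n => (m n)%:R * c n ^+ 2 * V) @ \oo --> lam * V by exact: cvgMr_tmp.
move/cvgrPdist_le: tauc => /(_ _ e0) tauc.
near=> n.
have h1 : `|lam * V - (m n)%:R * c n ^+ 2 * V| <= eps by near: n.
have h2 : Ebern p (S n) (fun A => (X n A - Z n A) ^+ 2) <= delta by near: n.
have h3 := second_moment_diff n (Z n) k0; rewrite Z2 in h3.
have h4 : (1 + k^-1) * Ebern p (S n) (fun A => (X n A - Z n A) ^+ 2) <= (1 + k^-1) * delta.
  by rewrite ler_wpM2l// addr_ge0// invr_ge0 ltW.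
rewrite (_ : EX2 n - _ = (EX2 n - (m n)%:R * c n ^+ 2 * V) -
  (lam * V - (m n)%:R * c n ^+ 2 * V)); last by ring.
apply: le_trans (ler_normB _ _) _; lra.
Unshelve. all: by end_near. Qed.

Lemma second_moment_cvg : exists2 s2 : R, 0 <= s2 & EX2 @ \oo --> s2.
Proof.
have [A0 A00 EXA] : exists2 A0 : R, 0 < A0 & \forall n \near \oo, EX2 n <= A0.
  have half : 0 < (2^-1 : R) by rewrite invr_gt0.
  have [tau tau0 /(_ _ ltr01) H] := approx_second_moment ltr01 half.
  exists (2 * (tau + 4)); first lra.
  apply: filterS H => n; have := EX2_ge0 n; rewrite invrK ler_norml => ? /andP[_]; lra.
have : cvg (EX2 @ \oo).
  apply/cauchy_cvgP; apply: cauchy_exP => eps e0.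
  (* k and then delta are chosen to make each of the three error terms at most eps/4, which leaves
     room for the strict inequality of a ball. *)
  pose k := eps / (4 * A0); have k0 : 0 < k by rewrite divr_gt0// mulr_gt0.
  have k1 : 0 < 1 + k^-1 by rewrite addr_gt0// invr_gt0.
  pose delta := eps / (4 * (1 + k^-1)).
  have d0 : 0 < delta by rewrite divr_gt0// mulr_gt0.
  have [tau tau0 H] := approx_second_moment d0 k0.
  exists tau; have e4 : 0 < eps / 4 by rewrite divr_gt0.
  suff : \forall n \near \oo, ball tau eps (EX2 n) by [].
  near=> n.
  have h1 : `|EX2 n - tau| <= k * EX2 n + (1 + k^-1) * delta + eps / 4.
    by near: n; exact: H.
  have h2 : EX2 n <= A0 by near: n.
  have h3 : k * EX2 n <= eps / 4.
    apply: le_trans (ler_wpM2l (ltW k0) h2) _.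
    have -> : k * A0 = eps / 4 by rewrite /k; field; rewrite gt_eqF.
    exact: lexx.
  have h4 : (1 + k^-1) * delta = eps / 4.
    by rewrite /delta -[k^-1 in LHS]/(k^-1); set k' := 1 + k^-1 in k1 *; field; rewrite gt_eqF.
  by rewrite /ball /= distrC; lra.
move=> /cvg_ex[s2 Hs2]; exists s2 => //.
by apply: (cvgr_to_ge Hs2); apply: nearW => n; exact: EX2_ge0.
Unshelve. all: by end_near. Qed.

(** The integral is the expectation of f under the law of Z plus an independent N(0, s) variable,
    written with its density. Averaging [mollify_error] over Z turns the weight 1 + z^2 into a
    second moment. *)
Lemma smoothed_law n (Z : {fset K} -> R) (f : R -> R) (B eps C s : R) :
  0 < s -> 0 <= C -> measurable_fun setT f -> (forall x, `|f x| <= B) ->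
  (forall x y, `|f x - f y| <= eps * (1 + x ^+ 2) + C * (y - x) ^+ 2) ->
  `|Ebern p (S n) (fun A => f (Z A)) - \int[@lebesgue_measure R]_y
     (f y * Ebern p (S n) (fun A => gaussK s (y - Z A)))|
  <= eps * (1 + Ebern p (S n) (fun A => Z A ^+ 2)) + 8 * C * s.
Proof.
move=> s0 C0 mf fB fC.
have iF A : (@lebesgue_measure R).-integrable setT (EFin \o (fun y => f y * gaussK s (y - Z A))).
  by have [_ iK _] := density_gaussK (Z A) s0; exact: (integrable_bounded_mul mf fB iK).
have [_ E] := Ebern_Rintegral p (S n) iF.
rewrite (_ : (\int[_]_y _) = Ebern p (S n)
   (fun A => \int[@lebesgue_measure R]_y (f y * gaussK s (y - Z A)))); last first.
  by rewrite -E; apply: eq_Rintegral => y _; rewrite EbernZ.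
rewrite -EbernB; apply: le_trans (Ebern_norm p01 _ _) _.
apply: le_trans (_ : Ebern p (S n) (fun A => eps * (1 + Z A ^+ 2) + 8 * C * s) <= _).
  by apply: Ebern_le => // A; exact: mollify_error.
by rewrite EbernD EbernZ EbernD !Ebern_cst.
Qed.

Lemma density_smoothed n (Z : {fset K} -> R) (s : R) : 0 < s ->
  density (fun y => Ebern p (S n) (fun A => gaussK s (y - Z A))).
Proof.
move=> s0; have iF A : (@lebesgue_measure R).-integrable setT
    (EFin \o (fun y => gaussK s (y - Z A))) by case: (density_gaussK (Z A) s0).
have [i E] := Ebern_Rintegral p (S n) iF; split=> //.
  by move=> y; apply: Ebern_ge0 => // A; exact: gaussK_ge0.
rewrite E (@Ebern_ext _ _ p (S n) _ (fun=> 1)) ?Ebern_cst// => A.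
by case: (density_gaussK (Z A) s0).
Qed.

(** The chain of comparisons is E f(X), E f(Z), the mollified law of Z, the Gaussian of variance h +
    tau, and the Gaussian of variance s2. Only the third comparison is a limit in n for fixed h; the
    others are made small through h and eps. *)
Lemma law_cvg (s2 : R) (f : R -> R) (B : R) : 0 <= s2 -> EX2 @ \oo --> s2 ->
  continuous f -> (forall x, `|f x| <= B) ->
  exists2 g0, gauss_expect s2 f = g0%:E &
    (fun n => Ebern p (S n) (fun A => f (X n A))) @ \oo --> g0.
Proof.
move=> s20 EXs2 cf fB; have [g0 gE Hg] := gauss_expect_approx cf fB s20.
exists g0 => //; apply/cvgrPdist_le => e e0.
pose A0 := 2 * s2 + 5; have A00 : 0 < A0 by rewrite /A0; lra.
pose eps := e / (8 * (1 + A0)).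
have eps0 : 0 < eps by rewrite divr_gt0// mulr_gt0//; lra.
have epsE : eps * (1 + A0) = e / 8 by rewrite /eps; field; rewrite gt_eqF//; lra.
have [C C0 fC] := bounded_continuous_modulus cf fB eps0.
have e40 : 0 < e / 4 by rewrite divr_gt0.
have [eta eta0 Heta] := Hg _ e40.
(* h is the variance of the mollifier and h^2 the L^2 error of the block approximation. The square
   is what makes (1 + 1/h) h^2 = h^2 + h small when the second moments are compared with k = h. *)
pose h := Num.min 1 (Num.min (eta / (2 * (s2 + 5))) (e / (36 * (C + 1)))).
have h0 : 0 < h by rewrite !lt_min ltr01 !divr_gt0// mulr_gt0//; lra.
have h1 : h <= 1 by rewrite ge_min lexx.
have heta : h * (s2 + 5) <= eta / 2.
  have : h <= eta / (2 * (s2 + 5)) by rewrite /h !ge_min lexx /= orbT.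
  by rewrite invfM mulrA ler_pdivlMr//; lra.
have hC : C * (h ^+ 2 + 8 * h) <= e / 4.
  have : h <= e / (36 * (C + 1)) by rewrite /h !ge_min lexx !orbT.
  rewrite ler_pdivlMr; last by rewrite mulr_gt0//; lra.
  have hh : h ^+ 2 <= h by rewrite expr2; have := ltW h0; nra.
  have := ler_wpM2l C0 hh; lra.
have hh0 : 0 < h ^+ 2 by rewrite exprn_gt0.
have [T [Y [M [lam [m [Z [YM Y0 ZE mc dXZ]]]]]]] := approxX hh0.
pose V := Ebern p T (fun A => Y A ^+ 2).
have V0 : 0 <= V by apply: Ebern_ge0 => // A; exact: sqr_ge0.
have lam0 : 0 <= lam.
  by apply: (cvgr_to_ge mc); apply: nearW => n; rewrite mulr_ge0 ?sqr_ge0.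
pose tau := lam * V; have tau0 : 0 <= tau by exact: mulr_ge0.
have Z2 n : Ebern p (S n) (fun A => Z n A ^+ 2) = (m n)%:R * c n ^+ 2 * V.
  have := ZE n (fun x => x ^+ 2) 0.
  rewrite random_step_iter_sqr// expr0n add0r -mulrA => <-.
  by apply: Ebern_ext => A; rewrite add0r.
have tauc : (fun n => (m n)%:R * c n ^+ 2 * V) @ \oo --> tau by exact: cvgMr_tmp.
have tau_s2 : `|tau - s2| <= h * (s2 + 3).
  have cv : (fun n => `|(m n)%:R * c n ^+ 2 * V - EX2 n|) @ \oo --> `|tau - s2|.
    by apply: cvg_norm; exact: cvgB.
  apply: (cvgr_to_le cv); move/cvgrPdist_le: EXs2 => /(_ _ ltr01) near1.
  near=> n.
  have n1 : `|s2 - EX2 n| <= 1 by near: n.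
  have n2 : Ebern p (S n) (fun A => (X n A - Z n A) ^+ 2) <= h ^+ 2 by near: n.
  have := second_moment_diff n (Z n) h0; rewrite Z2 distrC => /le_trans; apply.
  have n3 : EX2 n <= s2 + 1 by move: n1; rewrite ler_norml => /andP[]; lra.
  have n4 : h * EX2 n <= h * (s2 + 1) by rewrite ler_pM2l.
  have n5 : (1 + h^-1) * Ebern p (S n) (fun A => (X n A - Z n A) ^+ 2) <= (1 + h^-1) * h ^+ 2.
    by rewrite ler_wpM2l// addr_ge0// invr_ge0 ltW.
  have n6 : (1 + h^-1) * h ^+ 2 = h ^+ 2 + h by field; rewrite gt_eqF.
  have n7 : h ^+ 2 <= h by rewrite expr2; have := ltW h0; nra.
  lra.
have s0 : 0 < h + tau by lra.
have Igood : `|gaussI f (h + tau) - g0| <= e / 4.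
  apply: Heta => //; rewrite (_ : h + tau - s2 = h + (tau - s2)); last by ring.
  apply: le_lt_trans (ler_normD _ _) _; rewrite (gtr0_norm h0); nra.
have mf := measurable_test cf.
have kernel_cvg y : (fun n => Ebern p (S n) (fun A => gaussK h (y - Z n A))) @ \oo
    --> gaussK (h + tau) y.
  (* Evenness of the kernel rewrites y - Z as -y + Z, the form of the third condition with starting
     point -y. *)
  have E n : Ebern p (S n) (fun A => gaussK h (y - Z n A)) =
      iter (m n) (random_step p T Y (c n)) (gaussK h) (- y).
    rewrite -ZE; apply: Ebern_ext => A; rewrite -gaussK_even; congr gaussK; ring.
  have M0 : 0 <= M by apply: le_trans (normr_ge0 _) (YM fset0).
  have c1 : (fun n => gaussK (h + (m n)%:R * c n ^+ 2 * V) (- y)) @ \oo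
      --> gaussK (h + tau) (- y).
    have c1 : (fun n => h + (m n)%:R * c n ^+ 2 * V) @ \oo --> h + tau.
      by apply: cvgD => //; exact: cvg_cst.
    apply: (cvg_comp _ (gaussK^~ (- y)) c1).
    exact: gaussK_continuous_var.
  (* There are m steps, and m c^2 converges, so errors of order c^3 and c^4 per step sum to
     something that vanishes with c. *)
  have err n : (m n)%:R * step_bound h (c n * M) = (m n)%:R * c n ^+ 2 *
      (gauss_bound3 h * M ^+ 3 * c n + gauss_bound22 h * M ^+ 4 * (c n * c n)).
    by rewrite /step_bound; ring.
  have c2 : (fun n => (m n)%:R * step_bound h (c n * M)) @ \oo --> (0 : R).
    rewrite (_ : (fun n => _) = (fun n => (m n)%:R * c n ^+ 2 *
      (gauss_bound3 h * M ^+ 3 * c n + gauss_bound22 h * M ^+ 4 * (c n * c n)))).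
      rewrite [X in _ --> X](_ : _ = lam * (gauss_bound3 h * M ^+ 3 * 0 +
         gauss_bound22 h * M ^+ 4 * (0 * 0))); last by ring.
      apply: cvgM => //; apply: cvgD; first exact: cvgMl_tmp.
      by apply: cvgMl_tmp; exact: cvgM.
    by apply/funext => n; exact: err.
  rewrite -gaussK_even; apply/cvgrPdist_le => r r0.
  have r20 : 0 < r / 2 by rewrite divr_gt0.
  move/cvgrPdist_le: c1 => /(_ _ r20) c1; move/cvgrPdist_le: c2 => /(_ _ r20) c2.
  near=> n.
  have k1 : `|gaussK (h + tau) (- y) - gaussK (h + (m n)%:R * c n ^+ 2 * V) (- y)| <= r / 2.
    by near: n.
  have k2 : `|0 - (m n)%:R * step_bound h (c n * M)| <= r / 2 by near: n.
  have k3 := @random_step_iter R K p T Y M p01 YM Y0 (m n) h (c n) (- y) h0 (c0 n).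
  rewrite -/V mulrA in k3.
  rewrite E distrC; set a := iter _ _ _ _ in k3 *; set b := gaussK (h + tau) _ in k1 *.
  set b' := gaussK _ _ in k1 k3; rewrite (_ : a - b = (a - b') - (b - b')); last by ring.
  apply: le_trans (ler_normB _ _) _.
  have := ler_norm ((m n)%:R * step_bound h (c n * M)); move: k2; rewrite sub0r normrN; lra.
have I_cvg := Scheffe_bounded (fun n => density_smoothed n (Z n) h0)
  (density_gaussK0 s0) kernel_cvg mf fB.
move/cvgrPdist_le: I_cvg => /(_ _ e40) I_cvg.
move/cvgrPdist_le: tauc => /(_ _ ltr01) tauc.
near=> n.
have n1 : `|gaussI f (h + tau) - \int[@lebesgue_measure R]_y
     (f y * Ebern p (S n) (fun A => gaussK h (y - Z n A)))| <= e / 4 by near: n.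
have n2 : Ebern p (S n) (fun A => (X n A - Z n A) ^+ 2) <= h ^+ 2 by near: n.
have n3 : `|tau - (m n)%:R * c n ^+ 2 * V| <= 1 by near: n.
have ZA : Ebern p (S n) (fun A => Z n A ^+ 2) <= A0.
  rewrite Z2; move: n3 tau_s2; rewrite !ler_norml => /andP[n3 _] /andP[_ t2].
  have : h * (s2 + 3) <= s2 + 3 by have := ltW h0; nra.
  rewrite /A0; lra.
have n4 := smoothed_law n (Z n) h0 C0 mf fB fC.
have n5 : `|Ebern p (S n) (fun A => f (X n A)) - Ebern p (S n) (fun A => f (Z n A))|
   <= eps * (1 + Ebern p (S n) (fun A => Z n A ^+ 2)) + C * h ^+ 2.
  rewrite distrC -EbernB; apply: le_trans (Ebern_norm p01 _ _) _.
  apply: le_trans (_ : Ebern p (S n) (fun A => eps * (1 + Z n A ^+ 2) +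
     C * (X n A - Z n A) ^+ 2) <= _); first by apply: Ebern_le => // A.
  by rewrite EbernD !EbernZ EbernD Ebern_cst lerD2l ler_wpM2l.
have n6 : eps * (1 + Ebern p (S n) (fun A => Z n A ^+ 2)) <= e / 8.
  by rewrite -epsE ler_pM2l// lerD2l.
set x := Ebern p (S n) (fun A => f (X n A)) in n5 *.
set z := Ebern p (S n) (fun A => f (Z n A)) in n4 n5.
set w := \int[_]_y _ in n1 n4; set I := gaussI f _ in n1 Igood.
rewrite distrC (_ : x - g0 = (x - z) + ((z - w) - (I - w)) + (I - g0)); last by ring.
apply: le_trans (ler_normD _ _) _; apply: le_trans (lerD (ler_normD _ _) (lexx _)) _.
have n7 := ler_normB (z - w) (I - w); lra.
Unshelve. all: by end_near. Qed.

End BlockApproximation.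

(** * Ranks of boundary matrices *)

Section RankFunction.
Context {K : choiceType} (inc : K -> K -> rat).
Implicit Types (S T : {fset K}).

(** [K] may be infinite, so a boundary is recorded as a row over a finite family [U] of columns;
    [inc_rank_universe] makes the rank independent of that choice. *)
Definition inc_row m (U : 'I_m -> K) (Q : K) : 'rV[rat]_m := \row_j inc Q (U j).

Definition inc_span m (U : 'I_m -> K) S := (\sum_(Q <- S) <<inc_row U Q>>)%MS.

Lemma inc_row_span m (U : 'I_m -> K) S Q : Q \in S -> (inc_row U Q <= inc_span U S)%MS.
Proof.
move=> QS; rewrite /inc_span (big_fsetD1 Q QS) /=.
by apply: submx_trans (addsmxSl _ _); rewrite genmxE.
Qed.

Lemma inc_span_le m (U : 'I_m -> K) S n (V : 'M[rat]_(n, m)) :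
  (forall Q, Q \in S -> (inc_row U Q <= V)%MS) -> (inc_span U S <= V)%MS.
Proof.
move=> SV; rewrite /inc_span big_seq_cond; elim/big_rec: _ => [|Q W].
  exact: sub0mx.
by rewrite andbT => /SV QV WV; rewrite addsmx_sub genmxE QV.
Qed.

Lemma inc_spanS m (U : 'I_m -> K) S T : S `<=` T -> (inc_span U S <= inc_span U T)%MS.
Proof. by move=> /fsubsetP ST; apply: inc_span_le => Q /ST; exact: inc_row_span. Qed.

Lemma inc_spanU m (U : 'I_m -> K) S T : (inc_span U (S `|` T) :=: inc_span U S + inc_span U T)%MS.
Proof.
apply/eqmxP/andP; split; last first.
  by rewrite addsmx_sub !inc_spanS ?fsubsetUl ?fsubsetUr.
apply: inc_span_le => Q; rewrite inE => /orP[] QS.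
  exact: submx_trans (inc_row_span U QS) (addsmxSl _ _).
exact: submx_trans (inc_row_span U QS) (addsmxSr _ _).
Qed.

Definition inc_rank m (U : 'I_m -> K) S : nat := \rank (inc_span U S).

Lemma inc_rankS m (U : 'I_m -> K) S T : S `<=` T -> (inc_rank U S <= inc_rank U T)%N.
Proof. by move=> ST; rewrite mxrankS// inc_spanS. Qed.

Lemma inc_rank_card m (U : 'I_m -> K) S : (inc_rank U S <= #|` S|)%N.
Proof.
rewrite /inc_rank /inc_span -sum1_size.
elim: (enum_fset S) => [|Q s IH]; first by rewrite !big_nil mxrank0.
rewrite !big_cons (leq_trans (mxrank_adds_leqif _ _))// leq_add//.
by rewrite mxrank_gen rank_leq_row.
Qed.

(** By dim(V + W) = dim V + dim W - dim(V :&: W), the gain from adding T is dim W minus the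
    dimension of an intersection that grows with S. *)
Lemma inc_rank_submod m (U : 'I_m -> K) S S' T : S `<=` S' ->
  (inc_rank U (S' `|` T) + inc_rank U S <= inc_rank U (S `|` T) + inc_rank U S')%N.
Proof.
move=> SS'; rewrite /inc_rank !inc_spanU.
have h1 := mxrank_sum_cap (inc_span U S) (inc_span U T).
have h2 := mxrank_sum_cap (inc_span U S') (inc_span U T).
have h3 : (\rank (inc_span U S :&: inc_span U T)%MS <=
           \rank (inc_span U S' :&: inc_span U T)%MS)%N.
  by rewrite mxrankS// capmxS// inc_spanS.
lia.
Qed.

Lemma inc_rank_incr m (U : 'I_m -> K) S T : (inc_rank U (S `|` T) <= inc_rank U S + #|` T|)%N.
Proof.
rewrite {1}/inc_rank inc_spanU (leq_trans (mxrank_adds_leqif _ _))//.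
by rewrite leq_add2l inc_rank_card.
Qed.

Definition inc_mx m (U : 'I_m -> K) S : 'M[rat]_(size S, m) :=
  \matrix_(i, j) inc (tnth (in_tuple S) i) (U j).

Lemma inc_mx_span m (U : 'I_m -> K) S : (inc_mx U S :=: inc_span U S)%MS.
Proof.
apply/eqmxP/andP; split.
  apply/row_subP => i; rewrite [row _ _](_ : _ = inc_row U (tnth (in_tuple S) i)).
    by apply: inc_row_span; exact: mem_tnth.
  by apply/rowP => j; rewrite !mxE.
apply: inc_span_le => Q QS.
have /tnthP[i ->] : Q \in in_tuple S by [].
rewrite [inc_row _ _](_ : _ = row i (inc_mx U S)) ?row_sub//.
by apply/rowP => j; rewrite !mxE.
Qed.

Lemma inc_mx_ker m (U : 'I_m -> K) S (u : 'rV[rat]_(size S)) :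
  (forall Q x, Q \in S -> inc Q x != 0 -> x \in codom U) ->
  u *m inc_mx U S = 0 <->
  forall x, \sum_i u 0 i * inc (tnth (in_tuple S) i) x = 0.
Proof.
move=> SU; split=> [/rowP u0 x|u0]; last first.
  by apply/rowP => j; rewrite !mxE -[RHS](u0 (U j));
    apply: eq_bigr => i _; rewrite mxE.
have [/codomP[j ->]|xU] := boolP (x \in codom U).
  by have := u0 j; rewrite !mxE => H; rewrite -[RHS]H; apply: eq_bigr => i _; rewrite mxE.
apply: big1 => i _; apply/eqP; rewrite mulf_eq0; apply/orP; right.
by apply: contraNT xU; apply: SU; exact: mem_tnth.
Qed.

(** The left kernel consists of the linear relations between boundaries, which do not refer to the
    chosen columns; the ranks agree because the kernels do. *)
Lemma inc_rank_universe m m' (U : 'I_m -> K) (U' : 'I_m' -> K) S :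
  (forall Q x, Q \in S -> inc Q x != 0 -> x \in codom U) ->
  (forall Q x, Q \in S -> inc Q x != 0 -> x \in codom U') ->
  inc_rank U S = inc_rank U' S.
Proof.
move=> SU SU'; rewrite /inc_rank -!inc_mx_span.
have : \rank (kermx (inc_mx U S)) = \rank (kermx (inc_mx U' S)).
  apply/eqP; rewrite eqn_leq !mxrankS//; apply/rV_subP => u;
    rewrite !sub_kermx => /eqP.
    by move=> /(inc_mx_ker _ SU') H; apply/eqP/(inc_mx_ker _ SU).
  by move=> /(inc_mx_ker _ SU) H; apply/eqP/(inc_mx_ker _ SU').
rewrite !mxrank_ker.
have := rank_leq_row (inc_mx U S); have := rank_leq_row (inc_mx U' S).
lia.
Qed.

End RankFunction.

Lemma inc_rank_map (K : choiceType) (inc : K -> K -> rat) (f : K -> K)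
    m (U : 'I_m -> K) (S : {fset K}) :
  injective f -> (forall P Q, inc (f P) (f Q) = inc P Q) ->
  inc_rank inc (f \o U) [fset f x | x in S] = inc_rank inc U S.
Proof.
move=> fI fE; rewrite /inc_rank /inc_span.
have pS : perm_eq [fset f x | x in S] (map f S).
  apply: uniq_perm; [exact: fset_uniq|by rewrite map_inj_uniq// fset_uniq|].
  by move=> x; apply/imfsetP/mapP => -[y yS ->]; exists y.
rewrite (perm_big _ pS)/= big_map; congr (\rank _); apply: eq_bigr => Q _.
by congr (<<_>>)%MS; apply/rowP => j; rewrite !mxE fE.
Qed.

(** * Independence of integral vectors and rational rank *)

Section IntegralIndependence.

Definition intmx m n (A : 'M[int]_(m, n)) : 'M[rat]_(m, n) := map_mx intr A.

Lemma common_denominator m n (A : 'M[rat]_(m, n)) :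
  exists2 D : int, D != 0 & exists B : 'M[int]_(m, n), intmx B = D%:~R *: A.
Proof.
pose D : int := \prod_(ij : 'I_m * 'I_n) denq (A ij.1 ij.2).
exists D; first by apply/prodf_neq0 => ij _; exact: denq_neq0.
exists (\matrix_(i, j) (numq (A i j) *
   \prod_(kl : 'I_m * 'I_n | kl != (i, j)) denq (A kl.1 kl.2))).
apply/matrixP => i j; rewrite !mxE /D [in RHS](bigD1 (i, j))//= !intrM numqE.
by rewrite -[LHS]mulrA [LHS]mulrC.
Qed.

Lemma intmxM m n r (A : 'M[int]_(m, n)) (B : 'M[int]_(n, r)) :
  intmx (A *m B) = intmx A *m intmx B.
Proof. exact: map_mxM. Qed.

Lemma intmx_eq0 m n (A : 'M[int]_(m, n)) : intmx A = 0 -> A = 0.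
Proof.
move=> /matrixP A0; apply/matrixP => i j; have := A0 i j; rewrite !mxE.
by move/eqP; rewrite intr_eq0 => /eqP.
Qed.

(* [BZ] is a lattice of integral vectors spanning [B] over the rationals. *)
Lemma integral_independence_rank N k m1 m2 (Z : 'M[rat]_(m1, N))
    (B : 'M[rat]_(m2, N)) (BZ : 'rV[int]_N -> Prop) :
  (B <= Z)%MS -> (forall v, BZ v -> (intmx v <= B)%MS) ->
  (forall v, (intmx v <= B)%MS -> exists2 m, m != 0 & BZ (m *: v)) ->
  (exists2 z : 'M[int]_(k, N), (intmx z <= Z)%MS &
     forall c : 'rV[int]_k, BZ (c *m z) -> c = 0) <->
  (k + \rank B <= \rank Z)%N.
Proof.
move=> BleZ BZ1 BZ2; split=> [[z zZ zind]|kle].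
  (* Clearing the denominators of u and then taking a further multiple lands in [BZ], where integral
     independence applies. So torsion in the quotient cannot create or destroy independent
     families. *)
  have ind (u : 'rV[rat]_k) : (u *m intmx z <= B)%MS -> u = 0.
    have [D D0 [u' uu']] := common_denominator u.
    move=> uB; have : (intmx (u' *m z) <= B)%MS.
      by rewrite intmxM uu' -scalemxAl scalemx_sub.
    move=> /BZ2[m m0]; rewrite scalemxAl => /zind /eqP.
    rewrite scalemx_eq0 (negbTE m0)/= => /eqP u'0; apply/eqP.
    move: uu'; rewrite u'0 /intmx map_mx0 => /esym /eqP.
    by rewrite scalemx_eq0 intr_eq0 (negbTE D0).
  have zk : \rank (intmx z) = k.
    apply/eqP; rewrite -[_ == _]/(row_free (intmx z)) -kermx_eq0.
    by apply/rowV0P => v /sub_kermxP vz; apply: ind; rewrite vz sub0mx.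
  have zB : (intmx z :&: B)%MS = 0.
    apply/eqP/rowV0P => v; rewrite sub_capmx => /andP[/submxP[u ->]] /ind ->.
    by rewrite mul0mx.
  rewrite -zk -mxrank_disjoint_sum// mxrankS// addsmx_sub zZ//.
(* Conversely, a complement of B in Z has dimension at least k; k rows of a basis of it, cleared of
   denominators, form the family sought. *)
pose W := (Z :\: B)%MS.
have rW : (k <= \rank W)%N.
  have := mxrank_cap_compl Z B; rewrite (capmx_idPr BleZ) -/W; lia.
pose W' : 'M[rat]_(k, N) := rowsub (widen_ord rW) (row_base W).
have W'W : (W' <= W)%MS.
  apply: submx_trans (rowsub_sub _ _) _; by rewrite eq_row_base.
have W'free (u : 'rV[rat]_k) : u *m W' = 0 -> u = 0.
  rewrite /W' -[row_base W]mul1mx -mul_rowsub_mx mulmxA => /eqP.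
  rewrite mulmx_free_eq0 ?row_base_free// => /eqP /rowP H.
  apply/rowP => i; have := H (widen_ord rW i); rewrite !mxE (bigD1 i)//= !mxE eqxx mulr1.
  rewrite big1 ?addr0// => j ji; rewrite !mxE -val_eqE /=.
  by rewrite (negbTE (ji : val j != val i)) mulr0.
have [D D0 [z zW]] := common_denominator W'.
exists z; first by rewrite zW scalemx_sub// (submx_trans W'W)// diffmxSl.
move=> c /BZ1; rewrite intmxM zW -scalemxAr => cB.
apply: intmx_eq0; apply: W'free.
have : (D%:~R *: (intmx c *m W') <= (W :&: B))%MS.
  by rewrite sub_capmx cB andbT scalemx_sub// (submx_trans (submxMl _ _)).
by rewrite /W capmx_diff submx0 scalemx_eq0 intr_eq0 (negbTE D0)/= => /eqP.
Qed.

End IntegralIndependence.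

(** * Faces and boundaries of elementary cubes *)

Section Cubes.
Context {d : nat}.
Implicit Types (P Q : Cube d) (i j : 'I_d).

(** Inclusion of closed cubes as point sets, decided factor by factor: an edge must coincide with
    the edge of Q, and a point must be an integer point of the factor of Q. *)
Definition face_le P Q := [forall i, if P.2 i then Q.2 i && (Q.1 i == P.1 i)
  else (Q.1 i <= P.1 i) && (P.1 i <= Q.1 i + (Q.2 i : nat)%:Z)].

Lemma face_leP P Q : reflect (forall i, if P.2 i then Q.2 i && (Q.1 i == P.1 i)
  else (Q.1 i <= P.1 i) && (P.1 i <= Q.1 i + (Q.2 i : nat)%:Z)) (face_le P Q).
Proof. exact: forallP. Qed.

Lemma face_le_trans : transitive face_le.
Proof.
move=> Q P T /face_leP PQ /face_leP QT; apply/face_leP => i.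
move: (PQ i) (QT i); case: (P.2 i); case: (Q.2 i); case: (T.2 i) => //=; lia.
Qed.

Lemma face_lo_le Q i : Q.2 i -> face_le (face_lo Q i) Q.
Proof.
move=> Qi; apply/face_leP => j; rewrite /= ffunE; case: eqP => [->|_].
  by rewrite Qi; lia.
by case: (Q.2 j) => /=; rewrite ?eqxx//; lia.
Qed.

Lemma face_hi_le Q i : Q.2 i -> face_le (face_hi Q i) Q.
Proof.
move=> Qi; apply/face_leP => j; rewrite /= !ffunE; case: eqP => [->|_].
  by rewrite Qi; lia.
by case: (Q.2 j) => /=; rewrite ?eqxx//; lia.
Qed.

Lemma cdim_face (a : {ffun 'I_d -> int}) Q i : Q.2 i ->
  (cdim (a, [ffun j => if j == i then false else Q.2 j]) : nat).+1 = cdim Q.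
Proof.
move=> Qi; rewrite /cdim (bigD1 i)//= ffunE eqxx add0n [RHS](bigD1 i)//= Qi add1n.
by congr S; apply: eq_bigr => j /negbTE ji; rewrite ffunE ji.
Qed.

Lemma incidence_neq0 Q P : incidence Q P != 0 ->
  face_le P Q /\ (cdim P).+1 = cdim Q.
Proof.
rewrite /incidence => H.
have [i Qi Hi] : exists2 i, Q.2 i & (P == face_hi Q i) || (P == face_lo Q i).
  apply/exists_inP; apply: contraNT H => /exists_inPn H.
  apply/eqP; apply: big1 => i Qi; have := H i Qi; rewrite negb_or.
  by move=> /andP[/negbTE -> /negbTE ->]; rewrite subrr mulr0.
case/orP: Hi => /eqP ->; split; rewrite ?face_hi_le ?face_lo_le//; exact: cdim_face.
Qed.

Definition orient Q i : int := (-1) ^+ (\sum_(j < d | (j < i)%N) (Q.2 j : nat))%N.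

Lemma orient_face Q (a : {ffun 'I_d -> int}) i j : Q.2 i -> i != j ->
  orient (a, [ffun l => if l == i then false else Q.2 l]) j =
  if (i < j)%N then - orient Q j else orient Q j.
Proof.
move=> Qi ij; rewrite /orient /=; case: ifPn => ltij.
  rewrite (bigD1 i)//= ffunE eqxx add0n [in RHS](bigD1 i)//= Qi add1n exprS mulN1r opprK.
  by congr (_ ^+ _); apply: eq_bigr => l /andP[_ /negbTE li]; rewrite ffunE li.
congr (_ ^+ _); apply: eq_bigr => l lj; rewrite ffunE; case: eqP => // li.
by move: lj; rewrite li (negbTE ltij).
Qed.

(* The terms of the double boundary indexed by (i, j) and (j, i) cancel. *)
Lemma incidence_incidence Q P :
  \sum_(i < d | Q.2 i) orient Q i *
    (incidence (face_hi Q i) P - incidence (face_lo Q i) P) = 0.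
Proof.
pose F i j : int := orient Q i * (if (i < j)%N then - orient Q j else orient Q j) *
  ((P == face_hi (face_hi Q i) j)%:Z - (P == face_lo (face_hi Q i) j)%:Z
  - (P == face_hi (face_lo Q i) j)%:Z + (P == face_lo (face_lo Q i) j)%:Z).
have inc_face (a : {ffun 'I_d -> int}) i : Q.2 i ->
    let Q' := (a, [ffun l => if l == i then false else Q.2 l]) in
    incidence Q' P = \sum_(j < d | Q.2 j && (j != i))
      (if (i < j)%N then - orient Q j else orient Q j) *
      ((P == face_hi Q' j)%:Z - (P == face_lo Q' j)%:Z).
  move=> Qi Q'; rewrite /incidence; apply: eq_big => [j|j].
    by rewrite /= ffunE; case: eqP => _; rewrite ?andbF ?andbT.
  rewrite /= ffunE; case: eqP => // /eqP ji Qj.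
  by rewrite -(@orient_face _ a)// eq_sym.
transitivity (\sum_(i < d | Q.2 i) \sum_(j < d | Q.2 j && (j != i)) F i j).
  apply: eq_bigr => i Qi; rewrite [incidence (face_hi _ _) _]inc_face//.
  rewrite [incidence (face_lo _ _) _]inc_face// -sumrB mulr_sumr.
  by apply: eq_bigr => j _; rewrite /F /face_hi /face_lo /=; ring.
have Fanti i j : i != j -> F i j = - F j i.
  move=> ij; have ne : val i != val j by rewrite val_eqE.
  have hh : face_hi (face_hi Q i) j = face_hi (face_hi Q j) i.
    by congr pair; apply/ffunP => l; rewrite !ffunE /= ?ffunE; do 2!case: eqP.
  have ll : face_lo (face_lo Q i) j = face_lo (face_lo Q j) i.
    by congr pair; apply/ffunP => l; rewrite !ffunE /= ?ffunE; do 2!case: eqP.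
  have hl : face_lo (face_hi Q i) j = face_hi (face_lo Q j) i.
    by congr pair; apply/ffunP => l; rewrite !ffunE /= ?ffunE; do 2!case: eqP.
  have lh : face_hi (face_lo Q i) j = face_lo (face_hi Q j) i.
    by congr pair; apply/ffunP => l; rewrite !ffunE /= ?ffunE; do 2!case: eqP.
  rewrite /F hh ll hl lh; case: ltngtP ne => // _ _; ring.
set s := LHS.
have : s = - s.
  rewrite {1}/s (exchange_big_dep (fun j => Q.2 j))/=; last by move=> i j _ /andP[].
  rewrite /s -sumrN; apply: eq_bigr => i Qi; rewrite -sumrN.
  apply: eq_big => [j|j /and3P[_ _ ij]]; first by rewrite Qi /= eq_sym.
  by rewrite [LHS]Fanti// eq_sym.
lia.
Qed.

End Cubes.

(** * Betti numbers of a finite cubical set from boundary ranks *)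

Definition incidence_rat {d} (Q P : Cube d) : rat := (incidence Q P)%:~R.

Definition skel {d} (S : {fset Cube d}) (r : nat) : {fset Cube d} :=
  [fset Q in S | cdim Q == r].

Lemma emb_inj d n : injective (@emb d n).
Proof.
move=> [a e] [a' e'] [/ffunP H ->]; congr pair; apply/ffunP => i.
by have := H i; rewrite !ffunE => /addIr[ai]; exact/val_inj.
Qed.

Section Betti.
Context {d n : nat} (S : pred (BoxT d n)) (q : nat).
Let N := #|BoxT d n|.

Definition box_cube (j : 'I_N) : Cube d := emb (enum_val j).

Lemma box_cube_inj : injective box_cube.
Proof. by move=> i j /emb_inj /enum_val_inj. Qed.

Definition emb_fset : {fset Cube d} := [fset emb b | b : BoxT d n & S b].

Lemma mem_skel r (b : BoxT d n) :
  (emb b \in skel emb_fset r) = S b && (cdim (emb b) == r).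
Proof.
rewrite !inE /=; congr andb; apply/imfsetP/idP => [[b' /= Sb' /emb_inj ->//]|Sb].
by exists b.
Qed.

Lemma skel_box r Q : Q \in skel emb_fset r -> exists j, Q = box_cube j.
Proof.
rewrite !inE => /andP[/imfsetP[b /= _ ->] _].
by exists (enum_rank b); rewrite /box_cube enum_rankK.
Qed.

Hypothesis Sface : forall b P, S b -> face_le P (emb b) ->
  exists2 b', S b' & P = emb b'.

Definition bdry_mx : 'M[int]_N := \matrix_(i, j) incidence (box_cube i) (box_cube j).

(** Its row space is the space of rational r-chains of S inside the chains of the whole box. *)
Definition select r : 'M[rat]_(#|` skel emb_fset r|, N) :=
  \matrix_(i, j) (tnth (in_tuple (skel emb_fset r)) i == box_cube j)%:R.

Lemma selectP r (v : 'rV[rat]_N) :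
  reflect (forall j, v 0 j != 0 -> box_cube j \in skel emb_fset r)
    (v <= select r)%MS.
Proof.
apply: (iffP idP) => [/submxP[u ->] j|vS].
  rewrite mxE => /eqP; case: (boolP (box_cube j \in _)) => // jS [].
  apply: big1 => i _; rewrite mxE; case: eqP => [ij|_]; last by rewrite mulr0.
  by move: jS; rewrite -ij mem_tnth.
rewrite [v]row_sum_delta; apply: summx_sub => j _.
have [->|/vS jS] := eqVneq (v 0 j) 0; first by rewrite scale0r sub0mx.
apply: scalemx_sub; have /tnthP[i ji] : box_cube j \in in_tuple (skel emb_fset r) by [].
rewrite (_ : delta_mx 0 j = row i (select r)) ?row_sub//.
apply/rowP => l; rewrite !mxE eqxx /= -ji.
by rewrite (inj_eq box_cube_inj) eq_sym.
Qed.

Lemma rank_select r : \rank (select r) = #|` skel emb_fset r|.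
Proof.
apply/eqP; rewrite -[_ == _]/(row_free (select r)); apply/row_freeP.
exists (select r)^T; apply/matrixP => i i'; rewrite !mxE.
have [j ij] := skel_box (mem_tnth i (in_tuple (skel emb_fset r))).
rewrite (bigD1 j)//= !mxE ij eqxx mul1r big1 ?addr0 => [|l lj].
  by rewrite -ij eq_sym !(tnth_nth (box_cube j)) nth_uniq// fset_uniq.
by rewrite !mxE ij (inj_eq box_cube_inj) eq_sym (negbTE lj) mul0r.
Qed.

Lemma select_bdry r :
  select r *m intmx bdry_mx = inc_mx incidence_rat box_cube (skel emb_fset r).
Proof.
apply/matrixP => i l; rewrite !mxE.
have [j ij] := skel_box (mem_tnth i (in_tuple (skel emb_fset r))).
rewrite (bigD1 j)//= !mxE ij eqxx mul1r big1 ?addr0// => m mj.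
by rewrite !mxE ij (inj_eq box_cube_inj) eq_sym (negbTE mj) mul0r.
Qed.

Lemma skel_face r Q P : Q \in skel emb_fset r.+1 -> incidence Q P != 0 ->
  P \in skel emb_fset r.
Proof.
move=> + /incidence_neq0[PQ /eqP dPQ].
rewrite !inE => /andP[/imfsetP[b /= Sb Qb] /eqP dQ].
rewrite Qb in PQ; have [b' Sb' Pb'] := Sface Sb PQ; move: dPQ; rewrite dQ eqSS => dP.
apply/andP; split=> //; rewrite Pb'.
by apply/imfsetP; exists b'.
Qed.

Lemma select_bdry_bdry r :
  select r.+1 *m intmx bdry_mx *m intmx bdry_mx = 0.
Proof.
rewrite select_bdry; apply/matrixP => i l; rewrite !mxE.
pose Q := tnth (in_tuple (skel emb_fset r.+1)) i.
have QS : Q \in skel emb_fset r.+1 by exact: mem_tnth.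
transitivity ((\sum_j incidence Q (box_cube j) * incidence (box_cube j) (box_cube l))%:~R : rat).
  by rewrite rmorph_sum /=; apply: eq_bigr => j _; rewrite !mxE intrM.
rewrite (_ : \sum_j _ = 0)// -[RHS](incidence_incidence Q (box_cube l)).
rewrite {1}/incidence; under eq_bigr do rewrite mulr_suml.
rewrite exchange_big /=; apply: eq_bigr => k Qk.
rewrite -/(orient Q k); under eq_bigr do rewrite -mulrA.
rewrite -mulr_sumr; congr (_ * _).
have pick P : face_le P Q -> \sum_j ((box_cube j == P)%:Z * incidence (box_cube j) (box_cube l))
    = incidence P (box_cube l).
  move: QS; rewrite !inE => /andP[/imfsetP[b /= Sb ->] _] /(Sface Sb)[b' _ ->].
  rewrite (bigD1 (enum_rank b'))//= /box_cube enum_rankK eqxx mul1r big1 ?addr0// => j jb.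
  case: eqP => [/emb_inj jb'|_]; last by rewrite mul0r.
  by move: jb; rewrite -jb' enum_valK eqxx.
rewrite -(pick _ (face_hi_le Qk)) -(pick _ (face_lo_le Qk)) -sumrB.
by apply: eq_bigr => j _; rewrite mulrBl.
Qed.

Lemma intmxZ m1 m2 (a : int) (A : 'M[int]_(m1, m2)) : intmx (a *: A) = a%:~R *: intmx A.
Proof. exact: map_mxZ. Qed.

Lemma intmx_inj m1 m2 : injective (@intmx m1 m2).
Proof.
move=> A B /matrixP AB; apply/matrixP => i j; have := AB i j; rewrite !mxE.
exact: intr_inj.
Qed.

Let bdryZ (v : 'rV[int]_N) := exists2 b : 'rV[int]_N,
  forall j, b 0 j != 0 -> box_cube j \in skel emb_fset q.+1 & v = b *m bdry_mx.

(** [integral_independence_rank] with the cycles for Z, the rational boundaries of (q+1)-chains for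
    B and the integral boundaries for BZ. An integral vector that is a rational boundary has a
    multiple that is an integral boundary, so torsion is not counted. *)
Lemma indep_homology_rank k : indep_homology_family S q k <->
  (k + inc_rank incidence_rat box_cube (skel emb_fset q.+1)
     <= \rank (select q :&: kermx (intmx bdry_mx)))%N.
Proof.
rewrite /inc_rank -inc_mx_span -select_bdry.
rewrite -(@integral_independence_rank _ _ _ _ _ _ bdryZ); first last.
- move=> v /submxP[u]; rewrite mulmxA => vE.
  have [D D0 [b bE]] := common_denominator (u *m select q.+1).
  exists D => //; exists b.
    move=> j; have := @selectP q.+1 (intmx b) _ j.
    rewrite mxE intr_eq0; apply.
    by rewrite bE scalemx_sub// submxMl.
  by apply: intmx_inj; rewrite intmxZ intmxM bE -scalemxAl vE.
- move=> v [b bS ->]; rewrite intmxM submxMr//; apply/selectP => j.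
  by rewrite mxE intr_eq0; exact: bS.
- rewrite sub_capmx; apply/andP; split; last by apply/sub_kermxP; exact: select_bdry_bdry.
  rewrite select_bdry; apply/row_subP => i; apply/selectP => j.
  rewrite !mxE /incidence_rat intr_eq0; apply: skel_face.
  exact: mem_tnth.
have chainE r (c : BoxT d n -> int) : is_chain S r c <->
    (forall j, c (enum_val j) != 0 -> box_cube j \in skel emb_fset r).
  split=> [H j /H[Sj dj]|H b cb].
    by rewrite mem_skel Sj; apply/eqP.
  have := H (enum_rank b); rewrite /box_cube enum_rankK mem_skel => /(_ cb).
  by case/andP => ? /eqP.
have bdryE (c : BoxT d n -> int) p :
    bdry c p = ((\row_j c (enum_val j)) *m bdry_mx) 0 (enum_rank p).
  rewrite /bdry mxE (reindex (fun j : 'I_N => enum_val j : BoxT d n))/=;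
    last exact/onW_bij/enum_val_bij.
  by apply: eq_bigr => j _; rewrite !mxE /box_cube enum_rankK.
split=> [[z [zZ zind]]|[z zZ zind]].
  exists (\matrix_(i, j) z i (enum_val j)).
    apply/row_subP => i; have [zi1 zi2] := zZ i.
    rewrite sub_capmx; apply/andP; split.
      apply/selectP => j; rewrite !mxE intr_eq0.
      by move: j; apply/chainE.
    apply/sub_kermxP; rewrite (_ : row _ _ = intmx (\row_j z i (enum_val j))); last first.
      by apply/rowP => j; rewrite !mxE.
    rewrite -intmxM (_ : _ *m _ = 0) ?/intmx ?map_mx0//; apply/rowP => j.
    by have := zi2 (enum_val j); rewrite bdryE enum_valK => ->; rewrite mxE.
  move=> c [b bS cb]; have := zind (fun j => c 0 j).
  move=> H; apply/rowP => j; rewrite mxE; move: j; apply: H.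
  exists (fun p => b 0 (enum_rank p)); split.
    by apply/chainE => j; rewrite enum_valK; exact: bS.
  move=> p; rewrite bdryE; have := congr1 (fun M : 'rV_N => M 0 (enum_rank p)) cb.
  rewrite (_ : \row_j _ = b); last by apply/rowP => j; rewrite mxE enum_valK.
  by move=> <-; rewrite mxE; apply: eq_bigr => i _; rewrite mxE enum_rankK.
exists (fun i p => z i (enum_rank p)); split.
  move=> i; have := submx_trans (row_sub i _) zZ.
  rewrite sub_capmx => /andP[/selectP H1 /sub_kermxP H2]; split.
    by apply/chainE => j; have := H1 j; rewrite !mxE intr_eq0 enum_valK.
  move=> p; rewrite bdryE (_ : \row_j _ = row i z); last first.
    by apply/rowP => j; rewrite !mxE enum_valK.
  apply/eqP; rewrite -(intr_eq0 rat); apply/eqP.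
  move: H2; rewrite (_ : row _ _ = intmx (row i z)) -?intmxM; last first.
    by apply/rowP => j; rewrite !mxE.
  by move=> /intmx_eq0 ->; rewrite mxE.
move=> c [b [bS cb]].
suff /rowP H : \row_j c j = 0 by move=> j; have := H j; rewrite !mxE.
apply: zind; exists (\row_j b (enum_val j)).
  by move=> j; rewrite mxE; move: j; apply/chainE.
apply/rowP => j; have := cb (enum_val j); rewrite bdryE enum_valK => <-.
by rewrite mxE; apply: eq_bigr => i _; rewrite mxE.
Qed.

(** The maximum defining [betti] is the dimension of the cycles minus r_{q+1}, by
    [indep_homology_rank], and the dimension of the cycles is n_q - r_q by rank-nullity. *)
Lemma betti_rank :
  (betti S q + inc_rank incidence_rat box_cube (skel emb_fset q)
    + inc_rank incidence_rat box_cube (skel emb_fset q.+1)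
   = #|` skel emb_fset q|)%N.
Proof.
have := mxrank_mul_ker (select q) (intmx bdry_mx).
rewrite rank_select select_bdry inc_mx_span -/(inc_rank _ _ _) => <-.
set z := \rank _; set r1 := inc_rank _ _ (skel _ q.+1).
suff : (betti S q + r1 = z)%N by lia.
(* The empty family is independent, so the case k = 0 gives this inequality, which makes the natural
   subtraction below exact. *)
have r1z : (r1 <= z)%N.
  rewrite /z -[X in (X <= _)%N]add0n; apply/indep_homology_rank.
  by exists (fun i => fun=> 0); split => [[]//|c _ []].
have zN : (z <= N)%N by exact: rank_leq_col.
suff -> : betti S q = (z - r1)%N by lia.
apply/eqP; rewrite eqn_leq; apply/andP; split.
  by apply/bigmax_leqP => k /asboolP/indep_homology_rank; rewrite -/z -/r1; lia.
have lt : (z - r1 < N.+1)%N by lia.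
rewrite /betti (bigop.bigmax_sup (Ordinal lt))//=; apply/asboolP/indep_homology_rank.
by rewrite -/z -/r1; lia.
Qed.

End Betti.

(** * Windows and polymatroids *)

Section Windows.
Context {d : nat}.
Implicit Types (P Q : Cube d) (S T A B : {fset Cube d}) (x y : {ffun 'I_d -> int}).

Definition trans x Q : Cube d := ([ffun i => Q.1 i + x i], Q.2).

Lemma trans_inj x : injective (trans x).
Proof.
move=> [a e] [b f] [/ffunP H ->]; congr pair; apply/ffunP => i.
by have := H i; rewrite !ffunE => /addIr.
Qed.

Definition window_cube x k (ae : {ffun 'I_d -> 'I_k} * {ffun 'I_d -> bool}) :
  Cube d := ([ffun i => x i + (ae.1 i : nat)%:Z], ae.2).

(** Only the lower corner is constrained, so a cube may stick out by one unit. In exchange, disjoint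
    ranges of corners give disjoint sets of cubes, hence independent bits. *)
Definition window x (k : nat) : {fset Cube d} :=
  [fset window_cube x ae | ae in {: {ffun 'I_d -> 'I_k} * {ffun 'I_d -> bool}}].

Lemma mem_window x k Q :
  (Q \in window x k) = [forall i, (x i <= Q.1 i) && (Q.1 i < x i + k%:Z)].
Proof.
apply/imfsetP/forallP => [[[a e] _ ->] i|H].
  by rewrite /= ffunE /=; case: (a i) => u /= ku; move: (x i) => y; lia.
have k0 i : (`|Q.1 i - x i|%N < k)%N by have := H i; lia.
exists ([ffun i => Ordinal (k0 i)], Q.2) => //; case: Q H k0 => a e /= H k0.
by congr pair; apply/ffunP => i; rewrite !ffunE /=; have := H i; lia.
Qed.

Lemma windowP x k Q :
  reflect (forall i, x i <= Q.1 i < x i + k%:Z) (Q \in window x k).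
Proof. by rewrite mem_window; exact: forallP. Qed.

Lemma card_window x k : #|` window x k| = ((k * 2) ^ d)%N.
Proof.
rewrite /window card_imfset /=; last first.
  move=> [a e] [b f] [/ffunP H ->]; congr pair; apply/ffunP => i.
  by have := H i; rewrite !ffunE => /addrI[/val_inj].
by rewrite -cardE card_prod !card_ffun !card_ord card_bool expnMn.
Qed.

Lemma trans_window x y k :
  [fset trans y Q | Q in window x k] = window [ffun i => x i + y i] k.
Proof.
apply/fsetP => Q; apply/imfsetP/windowP => [[P /windowP PW ->] i|QW].
  by rewrite /= !ffunE; have := PW i; lia.
exists (trans [ffun i => - y i] Q).
  by apply/windowP => i; have := QW i; rewrite !ffunE /= ; lia.
case: Q {QW} => a e; congr pair; apply/ffunP => i; rewrite !ffunE /=; lia.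
Qed.

Lemma window_subset x y k l : (forall i, y i <= x i) ->
  (forall i, x i + k%:Z <= y i + l%:Z) -> window x k `<=` window y l.
Proof.
move=> yx xy; apply/fsubsetP => Q /windowP QW; apply/windowP => i.
by have := QW i; have := yx i; have := xy i; lia.
Qed.

(** The lower corner of a face differs from that of Q by 0 or 1 in each coordinate, hence the window
    of side 2 and the crude count 4^d. *)
Definition clq Q : {fset Cube d} := [fset P in window Q.1 2 | face_le P Q].

Lemma mem_clq P Q : (P \in clq Q) = face_le P Q.
Proof.
rewrite !inE /=; case: (boolP (face_le P Q)); rewrite ?andbF// andbT => /face_leP H.
by apply/windowP => i; have := H i; case: (P.2 i); case: (Q.2 i) => /=; lia.
Qed.

Lemma card_clq Q : (#|` clq Q| <= 4 ^ d)%N.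
Proof.
rewrite -[(4 ^ d)%N](card_window Q.1 2); apply: fsubset_leq_card.
by apply/fsubsetP => P; rewrite !inE => /andP[].
Qed.

Definition cl A : {fset Cube d} := \bigcup_(Q <- A) clq Q.

Lemma clP P A : reflect (exists2 Q, Q \in A & face_le P Q) (P \in cl A).
Proof.
apply: (iffP (bigfcupP _ _ _ _)) => [[Q]|[Q QA PQ]].
  by rewrite andbT mem_clq; exists Q.
by exists Q; rewrite ?andbT// mem_clq.
Qed.

Lemma clU A B : cl (A `|` B) = cl A `|` cl B.
Proof.
apply/fsetP => P; rewrite inE; apply/clP/orP => [[Q]|[|] /clP[Q QA PQ]].
- by rewrite inE => /orP[] QA PQ; [left|right]; apply/clP; exists Q.
- by exists Q; rewrite // inE QA.
- by exists Q; rewrite // inE QA orbT.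
Qed.

Lemma cl1 Q : cl [fset Q] = clq Q.
Proof. by rewrite /cl big_seq_fset1. Qed.

Lemma clS A B : A `<=` B -> cl A `<=` cl B.
Proof. by move/fsetUidPr => <-; rewrite clU fsubsetUl. Qed.

Lemma face_le_trans_cube x P Q : face_le (trans x P) (trans x Q) = face_le P Q.
Proof.
apply/face_leP/face_leP => H i; have := H i; rewrite /= ?ffunE;
  case: (P.2 i); case: (Q.2 i) => //=; lia.
Qed.

Lemma cl_trans x A : cl [fset trans x Q | Q in A] = [fset trans x Q | Q in cl A].
Proof.
apply/fsetP => P; apply/clP/imfsetP => [[_ /imfsetP[Q /= QA ->] PQ]|[P' /clP[Q QA P'Q] ->]].
  have PE : P = trans x (trans [ffun i => - x i] P).
    by case: P {PQ} => a e; congr pair; apply/ffunP => i; rewrite !ffunE /=; lia.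
  exists (trans [ffun i => - x i] P) => //; apply/clP; exists Q => //.
  by rewrite -(face_le_trans_cube x) -PE.
by exists (trans x Q); rewrite ?face_le_trans_cube// in_imfset.
Qed.

Lemma incidence_trans x P Q : incidence (trans x P) (trans x Q) = incidence P Q.
Proof.
rewrite /incidence; apply: eq_bigr => i _; congr (_ * (_%:Z - _%:Z)).
  rewrite (_ : face_hi (trans x P) i = trans x (face_hi P i)) ?(inj_eq (@trans_inj x))//.
  congr pair; apply/ffunP => j; rewrite !ffunE; case: eqP => // _; ring.
rewrite (_ : face_lo (trans x P) i = trans x (face_lo P i)) ?(inj_eq (@trans_inj x))//.
Qed.

Definition in_Lambda (n : nat) Q :=
  [forall i, (- n%:Z <= Q.1 i) && (Q.1 i + (Q.2 i : nat)%:Z <= n%:Z)].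

Lemma in_LambdaP n Q :
  reflect (forall i, (- n%:Z <= Q.1 i) && (Q.1 i + (Q.2 i : nat)%:Z <= n%:Z))
          (in_Lambda n Q).
Proof. exact: forallP. Qed.

Lemma in_Lambda_face n P Q : face_le P Q -> in_Lambda n Q -> in_Lambda n P.
Proof.
move=> /face_leP PQ /in_LambdaP QL; apply/in_LambdaP => i.
by have := PQ i; have := QL i; case: (P.2 i); case: (Q.2 i) => /=; lia.
Qed.

Definition clip n S : {fset Cube d} := [fset P in S | in_Lambda n P].

End Windows.

(** * Cube counts and boundary ranks as polymatroids *)

Section Polymatroids.
Context {R : realType} {d : nat}.
Implicit Types (S T : {fset Cube d}) (h : {fset Cube d} -> R).

(** Submodularity is stated as the decrease of increments, the form in which it is applied; the
    constant c bounds the increment per added cube. No value at the empty set is imposed. *)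
Record polymatroid (c : R) h : Prop := Polymatroid {
  pm_mono : forall S T, S `<=` T -> h S <= h T;
  pm_submod : forall S S' T, S `<=` S' -> h (S' `|` T) - h S' <= h (S `|` T) - h S;
  pm_incr : forall S T, h (S `|` T) - h S <= c * (#|` T|)%:R;
  pm_trans : forall x S, h [fset trans x Q | Q in S] = h S }.

Lemma skelU r S T : skel (S `|` T) r = skel S r `|` skel T r.
Proof. by apply/fsetP => Q; rewrite !inE /= andb_orl. Qed.

Lemma skelS r S T : S `<=` T -> skel S r `<=` skel T r.
Proof. by move/fsetUidPr => <-; rewrite skelU fsubsetUl. Qed.

Lemma skel_sub r S : skel S r `<=` S.
Proof. by apply/fsubsetP => Q; rewrite !inE => /andP[]. Qed.

Lemma skel_trans r x S :
  skel [fset trans x Q | Q in S] r = [fset trans x Q | Q in skel S r].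
Proof.
apply/fsetP => Q; rewrite !inE /=; apply/andP/imfsetP.
  by case=> /imfsetP[P /= PS ->] dP; exists P; rewrite // !inE /= PS.
case=> P /=; rewrite !inE => /andP[PS dP] ->; split=> //.
by apply/imfsetP; exists P.
Qed.

Lemma polymatroid_card_skel r : polymatroid 1 (fun S => (#|` skel S r|)%:R).
Proof.
split=> [S T ST|S S' T SS'|S T|x S].
- by rewrite ler_nat fsubset_leq_card// skelS.
- rewrite lerBlDr addrAC lerBrDr -!natrD ler_nat !skelU.
  have h1 := cardfsUI (skel S r) (skel T r); have h2 := cardfsUI (skel S' r) (skel T r).
  have h3 : (#|` skel S r `&` skel T r| <= #|` skel S' r `&` skel T r|)%N.
    by rewrite fsubset_leq_card// fsetSI// skelS.
  lia.
- rewrite mul1r lerBlDr -natrD ler_nat skelU.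
  have h1 := cardfsUI (skel S r) (skel T r).
  have := fsubset_leq_card (skel_sub r T); lia.
- by rewrite skel_trans card_imfset//; exact: trans_inj.
Qed.

(* Any set of columns containing all faces of [S] gives the same rank, see
   [bdry_rankE]. *)
Definition univ S : 'I_(#|` cl S|) -> Cube d := tnth (in_tuple (cl S)).
Arguments univ S _ : clear implicits.

Definition bdry_rank S : nat := inc_rank incidence_rat (univ S) S.

Lemma univ_support S S' Q x : S `<=` S' -> Q \in S -> incidence_rat Q x != 0 ->
  x \in codom (univ S').
Proof.
move=> /fsubsetP SS' QS; rewrite /incidence_rat intr_eq0 => /incidence_neq0[xQ _].
have /tnthP[i ->] : x \in in_tuple (cl S') by apply/clP; exists Q; rewrite // SS'.
exact: codom_f.
Qed.

Lemma bdry_rankE S m (U : 'I_m -> Cube d) :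
  (forall Q x, Q \in S -> incidence_rat Q x != 0 -> x \in codom U) ->
  inc_rank incidence_rat U S = bdry_rank S.
Proof. by move=> H; apply: inc_rank_universe => // Q x; exact: univ_support. Qed.

(** The columns used by [bdry_rank] vary with the set. The ranks become comparable once they are all
    computed over the columns of the largest set involved, or over translated columns for
    invariance. *)
Lemma polymatroid_bdry_rank r : polymatroid 1 (fun S => (bdry_rank (skel S r))%:R).
Proof.
have E S S' : S `<=` S' -> bdry_rank S = inc_rank incidence_rat (univ S') S.
  by move=> SS'; rewrite bdry_rankE// => Q x; exact: univ_support.
split=> [S T ST|S S' T SS'|S T|x S].
- by rewrite ler_nat (E _ _ (skelS r ST)) inc_rankS// skelS.
- rewrite lerBlDr addrAC lerBrDr -!natrD ler_nat.
  pose U := skel (S' `|` T) r.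
  rewrite !(E _ U) ?skelS ?fsubsetUl ?fsetSU ?(fsubset_trans SS') ?fsubsetUl//.
  by rewrite !skelU inc_rank_submod// skelS.
- rewrite mul1r lerBlDr -natrD ler_nat.
  pose U := skel (S `|` T) r.
  rewrite !(E _ U) ?skelS ?fsubsetUl// [X in inc_rank _ _ X]skelU.
  rewrite (leq_trans (inc_rank_incr _ _ _ _))// addnC leq_add2r.
  by rewrite fsubset_leq_card// skel_sub.
- congr _%:R; rewrite skel_trans; set T := skel S r.
  rewrite -(@bdry_rankE _ _ (trans x \o univ T)).
    by apply: inc_rank_map => [|P Q]; [exact: trans_inj|rewrite /incidence_rat incidence_trans].
  move=> _ y /imfsetP[P /= PT ->]; rewrite /incidence_rat intr_eq0.
  have -> : y = trans x (trans [ffun i => - x i] y).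
    by case: y => a e; congr pair; apply/ffunP => i; rewrite !ffunE /=; lia.
  rewrite incidence_trans => PY.
  have /codomP[j ->] : trans [ffun i => - x i] y \in codom (univ T).
    by apply: (univ_support (fsubset_refl _) PT); rewrite intr_eq0.
  exact: (codom_f (trans x \o univ T)).
Qed.

Lemma polymatroidD c c' h h' : polymatroid c h -> polymatroid c' h' ->
  polymatroid (c + c') (fun S => h S + h' S).
Proof.
move=> H H'; split=> [S T ST|S S' T SS'|S T|x S].
- by rewrite lerD ?(pm_mono H)// (pm_mono H').
- have := pm_submod H T SS'; have := pm_submod H' T SS'; lra.
- have := pm_incr H S T; have := pm_incr H' S T; nra.
- by rewrite (pm_trans H) (pm_trans H').
Qed.

End Polymatroids.

(** * Configurations *)

Section Configurations.
Context {R : realType} {d : nat}.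
Implicit Types (omega : Cube d -> R) (s : seq (Cube d)).

(** Turns inclusion of point sets into combinatorics. The barycenter of a cube lies in its relative
    interior, so any elementary cube containing it has the whole cube as a face; the two extreme
    corners test membership in the box. *)
Lemma cubes_in_XntE omega (t : R) n (b : BoxT d n) :
  cubes_in_Xnt omega t n b <->
  in_Lambda n (emb b) /\ exists2 Q, omega Q <= t & face_le (emb b) Q.
Proof.
rewrite /cubes_in_Xnt; split=> [/asboolP H|[/in_LambdaP bL [Q Qt /face_leP bQ]]].
  split.
    apply/in_LambdaP => i.
    have [|_ /(_ i)] := H (fun i => ((emb b).1 i)%:~R).
      by move=> j; rewrite lexx ler_int; split=> //; lia.
    have [|_ /(_ i)] := H (fun i => ((emb b).1 i + ((emb b).2 i : nat)%:Z)%:~R).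
      by move=> j; rewrite lexx ler_int; split=> //; lia.
    move=> [_ h1] [h2 _]; move: h1 h2.
    by rewrite -[n%:R]/(n%:Z%:~R) -mulrNz !ler_int => -> ->.
  pose m i : R := ((emb b).1 i)%:~R + ((emb b).2 i : nat)%:R / 2.
  have [|[Q [Qt Qm]] _] := H m.
    move=> i; rewrite /m intrD; case: ((emb b).2 i) => /=; split; lra.
  exists Q => //; apply/face_leP => i; have := Qm i; rewrite /m.
  case: ((emb b).2 i) => /= -[h1 h2]; last first.
    by move: h1 h2; rewrite mul0r addr0 !ler_int => -> ->.
  have h1' : Q.1 i < (emb b).1 i + 1 by rewrite -(ltr_int R) intrD; lra.
  have h2' : (emb b).1 i < Q.1 i + (Q.2 i : nat)%:Z by rewrite -(ltr_int R); lra.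
  by move: h1' h2'; case: (Q.2 i) => /=; lia.
apply/asboolP => x xb; split.
  exists Q; split => // i; have [h1 h2] := xb i; have := bQ i.
  split.
    apply: le_trans h1; rewrite ler_int.
    by move: (bQ i); case: ((emb b).2 i); case: (Q.2 i) => //=; lia.
  apply: (le_trans h2); rewrite ler_int.
  by move: (bQ i); case: ((emb b).2 i); case: (Q.2 i) => //=; lia.
move=> i; have [h1 h2] := xb i; have := bL i => /andP[h3 h4].
rewrite -[n%:R]/(n%:Z%:~R) -mulrNz; split.
  by apply: le_trans h1; rewrite ler_int.
by apply: (le_trans h2); rewrite ler_int.
Qed.

(** Lower corners range over -(n+1), ..., n: a cube starting at -(n+1) or n may protrude from the
    box and still contribute a face inside it. *)
Definition big_window n : {fset Cube d} :=
  window [ffun=> - (n%:Z + 1)] (2 * n + 2).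

Definition config s (t : R) omega : {fset Cube d} := [fset Q in s | omega Q <= t].

Lemma in_Lambda_emb n (P : Cube d) : in_Lambda n P -> exists b : BoxT d n, P = emb b.
Proof.
move=> /in_LambdaP PL.
have k0 i : (absz (P.1 i + n%:Z)%R < 2 * n + 1)%N by have := PL i; lia.
exists ([ffun i => Ordinal (k0 i)], P.2); case: P PL k0 => a e PL k0.
by congr pair; apply/ffunP => i; rewrite !ffunE /=; have := PL i; move=> /=; lia.
Qed.

Lemma emb_fset_Xnt omega t n :
  emb_fset (cubes_in_Xnt omega t n) = clip n (cl (config (big_window n) t omega)).
Proof.
apply/fsetP => P; rewrite !inE /=; apply/imfsetP/andP.
  move=> [b /= /cubes_in_XntE[bL [Q Qt bQ]] ->]; split=> //.
  apply/clP; exists Q => //; rewrite !inE /= Qt andbT.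
  apply/windowP => i; rewrite ffunE.
  move/in_LambdaP: bL => /(_ i); move/face_leP: bQ => /(_ i).
  by case: ((emb b).2 i); case: (Q.2 i) => /=; lia.
move=> [/clP[Q]]; rewrite !inE /= => /andP[_ Qt] PQ PL.
have [b Pb] := in_Lambda_emb PL; exists b => //=; apply/cubes_in_XntE.
by rewrite -Pb; split=> //; exists Q.
Qed.

Definition betti_pos q (S : {fset Cube d}) : R := (#|` skel S q|)%:R.
Definition betti_neg q (S : {fset Cube d}) : R :=
  (bdry_rank (skel S q))%:R + (bdry_rank (skel S q.+1))%:R.

Lemma beta_qntE q n (t : R) (omega : Omega d R) :
  let S := clip n (cl (config (big_window n) t omega)) in
  (beta_qnt q n t omega)%:R = betti_pos q S - betti_neg q S.
Proof.
move=> S; rewrite /betti_pos /betti_neg /beta_qnt.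
have Sface (b : BoxT d n) P : cubes_in_Xnt omega t n b -> face_le P (emb b) ->
    exists2 b', cubes_in_Xnt omega t n b' & P = emb b'.
  move=> /cubes_in_XntE[bL [Q Qt bQ]] Pb.
  have PL := in_Lambda_face Pb bL; have [b' Pb'] := in_Lambda_emb PL.
  exists b' => //; apply/cubes_in_XntE; rewrite -Pb'; split=> //; exists Q => //.
  exact: face_le_trans Pb bQ.
have := betti_rank q Sface; rewrite emb_fset_Xnt -/S.
have rkE r : inc_rank incidence_rat (@box_cube d n) (skel S r) = bdry_rank (skel S r).
  apply: bdry_rankE => Q x; rewrite /S -emb_fset_Xnt !inE /= => /andP[/imfsetP[b /= Sb ->] _].
  rewrite /incidence_rat intr_eq0 => /incidence_neq0[xb _].
  have [b' _ ->] := Sface _ _ Sb xb.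
  by rewrite (_ : emb b' = box_cube (enum_rank b')) ?codom_f// /box_cube enum_rankK.
rewrite !rkE => <-; rewrite !natrD; lra.
Qed.

End Configurations.

(** * From product measures to finite expectations *)

Section ProductMeasure.
Context {R : realType} {d : nat} (P : probability (Omega d R) R) (t : R).
Implicit Types (s : seq (Cube d)) (F : {fset Cube d} -> R).

Lemma measurable_coordinate (Q : Cube d) :
  measurable_fun setT (fun omega : Omega d R => omega Q : R).
Proof.
apply: (measurability _ (measurable_realfun.RGenOpens.measurableE R)).
move=> _ [A [a [b ->]] <-]; rewrite setTI; apply: sub_sigma_algebra.
have cQ : continuous (fun omega : {ptws Cube d -> R} => omega Q).
  exact: (@proj_continuous (Cube d) (fun=> R) Q).
by move/continuousP: cQ; apply; exact: interval_open.
Qed.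

Lemma measurable_cylinder s (B : Cube d -> set R) : (forall Q, measurable (B Q)) ->
  measurable [set omega : Omega d R | forall Q, Q \in s -> B Q (omega Q)].
Proof.
move=> mB; elim: s => [|Q s IH].
  by rewrite (_ : [set _ | _] = setT); [exact: measurableT|apply/seteqP; split].
rewrite (_ : [set _ | _] = ([set omega : Omega d R | B Q (omega Q)] `&`
  [set omega : Omega d R | forall Q, Q \in s -> B Q (omega Q)])%classic).
  apply: measurableI => //; rewrite -[X in measurable X]setTI.
  exact: measurable_coordinate.
apply/seteqP; split=> [omega H|omega [H1 H2] Q'].
  by split=> [|Q' Q's]; apply: H; rewrite inE ?eqxx// Q's orbT.
by rewrite inE => /predU1P[->//|]; exact: H2.
Qed.

Lemma config_cons Q s (omega : Cube d -> R) : config (Q :: s) t omega =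
  if omega Q <= t then Q |` config s t omega else config s t omega.
Proof.
apply/fsetP => x; rewrite !inE /=; case: ifP => h; rewrite !inE /=;
by case: (eqVneq x Q) => [->|//] /=; rewrite h ?andbF.
Qed.

Lemma measurable_config s F :
  measurable_fun setT (fun omega : Omega d R => F (config s t omega)).
Proof.
elim: s F => [|Q s IH] F.
  rewrite (_ : (fun _ => _) = cst (F fset0)); first exact: measurable_cst.
  by apply/funext => omega; congr F; apply/fsetP => x; rewrite !inE.
rewrite (_ : (fun _ => _) = (fun omega : Omega d R => if omega Q <= t
   then F (Q |` config s t omega) else F (config s t omega))); last first.
  by apply/funext => omega; rewrite config_cons; case: ifP.
apply: measurable_fun_ifT; last 2 first.
- exact: (IH (fun A => F (Q |` A))).
- exact: IH.
by apply: measurable_fun_ler => //; exact: measurable_coordinate.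
Qed.

Definition bit_prob (Q : Cube d) : R := fine (P [set omega : Omega d R | omega Q <= t]).

Let measurable_le Q : measurable [set omega : Omega d R | omega Q <= t].
Proof.
rewrite (_ : [set _ | _] =
  [set omega : Omega d R | forall Q', Q' \in [:: Q] -> [set x : R | x <= t] (omega Q')]).
  apply: (@measurable_cylinder [:: Q] (fun=> [set x : R | x <= t])) => _.
  by rewrite (_ : [set x | _] = `]-oo, t]%classic).
by apply/seteqP; split=> [omega H Q'|omega]; [rewrite inE => /eqP ->|apply; rewrite inE].
Qed.

Lemma bit_prob01 Q : 0 <= bit_prob Q <= 1.
Proof.
rewrite /bit_prob fine_ge0//= -lee_fin fineK ?fin_num_measure//.
exact: probability_le1.
Qed.

Lemma bit_prob_trans x Q : stationary P -> bit_prob (trans x Q) = bit_prob Q.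
Proof.
move=> st; rewrite /bit_prob -(st [ffun i => - x i] [set omega : Omega d R | omega Q <= t])//.
congr (fine (P _)); apply/seteqP; split=> omega; rewrite /= /tau.
  rewrite (_ : shift_cube _ Q = trans x Q)//.
  by congr pair; apply/ffunP => i; rewrite !ffunE opprK.
rewrite (_ : shift_cube _ Q = trans x Q)//.
by congr pair; apply/ffunP => i; rewrite !ffunE opprK.
Qed.

Hypothesis prodP : product_measure P.

Lemma integral_config s F : uniq s ->
  (\int[P]_omega (F (config s t omega))%:E = (Ebern bit_prob s F)%:E)%E.
Proof.
move=> us.
pose cyl s' (B : Cube d -> set R) :=
  [set omega : Omega d R | forall Q, Q \in s' -> B Q (omega Q)].
(* [product_measure] speaks only of cylinders, so the induction carries a cylinder over coordinates
   [s'] disjoint from [s]; each step moves one coordinate into it and splits it according to the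
   bit. *)
suff main s' B : uniq (s ++ s') -> (forall Q, measurable (B Q)) ->
    (\int[P]_(omega in cyl s' B) (F (config s t omega))%:E =
     P (cyl s' B) * (Ebern bit_prob s F)%:E)%E.
  have := main [::] (fun=> setT); rewrite cats0 (_ : cyl _ _ = setT).
    by move=> ->//; rewrite probability_setT mul1e.
  by apply/seteqP; split.
elim: s F us s' B => [|Q s IH] F us s' B uss' mB.
  rewrite /= (_ : (fun _ => _) = cst (F fset0)%:E) ?integral_cst 1?muleC//.
    exact: measurable_cylinder.
  by apply/funext => omega; congr ((F _)%:E); apply/fsetP => x; rewrite !inE.
move: us uss' => /= /andP[Qs us]; rewrite mem_cat negb_or => /andP[/andP[_ Qs'] uss'].
pose Bu C Q' := if Q' == Q then C else B Q'.
have mBu C : measurable C -> forall Q', measurable (Bu C Q').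
  by move=> mC Q'; rewrite /Bu; case: ifP.
have mle : measurable [set x : R | x <= t].
  by rewrite (_ : [set x | _] = `]-oo, t]%classic).
have PBu C : measurable C ->
    P (cyl (Q :: s') (Bu C)) = (P [set omega : Omega d R | C (omega Q)] * P (cyl s' B))%E.
  move=> mC; rewrite /cyl !prodP//; [|by move: uss'; rewrite cat_uniq => /and3P[]|
    by rewrite /= Qs'; move: uss'; rewrite cat_uniq => /and3P[] | exact: mBu].
  rewrite big_cons /Bu eqxx; congr (_ * _)%E; apply: eq_big_seq => Q' Q's'.
  by case: eqP => // Q'Q; move: Qs'; rewrite -Q'Q Q's'.
have cylBu C omega : cyl (Q :: s') (Bu C) omega <-> C (omega Q) /\ cyl s' B omega.
  rewrite /cyl /Bu /=; split=> [H|[H1 H2] Q'].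
    split=> [|Q' Q's']; first by have := H Q; rewrite mem_head eqxx; apply.
    have := H Q'; rewrite inE Q's' orbT => /(_ isT); case: eqP => // Q'Q.
    by move: Qs'; rewrite -Q'Q Q's'.
  by rewrite inE => /predU1P[->|Q's']; rewrite ?eqxx//; case: eqP => [->//|_]; exact: H2.
set C1 := [set x : R | x <= t] in mle *.
have mC2 : measurable (~` C1) by exact: measurableC.
rewrite [in LHS](_ : cyl s' B =
  (cyl (Q :: s') (Bu C1) `|` cyl (Q :: s') (Bu (~` C1)))%classic); last first.
  apply/seteqP; split=> omega; last by case=> /cylBu[].
  by move=> H; have [h|h] := pselect (C1 (omega Q)); [left|right]; apply/cylBu.
have dis : disj_set (cyl (Q :: s') (Bu C1)) (cyl (Q :: s') (Bu (~` C1))).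
  apply/disj_setPS => omega [/cylBu[h1 _] /cylBu[h2 _]]; exact: h2.
have m1 : measurable (cyl (Q :: s') (Bu C1)) by apply: measurable_cylinder; exact: mBu.
have m2 : measurable (cyl (Q :: s') (Bu (~` C1))) by apply: measurable_cylinder; exact: mBu.
rewrite integral_setU//; last first.
  by apply: measurable_funTS; apply/measurable_EFinP; exact: measurable_config.
have uss2 : uniq (s ++ Q :: s').
  by rewrite uniq_catC /= mem_cat negb_or Qs Qs' uniq_catC.
rewrite (_ : (\int[P]_(omega in cyl (Q :: s') (Bu C1)) _ = 
  \int[P]_(omega in cyl (Q :: s') (Bu C1)) (F (Q |` config s t omega))%:E)%E); last first.
  apply: eq_integral => omega; rewrite inE => /cylBu[h _].
  by rewrite config_cons h.
rewrite (_ : (\int[P]_(omega in cyl (Q :: s') (Bu (~` C1))) _ = 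
  \int[P]_(omega in cyl (Q :: s') (Bu (~` C1))) (F (config s t omega))%:E)%E); last first.
  apply: eq_integral => omega; rewrite inE => /cylBu[/negP h _].
  by rewrite config_cons (negbTE h).
rewrite (IH (fun A => F (Q |` A)))//; last exact: mBu.
rewrite (IH F)//; last exact: mBu.
rewrite !PBu//.
rewrite (_ : P [set omega : Omega d R | C1 (omega Q)] = (bit_prob Q)%:E); last first.
  by rewrite /bit_prob fineK// fin_num_measure.
rewrite (_ : P [set omega : Omega d R | (~` C1) (omega Q)] = (1 - bit_prob Q)%:E); last first.
  rewrite EFinB /bit_prob fineK ?fin_num_measure// -probability_setC//.
have : P (cyl s' B) \is a fin_num by rewrite fin_num_measure//; exact: measurable_cylinder.
set E1 := Ebern _ _ _; set E2 := Ebern _ _ F; case: (P (cyl s' B)) => [r| |]// _.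
by rewrite -!EFinM -EFinD; congr EFin; ring.
Qed.

End ProductMeasure.

(** * Stabilization of increments *)

Lemma exprB_le (R : realFieldType) (x y : R) k : 0 <= y -> y <= x -> x <= 2 ->
  x ^+ k - y ^+ k <= k%:R * 2 ^+ k * (x - y).
Proof.
move=> y0 yx x2; elim: k => [|k IH]; first by rewrite !expr0 subrr !mul0r.
have x0 : 0 <= x by lra.
have xk : x ^+ k <= 2 ^+ k by rewrite lerXn2r// ?nnegrE//; lra.
have ykxk : y ^+ k <= x ^+ k by rewrite lerXn2r// nnegrE.
have yk0 : 0 <= y ^+ k by rewrite exprn_ge0.
rewrite !exprS -natr1.
rewrite (_ : _ - _ = x * (x ^+ k - y ^+ k) + y ^+ k * (x - y)); last by ring.
have p0 : 0 <= (2 : R) ^+ k by rewrite exprn_ge0.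
have h1 : x * (x ^+ k - y ^+ k) <= 2 * (k%:R * 2 ^+ k * (x - y)).
  by apply: ler_pM => //; lra.
have h2 : y ^+ k * (x - y) <= 2 ^+ k * (x - y) by rewrite ler_wpM2r//; lra.
have h3 : 0 <= 2 ^+ k * (x - y) by rewrite mulr_ge0//; lra.
nra.
Qed.

Section BallWindows.
Context {d : nat}.
Implicit Types (Q : Cube d) (r : nat).

Definition ball_window r Q : {fset Cube d} :=
  window [ffun i => Q.1 i - r%:Z] (2 * r + 1).

Lemma ball_windowP r Q Q' :
  reflect (forall i, Q.1 i - r%:Z <= Q'.1 i <= Q.1 i + r%:Z) (Q' \in ball_window r Q).
Proof.
apply: (iffP (windowP _ _ _)) => H i; have := H i; rewrite ffunE; lia.
Qed.

Lemma ball_window_center r Q : Q \in ball_window r Q.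
Proof. by apply/ball_windowP => i; lia. Qed.

Lemma ball_windowS r r' Q : (r <= r')%N -> ball_window r Q `<=` ball_window r' Q.
Proof. by move=> rr'; apply: window_subset => i; rewrite !ffunE; lia. Qed.

End BallWindows.

Section Increments.
Context {R : realType} {d : nat}.
Variables (c : R) (h : {fset Cube d} -> R).
Hypothesis (hP : polymatroid c h) (c0 : 0 <= c).
Implicit Types (Q : Cube d) (A B : {fset Cube d}).

Definition incr (F : {fset Cube d} -> R) Q A := F (Q |` A) - F A.

Let G A := h (cl A).
Let F n A := h (clip n (cl A)).

Lemma cl_add Q A : cl (Q |` A) = cl A `|` clq Q.
Proof. by rewrite clU cl1 fsetUC. Qed.

Lemma clipU n A B : clip n (A `|` B) = clip n A `|` clip n B.
Proof. by apply/fsetP => P; rewrite !inE andb_orl. Qed.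

Lemma clipS n A B : A `<=` B -> clip n A `<=` clip n B.
Proof. by move/fsetUidPr => <-; rewrite clipU fsubsetUl. Qed.

Lemma clip_sub n A : clip n A `<=` A.
Proof. by apply/fsubsetP => P; rewrite !inE => /andP[]. Qed.

Lemma clip_id n A : (forall P, P \in A -> in_Lambda n P) -> clip n A = A.
Proof.
move=> H; apply/fsetP => P; rewrite !inE /=.
by case: (boolP (P \in A)) => //= /H ->.
Qed.

Let C := c * (4 ^ d)%:R.

Lemma incr_full_ge0 Q A : 0 <= incr G Q A.
Proof. by rewrite subr_ge0 (pm_mono hP)// cl_add fsubsetUl. Qed.

Lemma incr_full_le Q A : incr G Q A <= C.
Proof.
rewrite /incr /G cl_add (le_trans (pm_incr hP _ _))//.
by rewrite ler_wpM2l// ler_nat card_clq.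
Qed.

Lemma incr_full_anti Q A B : A `<=` B -> incr G Q B <= incr G Q A.
Proof. by move=> AB; rewrite /incr /G !cl_add (pm_submod hP)// clS. Qed.

Lemma incr_clip_ge0 n Q A : 0 <= incr (F n) Q A.
Proof. by rewrite subr_ge0 (pm_mono hP)// clipS// cl_add fsubsetUl. Qed.

Lemma incr_clip_le n Q A : incr (F n) Q A <= C.
Proof.
rewrite /incr /F cl_add clipU (le_trans (pm_incr hP _ _))//.
rewrite ler_wpM2l// ler_nat (leq_trans _ (card_clq Q))//.
by rewrite fsubset_leq_card// clip_sub.
Qed.

Lemma incr_clip_anti n Q A B : A `<=` B -> incr (F n) Q B <= incr (F n) Q A.
Proof.
by move=> AB; rewrite /incr /F !cl_add !clipU (pm_submod hP)// clipS// clS.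
Qed.

(** All faces of Q survive the clipping while the set to which they are added shrinks, so
    submodularity applies. *)
Lemma incr_full_clip n Q A : in_Lambda n Q -> incr G Q A <= incr (F n) Q A.
Proof.
move=> QL; rewrite /incr /G /F !cl_add clipU [clip n (clq Q)]clip_id.
  by rewrite (pm_submod hP)// clip_sub.
by move=> P; rewrite mem_clq => /in_Lambda_face; apply.
Qed.

Lemma clip_cl_inner n A : (forall P, P \in A -> in_Lambda n P) -> F n A = G A.
Proof.
move=> AL; rewrite /F clip_id// => P /clP[Q QA PQ].
exact: in_Lambda_face PQ (AL _ QA).
Qed.

Lemma incr_full_trans x Q A :
  incr G (trans x Q) [fset trans x P | P in A] = incr G Q A.
Proof.
rewrite /incr /G (_ : trans x Q |` _ = [fset trans x P | P in Q |` A]).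
  by rewrite !cl_trans !(pm_trans hP).
by rewrite imfsetU imfset_fset1.
Qed.

Variable p : Cube d -> R.
Hypothesis p01 : forall Q, 0 <= p Q <= 1.
Hypothesis p_trans : forall x Q, p (trans x Q) = p Q.

Definition origin_cube (e : {ffun 'I_d -> bool}) : Cube d := ([ffun=> 0], e).

(** By translation invariance the mean increment depends on the cube only through its type e. Q is
    first deleted from A, since the random set may already contain it. *)
Definition mean_incr r e : R := Ebern p (ball_window r (origin_cube e))
  (fun A => incr G (origin_cube e) (A `\ origin_cube e)).

Lemma mean_incrE s r Q : uniq s -> {subset ball_window r Q <= s} ->
  Ebern p s (fun A => incr G Q ((A `&` ball_window r Q) `\ Q)) = mean_incr r Q.2.
Proof.
move=> us bs; rewrite (Ebern_restrict p (fun A => incr G Q (A `\ Q)))//.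
set O := origin_cube Q.2.
have QE : Q = trans Q.1 O.
  rewrite /O; case: (Q) => a e; congr pair; apply/ffunP => i.
  by rewrite !ffunE add0r.
have bE : ball_window r Q = [fset trans Q.1 P | P in ball_window r O].
  by rewrite trans_window; congr window; apply/ffunP => i; rewrite !ffunE /= ?ffunE; lia.
have pb : perm_eq (ball_window r Q) (map (trans Q.1) (ball_window r O)).
  apply: uniq_perm; [exact: fset_uniq|rewrite map_inj_uniq ?fset_uniq//; exact: trans_inj|].
  by move=> P; rewrite bE; apply/imfsetP/mapP => -[P' ? ->]; exists P'.
rewrite (Ebern_perm _ _ pb) Ebern_map//; apply: Ebern_ext => A.
rewrite {1 3}QE -[RHS](incr_full_trans Q.1); congr incr.
apply/fsetP => P; rewrite !inE; apply/andP/imfsetP.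
  move=> [PQ /imfsetP[P' /= P'A PE]]; exists P' => //=; rewrite !inE P'A andbT.
  by apply: contra PQ => /eqP P'O; rewrite PE P'O.
move=> [P' /=]; rewrite !inE => /andP[P'O P'A] ->; split.
  by rewrite (inj_eq (@trans_inj _ _)).
by apply/imfsetP; exists P'.
Qed.

Lemma mean_incr_anti r r' e : (r <= r')%N -> mean_incr r' e <= mean_incr r e.
Proof.
move=> rr'; pose s := enum_fset (ball_window r' (origin_cube e)).
rewrite -(@mean_incrE s r (origin_cube e)) ?fset_uniq//; last first.
  by apply/fsubsetP; exact: ball_windowS.
apply: Ebern_le => // A; apply: incr_full_anti.
by rewrite fsetSD// fsubsetIl.
Qed.

Lemma mean_incr_ge0 r e : 0 <= mean_incr r e.
Proof. by apply: Ebern_ge0 => // A; exact: incr_full_ge0. Qed.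

(** The mean increments are nonincreasing in r and nonnegative; summing over the finitely many types
    gives one radius valid for all of them. *)
Lemma mean_incr_cauchy (eps : R) : 0 < eps ->
  exists r, forall r' e, (r <= r')%N -> mean_incr r e - mean_incr r' e <= eps.
Proof.
move=> e0; pose M r := \sum_e mean_incr r e.
have Mni : nonincreasing_seq M.
  by move=> r r' rr'; apply: ler_sum => e _; exact: mean_incr_anti.
have Mc : cvgn M.
  apply: nonincreasing_is_cvgn => //; exists 0 => _ [r _ <-].
  by apply: sumr_ge0 => e _; exact: mean_incr_ge0.
have Mlim := nonincreasing_cvgn_ge Mni Mc.
have [r _ Hr] : \forall r \near \oo, `|limn M - M r| < eps.
  by move/cvgr_dist_lt : Mc; apply.
exists r => r' e rr'; have := Hr r (leqnn r); have := Mlim r'.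
move=> h1 h2; have : M r - M r' <= eps.
  by move: h2; rewrite distrC => /(le_lt_trans (ler_norm _)); lra.
apply: le_trans; rewrite /M -sumrB (bigD1 e)//= lerDl.
by apply: sumr_ge0 => e' _; rewrite subr_ge0 mean_incr_anti.
Qed.

Lemma add_del (Q : Cube d) A : Q |` (A `\ Q) = Q |` A.
Proof. by apply/fsetP => P; rewrite !inE; case: eqP. Qed.

(* Both increments lie between the increments of [G] in the windows of radius
   [r'] and [r] around [Q], whose expectations are close. *)
Lemma core_increment (S : {fset Cube d}) n B r r' Q : (r <= r')%N ->
  ball_window r Q `<=` B -> B `<=` S -> S `<=` ball_window r' Q ->
  (forall P, P \in ball_window r Q -> in_Lambda n P) ->
  Ebern p S (fun A => ((F n (Q |` A) - F n (A `\ Q)) -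
                       (G ((Q |` A) `&` B) - G ((A `\ Q) `&` B))) ^+ 2)
  <= C * (mean_incr r Q.2 - mean_incr r' Q.2).
Proof.
move=> rr' rB BS Sr' rL.
have QB : Q \in B by apply: (fsubsetP rB); exact: ball_window_center.
have QL : in_Lambda n Q by apply: rL; exact: ball_window_center.
have rE : Ebern p S (fun A => incr G Q ((A `&` ball_window r Q) `\ Q)) = mean_incr r Q.2.
  apply: mean_incrE; first exact: fset_uniq.
  exact/fsubsetP/(fsubset_trans rB BS).
have r'E : mean_incr r' Q.2 <= Ebern p S (fun A => incr G Q (A `\ Q)).
  rewrite -(@mean_incrE (ball_window r' Q) r' Q) ?fset_uniq//.
  rewrite -(@Ebern_restrict _ _ p (ball_window r' Q) (fun A => incr G Q (A `\ Q)) S)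
    ?fset_uniq//; last exact/fsubsetP.
  apply: Ebern_le_in => // A /fsubsetP Ab; apply: incr_full_anti.
  by rewrite (fsetIidPl Ab) fsetSD// fsubsetIl.
(* The compared increments both lie in [V, U], itself inside [0, C], so the squared difference is at
   most C (U - V). An L^2 bound thus follows from the difference of two expectations. *)
have : Ebern p S (fun A => C * (incr G Q ((A `&` ball_window r Q) `\ Q) -
    incr G Q (A `\ Q))) <= C * (mean_incr r Q.2 - mean_incr r' Q.2).
  rewrite EbernZ EbernB rE ler_wpM2l ?mulr_ge0//; lra.
apply: le_trans; apply: Ebern_le => // A.
rewrite (_ : F n (Q |` A) - F n (A `\ Q) = incr (F n) Q (A `\ Q)); last first.
  by rewrite /incr add_del.
rewrite (_ : G _ - G _ = incr G Q ((A `\ Q) `&` B)); last first.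
  rewrite /incr -add_del fsetIUl [X in G (X `|` _)](fsetIidPl _) ?fsub1set//.
set U := incr G Q (_ `\ _); set V := incr G Q (A `\ Q).
have FU : incr (F n) Q (A `\ Q) <= U.
  apply: le_trans (incr_clip_anti _ _ (fsetSD _ (fsubsetIl A (ball_window r Q)))) _.
  rewrite /U /incr !clip_cl_inner// => P; rewrite !inE.
    by move=> /and3P[_ _ /rL].
  by case/orP => [/eqP ->//|/and3P[_ _ /rL]].
have VF : V <= incr (F n) Q (A `\ Q) by exact: incr_full_clip.
have GU : incr G Q ((A `\ Q) `&` B) <= U.
  apply: incr_full_anti; rewrite fsetIDAC; apply: fsetSD; exact: fsetIS.
have VG : V <= incr G Q ((A `\ Q) `&` B) by apply: incr_full_anti; exact: fsubsetIl.
have UC : U <= C by exact: incr_full_le.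
have V0 : 0 <= V by exact: incr_full_ge0.
rewrite expr2; nra.
Qed.

End Increments.

(** * Decomposition of the box into blocks *)

Section Blocks.
Context {R : realType} {d : nat}.
Implicit Types (Q : Cube d) (A : {fset Cube d}) (h : {fset Cube d} -> R) (n L r : nat).

Definition block_index n L : finType := {ffun 'I_d -> 'I_(2 * n %/ L)}.

(** Blocks are half-open in the lower corner: disjoint as sets of cubes, although neighbouring
    closures share faces. Their cubes stay inside the box, so block values need no clipping and are
    identically distributed. *)
Definition block n L (j : block_index n L) : {fset Cube d} :=
  window [ffun i => (L * j i)%N%:Z - n%:Z] L.

Definition block_core n L r (j : block_index n L) : {fset Cube d} :=
  window [ffun i => (L * j i)%N%:Z - n%:Z + r%:Z] (L - 2 * r).

Lemma block_disjoint n L (j j' : block_index n L) Q :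
  Q \in block j -> Q \in block j' -> j = j'.
Proof.
move=> /windowP Qj /windowP Qj'; apply/ffunP => i; apply: val_inj => /=.
have := Qj i; have := Qj' i; rewrite !ffunE.
case: (ltngtP (j i) (j' i)) => // lt.
  have : (L * (j i).+1 <= L * j' i)%N by rewrite leq_mul.
  by rewrite mulnS; lia.
have : (L * (j' i).+1 <= L * j i)%N by rewrite leq_mul.
by rewrite mulnS; lia.
Qed.

Lemma block_bound n L (j : block_index n L) i : (L * j i + L <= 2 * n)%N.
Proof.
have := ltn_ord (j i); rewrite -ltnS => jm.
have : (L * (j i).+1 <= L * (2 * n %/ L))%N by rewrite leq_mul.
by rewrite mulnS [(L * (_ %/ _))%N]mulnC; have := leq_divM (2 * n) L; lia.
Qed.

Lemma block_Lambda n L (j : block_index n L) Q : Q \in block j -> in_Lambda n Q.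
Proof.
move=> /windowP Qj; apply/in_LambdaP => i; have := Qj i; have := block_bound j i.
by rewrite !ffunE; case: (Q.2 i) => /=; lia.
Qed.

Lemma block_window n L (j : block_index n L) : block j `<=` big_window n.
Proof. by apply: window_subset => i; rewrite !ffunE; have := block_bound j i; lia. Qed.

Lemma block_core_ball n L r (j : block_index n L) Q : Q \in block_core r j ->
  ball_window r Q `<=` block j.
Proof.
move=> /windowP Qj; apply: window_subset => i; have := Qj i; rewrite !ffunE; lia.
Qed.

Lemma block_core_sub n L r (j : block_index n L) : block_core r j `<=` block j.
Proof.
apply/fsubsetP => Q /block_core_ball /fsubsetP; apply; exact: ball_window_center.
Qed.

Definition full h A := h (cl A).
Definition clipped h n A := h (clip n (cl A)).
Definition block_sum h n L A := \sum_(j : block_index n L) full h (A `&` block j).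

Lemma block_sum_incr h n L (j : block_index n L) Q A : Q \in block j ->
  block_sum h n L (Q |` A) - block_sum h n L (A `\ Q) =
  full h ((Q |` A) `&` block j) - full h ((A `\ Q) `&` block j).
Proof.
move=> Qj; rewrite /block_sum -sumrB (bigD1 j)//= big1 ?addr0// => j' jj'.
apply/eqP; rewrite subr_eq0; apply/eqP; congr full; apply/fsetP => P; rewrite !inE.
case: (eqVneq P Q) => [->|//] /=; case: (boolP (Q \in block j')) => // Qj'.
by move: jj'; rewrite (block_disjoint Qj Qj') eqxx.
Qed.

Lemma block_sum_incr0 h n L Q A : (forall j : block_index n L, Q \notin block j) ->
  block_sum h n L (Q |` A) = block_sum h n L (A `\ Q).
Proof.
move=> Qn; apply: eq_bigr => j _; congr full; apply/fsetP => P; rewrite !inE.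
by case: (eqVneq P Q) => [->|//] /=; rewrite (negbTE (Qn j)).
Qed.

Definition block_error h n L A := clipped h n A - block_sum h n L A.

Section OneFunctional.
Variables (c : R) (h : {fset Cube d} -> R).
Hypotheses (hP : polymatroid c h) (c0 : 0 <= c).
Let C := c * (4 ^ d)%:R.

(** Toggling Q changes the box value and the block sum each by an amount in [0, C]. This is the only
    bound available for cubes outside the block cores. *)
Lemma block_error_le n L Q A :
  (block_error h n L (Q |` A) - block_error h n L (A `\ Q)) ^+ 2 <= C ^+ 2.
Proof.
have C0 : 0 <= C by rewrite mulr_ge0.
have F0 : 0 <= clipped h n (Q |` A) - clipped h n (A `\ Q).
  by rewrite -add_del; exact: (incr_clip_ge0 hP).
have FC : clipped h n (Q |` A) - clipped h n (A `\ Q) <= C.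
  by rewrite -add_del; exact: (incr_clip_le hP c0).
suff [S0 SC] : 0 <= block_sum h n L (Q |` A) - block_sum h n L (A `\ Q) /\
       block_sum h n L (Q |` A) - block_sum h n L (A `\ Q) <= C.
  rewrite /block_error; set a := clipped _ _ _ in F0 FC *.
  set b := clipped _ _ _ in F0 FC *; set a' := block_sum _ _ _ _ in S0 SC *.
  set b' := block_sum _ _ _ _ in S0 SC *; nra.
have [[j Qj]|Qn] := pselect (exists j : block_index n L, Q \in block j).
  rewrite (block_sum_incr _ _ Qj) -add_del fsetIUl [X in full h (X `|` _)](fsetIidPl _) ?fsub1set//.
  by split; [exact: (incr_full_ge0 hP)|exact: (incr_full_le hP c0)].
rewrite block_sum_incr0 ?subrr// => j; apply/negP => Qj; apply: Qn; by exists j.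
Qed.

Variable p : Cube d -> R.
Hypothesis p01 : forall Q, 0 <= p Q <= 1.
Hypothesis p_trans : forall x Q, p (trans x Q) = p Q.

Lemma block_error_core n L r r' (j : block_index n L) Q :
  Q \in block_core r j -> (r <= r')%N -> (2 * n + 2 <= r')%N ->
  Ebern p (big_window n)
    (fun A => (block_error h n L (Q |` A) - block_error h n L (A `\ Q)) ^+ 2) <=
  C * (mean_incr h p r Q.2 - mean_incr h p r' Q.2).
Proof.
move=> Qj rr' nr'; have Qb := fsubsetP (block_core_sub r j) _ Qj.
have /windowP QS := fsubsetP (block_window j) _ Qb.
(* Corner coordinates in the window lie between -(n+1) and n, so they differ by at most 2n + 1. *)
have Sr' : big_window n `<=` ball_window r' Q.
  apply/fsubsetP => P /windowP PS; apply/ball_windowP => i.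
  by have := PS i; have := QS i; rewrite !ffunE; lia.
have rL P : P \in ball_window r Q -> in_Lambda n P.
  by move=> /(fsubsetP (block_core_ball Qj)) /block_Lambda.
apply: le_trans (core_increment hP c0 p01 p_trans rr' (block_core_ball Qj)
  (block_window j) Sr' rL).
apply: Ebern_le => // A; rewrite le_eqVlt; apply/orP; left; apply/eqP; congr (_ ^+ 2).
rewrite -/(full h _) -/(full h ((A `\ Q) `&` _)) -(block_sum_incr _ _ Qb).
rewrite /block_error /clipped; ring.
Qed.

End OneFunctional.

Lemma card_big_window n : #|` @big_window d n| = (((2 * n + 2) * 2) ^ d)%N.
Proof. exact: (@card_window d). Qed.

Lemma card_block_core n L r :
  (\sum_(Q <- big_window n) [exists j : block_index n L, Q \in block_core r j] =
   ((2 * n %/ L) * ((L - 2 * r) * 2)) ^ d)%N.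
Proof.
transitivity (\sum_(Q <- big_window n) \sum_(j : block_index n L) (Q \in block_core r j))%N.
  apply: eq_bigr => Q _; case: existsP => [[j Qj]|Qn]; last first.
    by rewrite big1// => j _; apply/eqP; rewrite eqb0; apply/negP => Qj; apply: Qn; exists j.
  rewrite (bigD1 j)//= Qj big1// => j' jj'; apply/eqP; rewrite eqb0.
  apply: contra jj' => Qj'; apply/eqP.
  by apply: (@block_disjoint n L _ _ Q); apply: (fsubsetP (block_core_sub r _)).
rewrite exchange_big /= (eq_bigr (fun=> ((L - 2 * r) * 2) ^ d)%N) => [|j _].
  by rewrite sum_nat_const card_ffun !card_ord -expnMn.
rewrite -(card_window [ffun i => (L * j i)%N%:Z - n%:Z + r%:Z]) -/(block_core r j).
rewrite -sum1_size -big_mkcond/= [LHS](_ : _ =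
  \sum_(Q <- [seq Q <- big_window n | Q \in block_core r j]) 1)%N.
  apply: perm_big; apply: uniq_perm; rewrite ?filter_uniq ?fset_uniq// => Q.
  rewrite mem_filter; case: (boolP (Q \in block_core r j)) => //= Qj.
  by rewrite (fsubsetP (block_window j))// (fsubsetP (block_core_sub r j)).
by rewrite big_filter.
Qed.

Section Estimate.
Variables (c : R) (u v : {fset Cube d} -> R).
Hypotheses (uP : polymatroid c u) (vP : polymatroid c v) (c0 : 0 <= c).
Variable p : Cube d -> R.
Hypothesis p01 : forall Q, 0 <= p Q <= 1.
Hypothesis p_trans : forall x Q, p (trans x Q) = p Q.
Let C := c * (4 ^ d)%:R.

(** When u - v is the Betti number, this is its value in the box minus the sum of its values in the
    blocks. *)
Definition error n L A := block_error u n L A - block_error v n L A.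

(** Efron-Stein, with a small contribution from cubes in block cores and the uniform bound for all
    others. Each 4 is the 2 of (a - b)^2 <= 2a^2 + 2b^2 times the two functionals. *)
Lemma error_variance n L r r' (eps : R) : (r <= r')%N -> (2 * n + 2 <= r')%N ->
  (forall e, mean_incr u p r e - mean_incr u p r' e <= eps) ->
  (forall e, mean_incr v p r e - mean_incr v p r' e <= eps) ->
  Vbern p (big_window n) (error n L) <=
    4 * C * eps * (((2 * n + 2) * 2) ^ d)%:R +
    4 * C ^+ 2 * ((((2 * n + 2) * 2) ^ d)%:R -
                  (((2 * n %/ L) * ((L - 2 * r) * 2)) ^ d)%:R).
Proof.
move=> rr' nr' ue ve.
have C0 : 0 <= C by rewrite mulr_ge0.
have eps0 : 0 <= eps.
  by have := mean_incr_anti uP c0 p01 p_trans [ffun=> false] rr'; have := ue [ffun=> false]; lra.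
apply: le_trans (Efron_Stein p01 _ (fset_uniq _)) _.
pose core Q : nat := [exists j : block_index n L, Q \in block_core r j].
have bound Q : Ebern p (big_window n)
     (fun A => (error n L (Q |` A) - error n L (A `\ Q)) ^+ 2) <=
     4 * C * eps + 4 * C ^+ 2 * (1 - (core Q)%:R).
  have half A : (error n L (Q |` A) - error n L (A `\ Q)) ^+ 2 <=
     2 * (block_error u n L (Q |` A) - block_error u n L (A `\ Q)) ^+ 2 +
     2 * (block_error v n L (Q |` A) - block_error v n L (A `\ Q)) ^+ 2.
    rewrite /error; set a := block_error u _ _ _; set b := block_error u _ _ _.
    set a' := block_error v _ _ _; set b' := block_error v _ _ _.
    have := sqr_ge0 ((a - b) + (a' - b')); nra.
  apply: le_trans (Ebern_le p01 _ half) _; rewrite EbernD !EbernZ.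
  rewrite /core; case: existsP => [[j Qj]|_].
    have hu := block_error_core uP c0 p01 p_trans Qj rr' nr'.
    have hv := block_error_core vP c0 p01 p_trans Qj rr' nr'.
    have {}hu := le_trans hu (ler_wpM2l C0 (ue Q.2)).
    have {}hv := le_trans hv (ler_wpM2l C0 (ve Q.2)).
    rewrite subrr mulr0 addr0 (_ : 4 * C * eps = 2 * (C * eps) + 2 * (C * eps)); last by ring.
    by rewrite lerD// ler_wpM2l.
  have hu : Ebern p (big_window n) (fun A =>
      (block_error u n L (Q |` A) - block_error u n L (A `\ Q)) ^+ 2) <= C ^+ 2.
    rewrite -[X in _ <= X](Ebern_cst p (big_window n)); apply: Ebern_le => // A.
    exact: (block_error_le uP).
  have hv : Ebern p (big_window n) (fun A =>
      (block_error v n L (Q |` A) - block_error v n L (A `\ Q)) ^+ 2) <= C ^+ 2.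
    rewrite -[X in _ <= X](Ebern_cst p (big_window n)); apply: Ebern_le => // A.
    exact: (block_error_le vP).
  have Ce := mulr_ge0 C0 eps0; rewrite subr0 mulr1.
  apply: le_trans (lerD (ler_wpM2l _ hu) (ler_wpM2l _ hv)) _ => //; lra.
apply: le_trans (ler_sum _ (fun Q _ => bound Q)) _.
have cst (a : R) : \sum_(Q <- @big_window d n) a = a * (((2 * n + 2) * 2) ^ d)%:R.
  rewrite big_const_seq count_predT iter_addr_0 -[LHS]mulr_natr.
  by congr (_ * _%:R); exact: card_big_window.
rewrite big_split /= cst -mulr_sumr sumrB cst mul1r -natr_sum card_block_core.
exact: lexx.
Qed.

(** First r is chosen so that the mean increments have settled, then L large compared with r so that
    the cores fill most of each block, then n large compared with L so that the uncovered strip is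
    negligible. *)
Lemma error_variance_small (delta : R) : 0 < delta ->
  exists2 L, (0 < L)%N & exists N, forall n, (N <= n)%N ->
  Vbern p (big_window n) (error n L) <= delta * vol d n.
Proof.
move=> d0; have C0 : 0 <= C by rewrite mulr_ge0.
(* The constants collect the factors of the two terms of [error_variance]; the added 1 keeps them
   positive as divisors when c = 0. *)
pose K1 := 4 * C * 4 ^+ d + 1; have K10 : 0 < K1.
  by rewrite /K1 ltr_wpDl// ?mulr_ge0// exprn_ge0.
pose K2 := 4 * C ^+ 2 * (2 ^+ d * (d%:R * 2 ^+ d)) + 1; have K20 : 0 < K2.
  by rewrite /K2 ltr_wpDl// ?mulr_ge0// ?exprn_ge0.
have e10 : 0 < delta / 4 / K1 by rewrite !divr_gt0.
have [ru Hu] := mean_incr_cauchy uP c0 p01 p_trans e10.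
have [rv Hv] := mean_incr_cauchy vP c0 p01 p_trans e10.
pose r := maxn ru rv.
pose eta := delta / 4 / K2; have eta0 : 0 < eta by rewrite !divr_gt0.
pose L := (2 * r + (Num.truncn ((2 * r)%:R / eta)).+1)%N.
have L0 : (0 < L)%N by rewrite /L addnS.
have rL : (2 * r)%:R / L%:R <= eta.
  rewrite ler_pdivrMr ?ltr0n// mulrC -ler_pdivrMr//.
  have := truncnS_gt ((2 * r)%:R / eta); move=> /ltW /le_trans; apply.
  by rewrite ler_nat /L leq_addl.
pose N := (Num.truncn ((2 + L)%:R / eta)).+1.
exists L => //; exists N => n Nn.
have n0 : (0 < n)%N by exact: leq_trans Nn.
pose r' := maxn r (2 * n + 2).
have rr' : (r <= r')%N by rewrite leq_maxl.
apply: le_trans (error_variance L rr' (leq_maxr _ _) _ _) _.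
- by move=> e; apply: le_trans (Hu r' e _);
    [rewrite lerB// (mean_incr_anti uP)// leq_maxl|rewrite (leq_trans _ rr')// leq_maxl].
- by move=> e; apply: le_trans (Hv r' e _);
    [rewrite lerB// (mean_incr_anti vP)// leq_maxr|rewrite (leq_trans _ rr')// leq_maxr].
pose V : R := (2 * n)%:R; have V0 : 0 < V by rewrite ltr0n muln_gt0.
rewrite /vol -/V.
(* Relative to the side of the box, x is the side of the window and y the total length of the cores
   along one axis. Their gap consists of the strips of width r inside the blocks and of the leftover
   2 + L, each at most eta. *)
pose x : R := (2 * n + 2)%:R / V; pose y : R := ((2 * n %/ L) * (L - 2 * r))%:R / V.
have y0 : 0 <= y by rewrite divr_ge0// ltW.
have x2 : x <= 2.
  rewrite ler_pdivrMr// /V -natrM ler_nat; clear -n0; lia.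
have yx : y <= x.
  rewrite ler_pM2r ?invr_gt0// ler_nat.
  have h1 : ((2 * n %/ L) * (L - 2 * r) <= (2 * n %/ L) * L)%N by rewrite leq_mul2l leq_subr orbT.
  by rewrite (leq_trans h1)// (leq_trans (leq_divM _ _))// leq_addr.
have xy : x - y <= eta + eta.
  have h2 : (2 * n < (2 * n %/ L).+1 * L)%N by rewrite ltn_ceil.
  have h3 : ((2 * n %/ L) * (L - 2 * r) + (2 * n %/ L) * (2 * r) = (2 * n %/ L) * L)%N.
    by rewrite -mulnDr subnK// /L leq_addr.
  have h4 : ((2 * n %/ L) * L <= 2 * n)%N by exact: leq_divM.
  have h5 : ((2 * n %/ L) * (2 * r))%:R / V <= eta.
    rewrite ler_pdivrMr// natrM; apply: le_trans (_ : (V / L%:R) * (2 * r)%:R <= _).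
      rewrite ler_wpM2r// ler_pdivlMr ?ltr0n// -natrM ler_nat; exact: h4.
    by rewrite mulrAC -mulrA mulrC ler_wpM2r// ltW.
  have h6 : (2 + L)%:R / V <= eta.
    rewrite ler_pdivrMr// mulrC -ler_pdivrMr//.
    have := truncnS_gt ((2 + L)%:R / eta); move=> /ltW /le_trans; apply.
    by rewrite /V ler_nat (leq_trans Nn)// leq_pmull.
  apply: le_trans (lerD h6 h5); rewrite /x /y -mulrBl -mulrDl ler_pM2r ?invr_gt0//.
  rewrite lerBlDr -!natrD ler_nat; move: h2 h3; rewrite mulSn; clear; lia.
have dxy := exprB_le d y0 yx x2.
have sE : (((2 * n + 2) * 2) ^ d)%:R = x ^+ d * V ^+ d * 2 ^+ d.
  by rewrite natrX natrM -!exprMn divfK// gt_eqF.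
have cE : (((2 * n %/ L) * ((L - 2 * r) * 2)) ^ d)%:R = y ^+ d * V ^+ d * 2 ^+ d.
  by rewrite natrX mulnA natrM -!exprMn divfK// gt_eqF.
rewrite {}sE {}cE.
have Vd : 0 < V ^+ d by rewrite exprn_gt0.
set e1 := delta / 4 / K1.
have e1E : 4 * C * 4 ^+ d * e1 <= delta / 4.
  rewrite /e1 mulrA ler_pdivrMr// mulrC ler_wpM2l//; first by rewrite divr_ge0// ltW.
  by rewrite /K1 lerDl.
have xd : x ^+ d <= 2 ^+ d by rewrite lerXn2r ?nnegrE// (le_trans y0).
have Vd0 := ltW Vd; have e1_ge0 : 0 <= e1 by exact: ltW.
have h1 : 4 * C * e1 * (x ^+ d * V ^+ d * 2 ^+ d) <= delta / 4 * V ^+ d.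
  rewrite (_ : 4 * C * e1 * _ = (4 * C * (x ^+ d * 2 ^+ d) * e1) * V ^+ d); last by ring.
  rewrite ler_wpM2r//; apply: le_trans e1E; rewrite ler_wpM2r// ler_wpM2l ?mulr_ge0//.
  have -> : 4 ^+ d = 2 ^+ d * 2 ^+ d :> R by rewrite -exprMn; congr (_ ^+ _); ring.
  by rewrite ler_wpM2r// exprn_ge0.
have h2 : 4 * C ^+ 2 * (x ^+ d * V ^+ d * 2 ^+ d - y ^+ d * V ^+ d * 2 ^+ d)
   <= delta / 2 * V ^+ d.
  rewrite (_ : 4 * C ^+ 2 * _ = (4 * C ^+ 2 * 2 ^+ d * (x ^+ d - y ^+ d)) * V ^+ d); last by ring.
  rewrite ler_wpM2r//.
  have c0' : 0 <= 4 * C ^+ 2 * 2 ^+ d by rewrite mulr_ge0 ?exprn_ge0// mulr_ge0 ?exprn_ge0.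
  have dd0 : 0 <= d%:R * 2 ^+ d :> R by rewrite mulr_ge0 ?exprn_ge0.
  apply: le_trans (ler_wpM2l c0' (le_trans dxy (ler_wpM2l dd0 xy))) _.
  rewrite (_ : _ * (_ * _) = 2 * ((K2 - 1) * eta)); last by rewrite /K2; ring.
  rewrite (_ : delta / 2 = 2 * (K2 * eta)); last by rewrite /eta; field; rewrite gt_eqF.
  by rewrite mulrBl mul1r ler_wpM2l// gerBl ltW.
have := lerD h1 h2; set z := _ + _; move=> /le_trans; apply.
by rewrite -mulrDl ler_wpM2r//; lra.
Qed.

End Estimate.
End Blocks.

(** * The central limit theorem *)

(** Disjoint blocks read disjoint bits, so summing over the bits of one block at a time produces one
    [random_step] each. The hypothesis for arbitrary [Psi] says that all blocks have the law of
    [Y]. *)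
Lemma Ebern_iid_sum (R : realType) (K : choiceType) (p : K -> R) (I : eqType)
    (J : seq I) (B : I -> {fset K}) (f Y : {fset K} -> R) (T : seq K) (c : R)
    (Phi : R -> R) (a : R) : uniq J ->
  (forall i j Q, i \in J -> j \in J -> Q \in B i -> Q \in B j -> i = j) ->
  (forall i Psi, i \in J -> Ebern p (B i) (fun A => Psi (f A) : R) =
                           Ebern p T (fun A => Psi (Y A))) ->
  Ebern p (flatten [seq enum_fset (B i) | i <- J])
    (fun A => Phi (a + c * \sum_(i <- J) f (A `&` B i))) =
  iter (size J) (random_step p T Y c) Phi a.
Proof.
elim: J a => [|i J IH] a /=; first by rewrite big_nil mulr0 addr0.
move=> /andP[iJ uJ] disj law; rewrite Ebern_cat.
(* The expectation over the remaining blocks, as a function of the value x of the first one. *)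
pose Psi x := iter (size J) (random_step p T Y c) Phi (a + c * x).
rewrite /random_step -(law i Psi) ?mem_head// /Psi.
apply: Ebern_ext_in => A AB; rewrite -IH//; first last.
- by move=> j Psi' jJ; apply: law; rewrite inE jJ orbT.
- by move=> j k Q jJ kJ; apply: disj; rewrite inE ?jJ ?kJ orbT.
apply: Ebern_ext_in => A' A'B; congr Phi; rewrite big_cons mulrDr addrA.
have A'i Q : Q \in A' -> Q \notin B i.
  move=> /A'B /flatten_mapP[j jJ Qj]; apply/negP => Qi.
  have ij : i = j by apply: (disj i j Q) => //; rewrite ?mem_head// inE jJ orbT.
  by move: iJ; rewrite ij jJ.
congr (_ + _ * f _ + _ * _).
  apply/fsetP => Q; rewrite !inE; apply/andP/idP => [[/orP[//|/A'i/negP]]//|QA].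
  by rewrite QA AB.
apply: eq_big_seq => j jJ; congr f; apply/fsetP => Q; rewrite !inE.
case: (boolP (Q \in B j)) => Qj; rewrite ?andbF// !andbT.
case: (boolP (Q \in A)) => //= /AB Qi.
have ij : i = j by apply: (disj i j Q) => //; rewrite ?mem_head// inE jJ orbT.
by move: iJ; rewrite ij jJ.
Qed.

(** * Volume asymptotics *)

Section VolumeLimits.
Context {R : realType} {d : nat}.
Hypothesis d0 : (0 < d)%N.

Definition norm_factor n : R := (Num.sqrt (vol d n))^-1.

Lemma vol_ge0 n : 0 <= vol d n :> R.
Proof. by rewrite exprn_ge0. Qed.

Lemma norm_factor_ge0 n : 0 <= norm_factor n.
Proof. by rewrite invr_ge0 sqrtr_ge0. Qed.

Lemma norm_factor_sqr n : norm_factor n ^+ 2 = (vol d n)^-1.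
Proof. by rewrite exprVn sqr_sqrtr// vol_ge0. Qed.

Lemma vol_ge n : (0 < n)%N -> n%:R <= vol d n :> R.
Proof.
move=> n0; rewrite /vol; apply: le_trans (_ : (2 * n)%:R <= _).
  by rewrite ler_nat leq_pmull.
by rewrite -natrX ler_nat -[X in (X <= _)%N]expn1 leq_pexp2l// muln_gt0.
Qed.

Lemma norm_factor_cvg : norm_factor @ \oo --> (0 : R).
Proof.
apply/cvgrPdist_le => e e0; near=> n.
have n0 : (0 < n)%N by near: n; exact: nbhs_infty_ge.
have ne : (e ^+ 2)^-1 <= n%:R by near: n; exact: nbhs_infty_ger.
have h : (e ^+ 2)^-1 <= vol d n by apply: le_trans ne (vol_ge n0).
rewrite sub0r normrN ger0_norm ?norm_factor_ge0//.
rewrite -(ler_pXn2r (n := 2)) ?nnegrE ?norm_factor_ge0 ?(ltW e0)//.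
have V0 : 0 < vol d n :> R by apply: lt_le_trans (vol_ge n0); rewrite ltr0n.
have e20 : 0 < e ^+ 2 by rewrite exprn_gt0.
by rewrite norm_factor_sqr -(invrK (e ^+ 2)) lef_pV2 ?posrE ?invr_gt0.
Unshelve. all: by end_near. Qed.

Lemma block_density_cvg L : (0 < L)%N ->
  (fun n => ((2 * n %/ L) ^ d)%:R * norm_factor n ^+ 2) @ \oo --> (L%:R^-1 ^+ d : R).
Proof.
move=> L0; have E n : ((2 * n %/ L) ^ d)%:R * norm_factor n ^+ 2 =
    ((2 * n %/ L)%:R / (2 * n)%:R : R) ^+ d.
  by rewrite norm_factor_sqr /vol expr_div_n natrX.
rewrite (_ : (fun n => _) = (fun n => ((2 * n %/ L)%:R / (2 * n)%:R : R) ^+ d)); last exact/funext.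
have H : (fun n => (2 * n %/ L)%:R / (2 * n)%:R : R) @ \oo --> (L%:R^-1 : R).
  apply/cvgrPdist_le => e e0; near=> n.
  have n0 : (0 < n)%N by near: n; exact: nbhs_infty_ge.
  have ne : e^-1 <= n%:R by near: n; exact: nbhs_infty_ger.
  have V0 : 0 < (2 * n)%:R :> R by rewrite ltr0n muln_gt0.
  have LR : 0 < L%:R :> R by rewrite ltr0n.
  have h1 : (2 * n < (2 * n %/ L).+1 * L)%N by rewrite ltn_ceil.
  have h2 : ((2 * n %/ L) * L <= 2 * n)%N by exact: leq_divM.
  have h1' : (2 * n)%:R / L%:R - 1 <= (2 * n %/ L)%:R :> R.
    by rewrite lerBlDr natr1 ler_pdivrMr// -natrM ler_nat ltnW.
  have h2' : (2 * n %/ L)%:R <= (2 * n)%:R / L%:R :> R.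
    by rewrite ler_pdivlMr// -natrM ler_nat.
  have -> : L%:R^-1 - (2 * n %/ L)%:R / (2 * n)%:R =
     ((2 * n)%:R / L%:R - (2 * n %/ L)%:R) / (2 * n)%:R :> R.
    by rewrite mulrBl mulrAC divff ?mul1r ?gt_eqF.
  rewrite normrM [X in _ * X]gtr0_norm ?invr_gt0// ler_pdivrMr//.
  have en : 1 <= e * n%:R by rewrite mulrC -ler_pdivrMr// mul1r.
  have nn : n%:R <= (2 * n)%:R :> R by rewrite ler_nat leq_pmull.
  have := ler_wpM2l (ltW e0) nn.
  rewrite ger0_norm ?subr_ge0//; lra.
exact: (cvg_comp _ _ H (@exprn_continuous R d _)).
Unshelve. all: by end_near. Qed.

End VolumeLimits.

Section BettiNumbers.
Context {R : realType} {d : nat}.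
Variables (c : R) (u v : {fset Cube d} -> R) (p : Cube d -> R).
Hypotheses (uP : polymatroid c u) (vP : polymatroid c v) (c0 : 0 <= c).
Hypotheses (p01 : forall Q, 0 <= p Q <= 1) (p_trans : forall x Q, p (trans x Q) = p Q).
Implicit Types (h : {fset Cube d} -> R) (A W : {fset Cube d}).

Definition local_value A := full u A - full v A.
Definition value n A := clipped u n A - clipped v n A.
Definition mean_value n := Ebern p (big_window n) (value n).
Definition normalized n A := (value n A - mean_value n) / Num.sqrt (vol d n).

Lemma full_bounded h W : polymatroid c h ->
  exists M, forall A, `|full h (A `&` W)| <= M.
Proof.
move=> hP; exists (`|h fset0| + `|h (cl W)|) => A.
have h1 : h fset0 <= full h (A `&` W) by apply: (pm_mono hP); exact: fsub0set.
have h2 : full h (A `&` W) <= h (cl W) by apply: (pm_mono hP); rewrite clS// fsubsetIr.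
have := ler_norm (h (cl W)); have := ler_norm (- h fset0); rewrite normrN.
have := normr_ge0 (h fset0); have := normr_ge0 (h (cl W)).
by rewrite ler_norml => *; apply/andP; split; lra.
Qed.

Lemma full_trans h x A : polymatroid c h ->
  full h [fset trans x Q | Q in A] = full h A.
Proof. by move=> hP; rewrite /full cl_trans (pm_trans hP). Qed.

(** Translation invariance makes the block values identically distributed. *)
Lemma Ebern_window_trans x k (Psi : R -> R) :
  Ebern p (window x k) (fun A => Psi (local_value A)) =
  Ebern p (window [ffun=> 0] k) (fun A => Psi (local_value A)).
Proof.
have E : window x k = [fset trans x Q | Q in window [ffun=> 0] k].
  by rewrite trans_window; congr window; apply/ffunP => i; rewrite !ffunE add0r.
rewrite (@Ebern_perm _ _ _ _ (map (trans x) (window [ffun=> 0] k))); last first.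
  apply: uniq_perm; [exact: fset_uniq|rewrite map_inj_uniq ?fset_uniq//; exact: trans_inj|].
  by move=> P; rewrite E; apply/imfsetP/mapP => -[P' ? ->]; exists P'.
rewrite Ebern_map//; apply: Ebern_ext => A.
by rewrite /local_value !full_trans.
Qed.

Lemma iid_approximation_value delta : 0 < delta ->
  iid_approximation p (fun n => big_window n) normalized (@norm_factor R d) delta.
Proof.
move=> delta0.
have [L L0 [N errN]] := error_variance_small uP vP c0 p01 p_trans delta0.
pose W := window [ffun=> 0 : int] L : {fset Cube d}.
pose mu := Ebern p W local_value.
(* Intersecting with W makes Y bounded on every set of cubes, as [iid_approximation] demands,
   without changing its law. *)
pose Y A := local_value (A `&` W) - mu.
have [Mu HMu] := full_bounded W uP; have [Mv HMv] := full_bounded W vP.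
have YW Psi : Ebern p W (fun A => Psi (Y A)) = Ebern p W (fun A => Psi (local_value A - mu)) :> R.
  apply: Ebern_ext_in => A /fsubsetP AW; congr Psi; congr (local_value _ - _).
  exact/fsetIidPl.
exists W, Y, (Mu + Mv + `|mu|), (L%:R^-1 ^+ d), (fun n => (2 * n %/ L) ^ d)%N,
  (fun n A => @norm_factor R d n * \sum_(j : block_index n L) (local_value (A `&` block j) - mu)).
have blockE n (j : block_index n L) (Psi : R -> R) :
    Ebern p (block j) (fun A => Psi (local_value A - mu)) = Ebern p W (fun A => Psi (Y A)).
  by rewrite YW; exact: (Ebern_window_trans _ _ (fun x => Psi (x - mu))).
split.
- move=> A; apply: le_trans (ler_normB _ _) _; rewrite lerD2r.
  by apply: le_trans (ler_normB _ _) _; apply: lerD.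
- rewrite (YW id) /=.
  by rewrite EbernB Ebern_cst subrr.
- move=> n Phi a; pose J := index_enum (@block_index d n L).
  have sJ : size J = ((2 * n %/ L) ^ d)%N.
    transitivity #|@block_index d n L|; last by rewrite card_ffun !card_ord.
    by rewrite -sum1_card -sum1_size; exact: eq_bigl.
  rewrite -sJ -(@Ebern_iid_sum _ _ p _ J (@block d n L) (fun A => local_value A - mu)); first last.
  + by move=> i Psi _; exact: blockE.
  + by move=> i j Q _ _; exact: block_disjoint.
  + exact: index_enum_uniq.
  (* The blocks do not exhaust the window; the bits outside their union U are summed out by
     [Ebern_restrict]. *)
  pose U := [fset Q in flatten [seq enum_fset (block j) | j <- J]].
  have UE Q : (Q \in U) = (Q \in flatten [seq enum_fset (block j) | j <- J]).
    by rewrite inE.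
  have jU (j : block_index n L) A : (A `&` U) `&` block j = A `&` block j.
    apply/fsetP => Q; rewrite !in_fsetI UE; case: (boolP (Q \in block j)); rewrite ?andbF// => Qj.
    rewrite (_ : Q \in flatten _) ?andbT//; apply/flatten_mapP.
    by exists j => //; rewrite mem_index_enum.
  have Uw : {subset U <= big_window n}.
    move=> Q; rewrite UE => /flatten_mapP[j _].
    exact: (fsubsetP (block_window j)).
  rewrite (@Ebern_perm _ _ p (flatten _) U); last first.
    apply: uniq_perm; [|exact: fset_uniq|by move=> Q; rewrite UE].
    have : uniq J by exact: index_enum_uniq.
    elim: (J) => [//|j J' IH] /= /andP[jJ' uJ'].
    rewrite cat_uniq fset_uniq IH// andbT; apply/hasPn => Q /flatten_mapP[j' j'J' Qj'].
    apply/negP => Qj; move: jJ'; rewrite (block_disjoint Qj Qj') j'J' //.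
  rewrite -(@Ebern_restrict _ _ p (big_window n) _ U) ?fset_uniq//.
  apply: Ebern_ext => A; congr (Phi (_ + _ * _)).
  by apply: eq_bigr => j _; rewrite jU.
- exact: block_density_cvg.
- near=> n; have Nn : (N <= n)%N by near: n; exact: nbhs_infty_ge.
  have n0 : (0 < n)%N by near: n; exact: nbhs_infty_ge.
  have V0 : 0 < vol d n :> R by rewrite exprn_gt0// ltr0n muln_gt0.
  (* With this mean, the centered error divided by the square root of the volume is exactly X - Z,
     so the variance bound is the required L^2 bound. *)
  have errE : Ebern p (big_window n) (error u v n L) =
      mean_value n - \sum_(j : @block_index d n L) mu.
    rewrite (@Ebern_ext _ _ p _ _ (fun A => value n A -
        \sum_(j : block_index n L) local_value (A `&` block j))).
      rewrite EbernB Ebern_sum; congr (_ - _); apply: eq_bigr => j _.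
      rewrite (Ebern_restrict p local_value)// ?fset_uniq//; last first.
        exact/fsubsetP/block_window.
      exact: (Ebern_window_trans _ _ id).
    by move=> A; rewrite /error /block_error /block_sum /value /local_value sumrB; ring.
  have := errN n Nn; rewrite /Vbern errE => errn.
  rewrite (@Ebern_ext _ _ p _ _ (fun A => (vol d n)^-1 * (error u v n L A -
     (mean_value n - \sum_(j : @block_index d n L) mu)) ^+ 2)); last first.
    move=> A; rewrite -norm_factor_sqr -exprMn; congr (_ ^+ 2).
    rewrite /normalized /norm_factor /error /block_error /block_sum /value /local_value.
    by rewrite !sumrB; ring.
  by rewrite EbernZ mulrC ler_pdivrMr.
Unshelve. all: by end_near. Qed.

End BettiNumbers.

Lemma polymatroid_weaken (R : realType) d (c c' : R) (h : {fset Cube d} -> R) :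
  c <= c' -> polymatroid c h -> polymatroid c' h.
Proof.
move=> cc' hP; split; [exact: (pm_mono hP)|exact: (pm_submod hP)| |exact: (pm_trans hP)].
by move=> S T; apply: le_trans (pm_incr hP S T) _; rewrite ler_wpM2r.
Qed.

Theorem theorem2p12 (R : realType) (d q : nat) (t : R)
  (P : probability (Omega d R) R) :
  (q < d)%N -> 0 <= t <= 1 ->
  supported_01 P -> stationary P -> ergodic P -> product_measure P ->
  exists s2 : R, 0 <= s2 /\
    ((fun n : nat =>
        Ex P (fun omega => ((beta_qnt q n t omega)%:R
                            - Ex P (fun w => (beta_qnt q n t w)%:R)) ^+ 2)
        / vol d n) @ \oo --> s2) /\
    conv_in_law_gauss P
      (fun n omega => ((beta_qnt q n t omega)%:R
                       - Ex P (fun w => (beta_qnt q n t w)%:R))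
                      / Num.sqrt (vol d n)) s2.
Proof.
move=> qd _ _ st _ prodP; have d0 : (0 < d)%N by case: (d) qd.
pose p := bit_prob P t.
have p01 : forall Q, 0 <= p Q <= 1 by move=> Q; exact: bit_prob01.
have p_trans x Q : p (trans x Q) = p Q by exact: bit_prob_trans.
pose u := betti_pos q : {fset Cube d} -> R; pose v := betti_neg q : {fset Cube d} -> R.
(* The two ranks in v add their constants to 1 + 1; u is weakened to the same constant. *)
have uP : polymatroid 2 u.
  by apply: polymatroid_weaken (polymatroid_card_skel q); lra.
have vP : polymatroid 2 v.
  apply: polymatroid_weaken (polymatroidD (polymatroid_bdry_rank q) (polymatroid_bdry_rank q.+1)).
  lra.
have betaE n omega : (beta_qnt q n t omega)%:R = value u v n (config (big_window n) t omega).
  exact: beta_qntE.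
have intE n (F : {fset Cube d} -> R) :
    (\int[P]_omega (F (config (big_window n) t omega))%:E)%E = (Ebern p (big_window n) F)%:E.
  by rewrite integral_config// fset_uniq.
have meanE n : Ex P (fun w => (beta_qnt q n t w)%:R) = mean_value u v p n.
  rewrite /Ex; under eq_integral do rewrite betaE.
  by rewrite intE.
have approx := iid_approximation_value uP vP (ler0n _ 2) p01 p_trans.
have c_cvg := @norm_factor_cvg R d d0.
have [s2 s20 Hs2] := second_moment_cvg p01 approx.
exists s2; split => //; split.
  move: Hs2; set G := (X in X @ _ --> _); set H := (X in _ -> X @ _ --> _).
  suff -> : H = G by [].
  apply/funext => n; rewrite /H /G meanE /Ex.
  under eq_integral do rewrite betaE.
  rewrite (intE n (fun A => (value u v n A - mean_value u v p n) ^+ 2)) /= mulrC -EbernZ.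
  apply: Ebern_ext => A; rewrite /normalized exprMn exprVn sqr_sqrtr ?vol_ge0//.
  by rewrite mulrC.
move=> f cf [M fM].
have [g0 -> Hg] := law_cvg p01 (@norm_factor_ge0 R d) c_cvg approx s20 Hs2 cf fM.
rewrite (_ : (fun n => _) = (fun n => (Ebern p (big_window n)
   (fun A => f (normalized u v p n A)))%:E)); 
  first by apply/fine_cvgP; split; [exact: nearW|exact: Hg].
apply/funext => n; rewrite meanE; under eq_integral do rewrite betaE.
exact: (intE n (fun A => f (normalized u v p n A))).
Qed.
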